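(* (1) For all skew shapes $A$ and $B$, the following implications and equivalences hold: - $s_A-s_B$ is $D$-positive $\Rightarrow$ $s_A-s_B$ is Schur-positive; - $s_A-s_B$ is Schur-positive $\Leftrightarrow$ $s_A-s_B$ is $\mathcal S$-positive; - $s_A-s_B$ is Schur-positive $\Rightarrow$ $s_A-s_B$ is $F$-positive $\Rightarrow$ $s_A-s_B$ is $M$-positive; - $\mathrm{supp}_D(A)\supseteq\mathrm{supp}_D(B)$ $\Leftrightarrow$ $\mathrm{supp}_s(A)\supseteq\mathrm{supp}_s(B)$ $\Leftrightarrow$ $\mathrm{supp}_{\mathcal S}(A)\supseteq\mathrm{supp}_{\mathcal S}(B)$; - $\mathrm{supp}_s(A)\supseteq\mathrm{supp}_s(B)$ $\Rightarrow$ $\mathrm{supp}_F(A)\supseteq\mathrm{supp}_F(B)$ $\Rightarrow$ $\mathrm{supp}_M(A)\supseteq\mathrm{supp}_M(B)$; - $s_A-s_B$ is Schur-positive $\Rightarrow$ $\mathrm{supp}_s(A)\supseteq\mathrm{supp}_s(B)$; $s_A-s_B$ is $F$-positive $\Rightarrow$ $\mathrm{supp}_F(A)\supseteq\mathrm{supp}_F(B)$; $s_A-s_B$ is $M$-positive $\Rightarrow$ $\mathrm{supp}_M(A)\supseteq\mathrm{supp}_M(B)$; - $\mathrm{supp}_F(A)\supseteq\mathrm{supp}_F(B)$ $\Rightarrow$ the overlap condition, meaning any one of the following three equivalent conditions: $\mathrm{rows}_k(A)\preceq\mathrm{rows}_k(B)$ for all $k\ge1$; $\mathrm{cols}_\ell(A)\preceq\mathrm{cols}_\ell(B)$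 for all $\ell\ge1$; $\mathrm{rects}_{k,\ell}(A)\le\mathrm{rects}_{k,\ell}(B)$ for all $k,\ell\ge1$. (2) Each of the one-directional implications ($\Rightarrow$) listed in (1), with the exception of the last one (from $F$-support containment to the overlap condition, for which strictness is not asserted), is strict: its converse fails for some pair of skew shapes $A$, $B$. (3) Restrict to pairs of skew shapes with $|A|=|B|$. Then the list in (1) is complete in the following sense. Consider the eight classes of conditions: $D$-positivity of $s_A-s_B$; Schur-positivity (equivalently $\mathcal S$-positivity) of $s_A-s_B$; $F$-positivity of $s_A-s_B$; $M$-positivity of $s_A-s_B$; containment of Schur supports (equivalently of $D$-supports, equivalently of $\mathcal S$-supports); containment of $F$-supports; containment of $M$-supports; the overlap condition (containments meaning that the support of $A$ contains that of $B$). Apart from the two possible exceptions ''overlap condition $\Rightarrow$ $\mathrm{supp}_F(A)\supseteq\mathrm{supp}_F(B)$'' and ''overlap condition $\Rightarrow$ $\mathrm{supp}_M(A)\supseteq\mathrm{supp}_M(B)$'', whose truth is not decided here, every implication between two of these classes that holds for all $A,B$ with $|A|=|B|$ is a consequence of the implications listed in (1). In particular, none of the following four implications holds for all pairs of skew shapes $A,B$ with $|A|=|B|$: - $\mathrm{supp}_s(A)\supseteq\mathrm{supp}_s(B)$ $\Rightarrow$ $s_A-s_B$ is $M$-positive; - $s_A-s_B$ is $F$-positive $\Rightarrow$ $\mathrm{supp}_s(A)\supseteq\mathrm{supp}_s(B)$; - $s_A-s_B$ is $M$-positive $\Rightarrow$ $\mathrm{rows}_k(A)\preceq\mathrm{rows}_k(B)$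 for all $k\ge1$; - $\mathrm{rows}_k(A)\preceq\mathrm{rows}_k(B)$ for all $k\ge1$ $\Rightarrow$ $s_A-s_B$ is $M$-positive.
   Context: A composition of $n$ is a sequence of positive integers with sum $n$; a partition is a weakly decreasing composition. Compositions $\alpha=(\alpha_1,\dots,\alpha_k)$ of $n$ correspond bijectively to subsets of $[n-1]=\{1,\dots,n-1\}$ via $S(\alpha)=\{\alpha_1,\alpha_1+\alpha_2,\dots,\alpha_1+\cdots+\alpha_{k-1}\}$. Young diagrams are left-justified with row $1$ at the top; a skew shape $\lambda/\mu$ is the Young diagram of $\lambda$ with the boxes of $\mu\subseteq\lambda$ removed from its top-left; $|A|$ is the number of boxes of $A$. Bases of quasisymmetric functions, indexed by compositions: - Monomial: $M_\alpha=\sum_{i_1<\cdots<i_k}x_{i_1}^{\alpha_1}\cdots x_{i_k}^{\alpha_k}$. - Fundamental: $F_\alpha=\sum_{S(\alpha)\subseteq S(\beta)\subseteq[n-1]}M_\beta$ for $\alpha$ of size $n$. - Quasisymmetric Schur functions $\mathcal S_\alpha$ (Haglund, Luoto, Mason, van Willigenburg): $\mathcal S_\alpha=\sum_T x^T$ over semistandard composition tableaux $T$ of shape $\alpha$, i.e. fillings by positive integers of the left-justified diagram with $\alpha_i$ boxes in row $i$ from the top, such that rows weakly decrease left to right, the leftmost column strictly increases top to bottom, and, extending $T$ by zeros to a rectangular array $\hat T$ with $\ell$ rows ($\ell$ the number of parts of $\alpha$) and $m$ columns ($m$ the largest part), for all $1\le i<j\le\ell$ and $2\le k\le m$: if $\hat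 T(j,k)\ne0$ and $\hat T(j,k)\ge\hat T(i,k)$ then $\hat T(j,k)>\hat T(i,k-1)$. They satisfy $s_\lambda=\sum_\alpha\mathcal S_\alpha$, summed over all compositions $\alpha$ whose weakly decreasing rearrangement is $\lambda$. - Dual immaculate functions $D_\alpha$ (Berg, Bergeron, Saliola, Serrano, Zabrocki): $D_\alpha=\sum_T x^T$ over fillings $T$ by positive integers of the left-justified diagram with $\alpha_i$ boxes in row $i$ from the top, with rows weakly increasing left to right and the first column strictly increasing top to bottom. For a partition $\lambda$ with $k$ parts, $s_\lambda=\sum_\sigma(-1)^\sigma D_{(\lambda_{\sigma_1}+1-\sigma_1,\dots,\lambda_{\sigma_k}+k-\sigma_k)}$, summed over permutations $\sigma$ of $[k]$ with $\lambda_{\sigma_i}+i-\sigma_i>0$ for all $i$, where $(-1)^\sigma$ is the sign of $\sigma$. Here $x^T=\prod_i x_i^{\#\{\text{entries of }T\text{ equal to }i\}}$. A standard Young tableau (SYT) of a skew shape $A$ with $n$ boxes is a filling by $1,\dots,n$, each used once, increasing along rows and down columns; its descent composition corresponds to the set of $i$ such that $i+1$ is in a strictly lower row than $i$. The skew Schur function is $s_A=\sum_TF_{\mathrm{comp}(T)}$ over SYT $T$ of shape $A$, where $\mathrm{comp}(T)$ is the descent composition; it is symmetric, and $s_\lambda=s_{\lambda/\emptyset}$ are the Schur functions. For a basis $X\in\{M,F,\mathcal S,D\}$, a function is $X$-positive if all its coefficients in the basis $X$ are nonnegative, and $\mathrm{supp}_X(A)$ is the set of $\alpha$ such that $X_\alpha$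 has nonzero coefficient in $s_A$. (For $X=D$, where coefficients may be negative, one may alternatively require the coefficient to be positive; the claim holds with either convention.) Schur-positivity and the Schur support $\mathrm{supp}_s(A)$ are defined likewise using the basis $\{s_\lambda\}$ of symmetric functions. For a skew shape $A$ with $r$ rows, $\mathrm{rows}_k(A)$ is the partition obtained by sorting the numbers $\mathrm{overlap}_k(i)$, $1\le i\le r-k+1$, into weakly decreasing order and omitting zeros, where $\mathrm{overlap}_k(i)$ is the number of columns occupied in common by rows $i,\dots,i+k-1$. The partition $\mathrm{cols}_\ell(A)$ is defined in the same way with the roles of rows and columns exchanged: it records, for each $\ell$ consecutive columns of $A$, the number of rows they occupy in common. $\mathrm{rects}_{k,\ell}(A)$ is the number of $k\times\ell$ rectangular subdiagrams ($k$ rows, $\ell$ columns) contained inside $A$. Dominance order, for partitions possibly of different sizes: $\lambda=(\lambda_1,\dots,\lambda_r)\preceq\mu=(\mu_1,\dots,\mu_s)$ if $\lambda_1+\cdots+\lambda_k\le\mu_1+\cdots+\mu_k$ for all $k=1,\dots,r$, where $\mu_i=0$ for $i>s$. *)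

(* Defs.v *)
(* Written over the Mathematical Components library. *)
From Stdlib Require Import Relation_Operators.
From mathcomp Require Import all_boot all_order all_algebra.

Set Implicit Arguments.
Unset Strict Implicit.
Unset Printing Implicit Defensive.

Import Order.TTheory GRing.Theory Num.Theory.

Definition is_comp (a : seq nat) : bool := 0 \notin a.

Definition is_part (a : seq nat) : bool := sorted geq a && is_comp a.

(* S(a), as the increasing sequence of its elements *)
Definition cuts (a : seq nat) : seq nat :=
  [seq sumn (take i a) | i <- iota 1 (size a).-1].

(* The composition a of n with S(a) = D, for D an increasing sequence of
   elements of {1, ..., n-1}; the only composition of 0 is the empty one. *)
Definition comp_of (n : nat) (D : seq nat) : seq nat :=
  if n == 0 then [::] else pairmap (fun p q => q - p) 0 (rcons D n).

Definition comps (n : nat) : seq (seq nat) :=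
  [seq comp_of n (mask b (iota 1 n.-1)) | b : n.-1.-tuple bool].

(* A formal power series in x_1, x_2, ... is given by its coefficients: the
   value at e is the coefficient of x_1^e_1 ... x_N^e_N, where N = size e.
   A monomial is thus represented by several sequences e, which differ by
   trailing zeros; the series below take the same value on all of them. *)
Definition series := seq nat -> int.

Definition sub_series (f g : series) : series := fun e => (f e - g e)%R.

Definition monomial (a : seq nat) : series := fun e =>
  Posz #|[set i : {ffun 'I_(size a) -> 'I_(size e)} |
       [forall p : 'I_(size a), forall q : 'I_(size a), (p < q) ==> (i p < i q)] &&
       [forall v : 'I_(size e),
          \sum_(p | i p == v) nth 0 a p == nth 0 e v]]|.

Definition fundamental (a : seq nat) : series := fun e =>
  (\sum_(b <- comps (sumn a) | all (mem (cuts b)) (cuts a)) monomial b e)%R.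

(* Rows and columns of diagrams are numbered from 0.  A filling by entries in
   {1, ..., N} of a diagram contained in an r x c rectangle is an r x c array
   over {0, ..., N} which vanishes exactly outside the diagram. *)
Definition diagram := nat -> nat -> bool.

Definition is_filling (D : diagram) N r c (T : 'M['I_N.+1]_(r, c)) : bool :=
  [forall i : 'I_r, forall j : 'I_c, (T i j != 0 :> nat) == D i j].

Definition occ N r c (T : 'M['I_N.+1]_(r, c)) (v : nat) : nat :=
  #|[set x : 'I_r * 'I_c | T x.1 x.2 == v :> nat]|.

(* x^T is the monomial with exponents e *)
Definition has_content (e : seq nat) r c (T : 'M['I_(size e).+1]_(r, c)) :
    bool :=
  [forall v : 'I_(size e), occ T v.+1 == nth 0 e v].

Definition comp_diagram (a : seq nat) : diagram := fun i j => j < nth 0 a i.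

Definition maxpart (a : seq nat) : nat := \max_(p <- a) p.

Definition first_col_incr N r c (T : 'M['I_N.+1]_(r, c)) : bool :=
  [forall i : 'I_r, forall i' : 'I_r, forall j : 'I_c,
     (j == 0 :> nat) && (i < i') ==> (T i j < T i' j)].

Definition is_ssct (a : seq nat) N (T : 'M['I_N.+1]_(size a, maxpart a)) :
    bool :=
  [&& is_filling (comp_diagram a) T,
      [forall i : 'I_(size a), forall j : 'I_(maxpart a),
        forall j' : 'I_(maxpart a),
         (j < j') && comp_diagram a i j' ==> (T i j' <= T i j)],
      first_col_incr T
    & [forall i : 'I_(size a), forall j : 'I_(size a),
        forall k' : 'I_(maxpart a), forall k : 'I_(maxpart a),
         [&& i < j, k == k'.+1 :> nat, T j k != 0 :> nat & T i k <= T j k]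
           ==> (T i k' < T j k)]].

Definition quasi_schur (a : seq nat) : series := fun e =>
  Posz #|[set T : 'M['I_(size e).+1]_(size a, maxpart a) |
       is_ssct T && has_content T]|.

Definition is_immaculate (a : seq nat) N
    (T : 'M['I_N.+1]_(size a, maxpart a)) : bool :=
  [&& is_filling (comp_diagram a) T,
      [forall i : 'I_(size a), forall j : 'I_(maxpart a),
        forall j' : 'I_(maxpart a),
         (j < j') && comp_diagram a i j' ==> (T i j <= T i j')]
    & first_col_incr T].

Definition dual_immaculate (a : seq nat) : series := fun e =>
  Posz #|[set T : 'M['I_(size e).+1]_(size a, maxpart a) |
       is_immaculate T && has_content T]|.

Definition skew_diagram (lam mu : seq nat) : diagram :=
  fun i j => nth 0 mu i <= j < nth 0 lam i.

Definition skew_size (lam mu : seq nat) : nat :=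
  #|[set x : 'I_(size lam) * 'I_(maxpart lam) | skew_diagram lam mu x.1 x.2]|.

Definition is_syt (lam mu : seq nat) n
    (T : 'M['I_n.+1]_(size lam, maxpart lam)) : bool :=
  let D := skew_diagram lam mu in
  [&& is_filling D T,
      [forall v : 'I_n, occ T v.+1 == 1],
      [forall i : 'I_(size lam), forall j : 'I_(maxpart lam),
        forall j' : 'I_(maxpart lam),
         [&& j < j', D i j & D i j'] ==> (T i j < T i j')]
    & [forall i : 'I_(size lam), forall i' : 'I_(size lam),
        forall j : 'I_(maxpart lam),
         [&& i < i', D i j & D i' j] ==> (T i j < T i' j)]].

Definition is_descent n r c (T : 'M['I_n.+1]_(r, c)) (k : nat) : bool :=
  [exists x : 'I_r * 'I_c, exists y : 'I_r * 'I_c,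
     [&& T x.1 x.2 == k :> nat, T y.1 y.2 == k.+1 :> nat & x.1 < y.1]].

Definition desc_comp n r c (T : 'M['I_n.+1]_(r, c)) : seq nat :=
  comp_of n [seq k <- iota 1 n.-1 | is_descent T k].

Definition skew_schur (lam mu : seq nat) : series := fun e =>
  (\sum_(T : 'M['I_(skew_size lam mu).+1]_(size lam, maxpart lam)
         | is_syt mu T) fundamental (desc_comp T) e)%R.

Definition schur (lam : seq nat) : series := skew_schur lam [::].

Record skew_shape := SkewShape {
  outer : seq nat;
  inner : seq nat;
  outer_part : is_part outer;
  inner_part : is_part inner;
  inner_sub : [forall i : 'I_(size inner), nth 0 inner i <= nth 0 outer i]
}.

Definition nboxes (A : skew_shape) : nat := skew_size (outer A) (inner A).

Definition inside (A : skew_shape) : diagram :=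
  skew_diagram (outer A) (inner A).

Definition nrows (A : skew_shape) : nat := size (outer A).

Definition ncols (A : skew_shape) : nat := maxpart (outer A).

Definition sfun (A : skew_shape) : series := skew_schur (outer A) (inner A).

Definition diff (A B : skew_shape) : series := sub_series (sfun A) (sfun B).

Record family := Family {
  indices : pred (seq nat);
  member : seq nat -> series
}.

Definition bM := Family is_comp monomial.
Definition bF := Family is_comp fundamental.
Definition bS := Family is_comp quasi_schur.
Definition bD := Family is_comp dual_immaculate.
Definition bs := Family is_part schur.

(* f is the (finite) linear combination of the members of X with coefficients
   c.  Each of the five families is linearly independent, so that c is
   determined by f. *)
Definition expansion (X : family) (f : series) (c : seq nat -> int) : Prop :=
  exists s : seq (seq nat),
    [/\ uniq s, all (indices X) s, (forall a, a \notin s -> c a = 0%R)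
      & forall e, f e = (\sum_(a <- s) c a * member X a e)%R].

Definition positive (X : family) (f : series) : Prop :=
  exists2 c, expansion X f c & forall a, (0 <= c a)%R.

Definition supp (X : family) (A : skew_shape) (a : seq nat) : Prop :=
  exists2 c, expansion X (sfun A) c & c a <> 0%R.

(* the alternative convention for the support: only positive coefficients *)
Definition psupp (X : family) (A : skew_shape) (a : seq nat) : Prop :=
  exists2 c, expansion X (sfun A) c & (0 < c a)%R.

Definition supp_contains (X : family) (A B : skew_shape) : Prop :=
  forall a, supp X B a -> supp X A a.

Definition psupp_contains (X : family) (A B : skew_shape) : Prop :=
  forall a, psupp X B a -> psupp X A a.

(* For a diagram D with columns 0, ..., c-1: the number of columns occupied in
   common by the k rows i, ..., i+k-1. *)
Definition overlap (c : nat) (D : diagram) (k i : nat) : nat :=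
  #|[set j : 'I_c | [forall p : 'I_k, D (i + p) j]]|.

Definition overlaps (r c : nat) (D : diagram) (k : nat) : seq nat :=
  sort geq
    [seq v <- [seq overlap c D k i | i <- iota 0 (r.+1 - k)] | v != 0].

Definition rows (k : nat) (A : skew_shape) : seq nat :=
  overlaps (nrows A) (ncols A) (inside A) k.

Definition cols (l : nat) (A : skew_shape) : seq nat :=
  overlaps (ncols A) (nrows A) (fun j i => inside A i j) l.

Definition rects (k l : nat) (A : skew_shape) : nat :=
  #|[set x : 'I_(nrows A) * 'I_(ncols A) |
      [forall p : 'I_k, forall q : 'I_l, inside A (x.1 + p) (x.2 + q)]]|.

Definition dominated (lam mu : seq nat) : Prop :=
  forall k, 1 <= k <= size lam -> sumn (take k lam) <= sumn (take k mu).

Definition rows_cond (A B : skew_shape) : Prop :=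
  forall k, 1 <= k -> dominated (rows k A) (rows k B).

Definition cols_cond (A B : skew_shape) : Prop :=
  forall l, 1 <= l -> dominated (cols l A) (cols l B).

Definition rects_cond (A B : skew_shape) : Prop :=
  forall k l, 1 <= k -> 1 <= l -> rects k l A <= rects k l B.

Variant cond :=
  Dpos | Spos | Fpos | Mpos | Ssupp | Fsupp | Msupp | Overlap.

Definition holds (c : cond) (A B : skew_shape) : Prop :=
  match c with
  | Dpos => positive bD (diff A B)
  | Spos => positive bs (diff A B)
  | Fpos => positive bF (diff A B)
  | Mpos => positive bM (diff A B)
  | Ssupp => supp_contains bs A B
  | Fsupp => supp_contains bF A B
  | Msupp => supp_contains bM A B
  | Overlap => rows_cond A B
  end.

(* The one-directional implications whose converses fail. *)
Variant strict_arrow : cond -> cond -> Prop :=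
  | Dpos_Spos : strict_arrow Dpos Spos
  | Spos_Fpos : strict_arrow Spos Fpos
  | Fpos_Mpos : strict_arrow Fpos Mpos
  | Ssupp_Fsupp : strict_arrow Ssupp Fsupp
  | Fsupp_Msupp : strict_arrow Fsupp Msupp
  | Spos_Ssupp : strict_arrow Spos Ssupp
  | Fpos_Fsupp : strict_arrow Fpos Fsupp
  | Mpos_Msupp : strict_arrow Mpos Msupp.

Variant arrow (c d : cond) : Prop :=
  | arrow_strict of strict_arrow c d
  | arrow_overlap of c = Fsupp & d = Overlap.

Definition consequence : cond -> cond -> Prop := clos_refl_trans cond arrow.

Definition undecided (c d : cond) : Prop :=
  c = Overlap /\ (d = Fsupp \/ d = Msupp).

(* Main.v *)
Require Import Defs.
From mathcomp Require Import all_boot all_order all_algebra.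
From mathcomp Require Import all_fingroup zify.
From Stdlib Require Import Relation_Operators.

(** A skew Schur function is a nonnegative combination of Schur functions:
    Bender-Knuth involutions on Gelfand-Tsetlin patterns make it symmetric, and
    Stembridge's involution cancels the alternating sum that extracts its
    coefficients. Relative to S and D the Schur functions have disjoint
    supports: each S_a or D_a occurs in at most one s_lambda, and s_lambda
    contains S_lambda and D_lambda with coefficient 1. Since in S all the
    coefficients are 1 whereas D also has coefficients -1, positivity in S is
    equivalent to Schur-positivity, positivity in D only implies it, and the
    support containments agree. The steps s -> F -> M hold because the members
    of each basis are nonnegative combinations of those of the next.

    For the overlap condition, a standard tableau of shape B is built greedily
    from k-1 horizontal strips followed by l-1 vertical strips; this leaves
    rects_{k,l}(B) boxes. Any tableau of shape A with the same descents leaves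
    at least rects_{k,l}(A). Dominance of rows_k or of cols_l amounts to
    comparing all the sums of (a - t)^+ over their parts a, and these sums are
    the numbers rects_{k,l}.

    Four pairs of shapes of equal size refute everything else: 2 and 11; 311/1
    and 22; 3211/11 and 3221/21; 42/2 and 41/1. *)

Set Implicit Arguments.
Unset Strict Implicit.
Unset Printing Implicit Defensive.

Import Order.TTheory GRing.Theory Num.Theory.

(** * Compositions and the monomial and fundamental bases *)

(** A series is known only through its values at exponent sequences, so each identity is an equality
    of counts at one sequence, and uniqueness of an expansion comes from a rank that makes the
    family triangular against monomials. Schur functions inherit uniqueness from [D]. Standard and
    immaculate tableaux are replaced by the row lengths of their sub-fillings, composition tableaux
    by the heights of their columns; the tableau conditions become inequalities between consecutive
    shapes. The two alternating formulas, the extraction of Schur coefficients and the expansion of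
    a Schur function in [D], are both written with the determinant [match_sign], and both are
    cancelled by an involution that exchanges two entries of a rho-shifted vector. Symmetry enters
    twice: to invert the extraction formula, and because composition tableaux produce patterns with
    reversed content. Four pairs of shapes suffice since a pair that satisfies a strong condition
    and violates a weak one refutes every implication from a weaker condition to a stronger one. *)

Definition alln n (p : pred nat) := all p (iota 0 n).

Lemma allnP n (p : pred nat) : reflect (forall i, i < n -> p i) (alln n p).
Proof.
apply: (iffP allP) => h i; first by move=> lt; apply: h; rewrite mem_iota.
by rewrite mem_iota; exact: h.
Qed.

Lemma bij_card (S T : finType) (X : {set S}) (Y : {set T}) (f : S -> T) :
    {in X &, injective f} -> (forall x, x \in X -> f x \in Y) ->
    (forall y, y \in Y -> exists2 x, x \in X & f x = y) -> #|X| = #|Y|.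
Proof.
move=> finj fXY fonto; rewrite -(card_in_imset finj); apply: eq_card => y.
apply/imsetP/idP => [[x xX ->]|yY]; first exact: fXY.
by have [x xX <-] := fonto y yY; exists x.
Qed.

(** Quasisymmetry in this encoding: the values of [monomial a] and [fundamental a] at [e] depend on
    [e] only through this composition. *)
Definition flat (e : seq nat) := [seq x <- e | x != 0].

Lemma is_comp_flat e : is_comp (flat e).
Proof. by rewrite /is_comp mem_filter. Qed.

Lemma sumn_flat e : sumn (flat e) = sumn e.
Proof. by elim: e => //= x e IH; case: x => //= x; rewrite IH. Qed.

Lemma flat_comp a : is_comp a -> flat a = a.
Proof.
move=> ca; apply/all_filterP/allP => x xa; apply/eqP => x0.
by rewrite x0 in xa; rewrite /is_comp xa in ca.
Qed.

Lemma is_comp_cons x a : is_comp (x :: a) = (0 < x) && is_comp a.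
Proof. by rewrite /is_comp inE negb_or eq_sym -lt0n. Qed.

Lemma is_comp_nth a i : is_comp a -> i < size a -> 0 < nth 0 a i.
Proof.
move=> ca lt; rewrite lt0n; apply/eqP => h.
by move: ca; rewrite /is_comp -h mem_nth.
Qed.

Lemma scanl_addnE c a :
  scanl addn c a = [seq c + sumn (take i a) | i <- iota 1 (size a)].
Proof.
elim: a c => //= x a IH c; rewrite IH take0 /= addn0; congr (_ :: _).
rewrite -[2]/(1 + 1) iotaDl -map_comp; apply: eq_map => i /=.
by rewrite addnA.
Qed.

(** With the total appended, [cuts] is the list of all partial sums. [scanl] produces it and the
    differences taken by [comp_of] undo it; this is the bijection between compositions and
    subsets. *)
Lemma rcons_cuts a : a != [::] -> rcons (cuts a) (sumn a) = scanl addn 0 a.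
Proof.
rewrite scanl_addnE /cuts; case: a => // x a _ /=.
set f := fun i => _.
rewrite -[RHS]/(map f (iota 1 (size a).+1)) -[in RHS](addn1 (size a)).
rewrite iotaD map_cat /= cats1.
by congr rcons; rewrite /f add1n /= take_size.
Qed.

Lemma pairmap_scanl_addn c a :
  pairmap (fun p q => q - p) c (scanl addn c a) = a.
Proof. by elim: a c => //= x a IH c; rewrite addKn IH. Qed.

Lemma scanl_pairmap_subn c s :
  path ltn c s -> scanl addn c (pairmap (fun p q => q - p) c s) = s.
Proof. by elim: s c => //= x s IH c /andP[lt p]; rewrite subnKC ?IH // ltnW. Qed.

Lemma is_comp_pairmap c s :
  path ltn c s -> is_comp (pairmap (fun p q => q - p) c s).
Proof.
by elim: s c => //= x s IH c /andP[lt p]; rewrite is_comp_cons subn_gt0 lt IH.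
Qed.

Lemma path_scanl c a : is_comp a -> path ltn c (scanl addn c a).
Proof.
elim: a c => //= x a IH c; rewrite is_comp_cons => /andP[x0 ca].
by rewrite IH // andbT; lia.
Qed.

Lemma sumn_gt0 a : is_comp a -> a != [::] -> 0 < sumn a.
Proof. by case: a => //= x a; rewrite is_comp_cons => /andP[x0 _] _; lia. Qed.

Lemma comp_of_cuts a : is_comp a -> comp_of (sumn a) (cuts a) = a.
Proof.
move=> ca; rewrite /comp_of; case: eqP => [s0|/eqP s0].
  by case: (a =P [::]) => // /eqP /(sumn_gt0 ca); rewrite s0.
rewrite rcons_cuts; last by apply: contraNneq s0 => ->.
exact: pairmap_scanl_addn.
Qed.

Lemma sorted_cuts a : is_comp a -> sorted ltn (cuts a).
Proof.
move=> ca; case: (a =P [::]) => [-> //|/eqP a0].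
have := path_scanl 0 ca; rewrite -rcons_cuts // rcons_path.
by case/andP => /path_sorted.
Qed.


Lemma path_rcons_ltn n D : 0 < n -> sorted ltn D ->
  (forall x, x \in D -> 0 < x < n) -> path ltn 0 (rcons D n).
Proof.
move=> n0 sD h; have tr : transitive ltn by move=> ? ? ?; exact: ltn_trans.
rewrite rcons_path path_sortedE // sD andbT; apply/andP; split.
  by apply/allP => x /h /andP[].
case: D sD h => //= x D _ h; have := mem_last x D => /h /andP[] //.
Qed.

Lemma mem_cuts a x : is_comp a -> x \in cuts a -> 0 < x < sumn a.
Proof.
move=> ca /mapP[i]; rewrite mem_iota => /andP[i1 i2] ->.
have il : i < size a by lia.
have c1 : is_comp (take i a).
  by apply: contra ca; exact: mem_take.
have c2 : is_comp (drop i a).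
  by apply: contra ca; exact: mem_drop.
rewrite -[X in _ && (_ < sumn X)](cat_take_drop i a) sumn_cat.
have := sumn_gt0 c1; have := sumn_gt0 c2.
have s1 : size (take i a) = i by rewrite size_takel // ltnW.
have s2 : size (drop i a) = size a - i by rewrite size_drop.
by rewrite -!size_eq0 s1 s2; lia.
Qed.

Lemma comp_of_spec n D : path ltn 0 (rcons D n) ->
  [/\ is_comp (comp_of n D), sumn (comp_of n D) = n & cuts (comp_of n D) = D].
Proof.
move=> p; have n0 : n != 0.
  by case: n p => //; rewrite rcons_path /= ltn0 andbF.
rewrite /comp_of (negPf n0); set a := pairmap _ _ _.
have a0 : a != [::] by rewrite -size_eq0 size_pairmap size_rcons.
have := rcons_cuts a0; rewrite scanl_pairmap_subn // => /rcons_inj[-> ->].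
by split=> //; exact: is_comp_pairmap.
Qed.

Lemma mem_comps n a : (a \in comps n) = is_comp a && (sumn a == n).
Proof.
have tr : transitive ltn by move=> ? ? ?; exact: ltn_trans.
apply/imageP/andP => [[b _ ->]|[ca /eqP <-]].
  have [n0|n0] := posnP n; first by move: b; rewrite n0.
  have [|-> -> _] := @comp_of_spec n (mask b (iota 1 n.-1)); last by [].
  apply: path_rcons_ltn => //.
    by apply: (subseq_sorted tr (mask_subseq _ _)); exact: iota_ltn_sorted.
  by move=> x /mem_mask; rewrite mem_iota; lia.
set s := iota 1 _; have sz : size (map (mem (cuts a)) s) == (sumn a).-1.
  by rewrite size_map size_iota.
exists (Tuple sz) => //=; rewrite -filter_mask.
suff -> : filter (mem (cuts a)) s = cuts a by rewrite comp_of_cuts.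
apply: (irr_sorted_eq tr ltnn).
- by apply: sorted_filter => //; exact: iota_ltn_sorted.
- exact: sorted_cuts.
move=> x; rewrite mem_filter /= andb_idr // => /(mem_cuts ca).
by rewrite mem_iota; lia.
Qed.

Lemma uniq_comps n : uniq (comps n).
Proof.
rewrite map_inj_in_uniq ?enum_uniq // => b1 b2 _ _ eq12.
case: (posnP n) => [n0|n0].
  by move: b1 b2 {eq12}; rewrite n0 => b1 b2; rewrite (tuple0 b1) (tuple0 b2).
have tr : transitive ltn by move=> ? ? ?; exact: ltn_trans.
have h (b : n.-1.-tuple bool) : path ltn 0 (rcons (mask b (iota 1 n.-1)) n).
  apply: path_rcons_ltn => //.
    by apply: (subseq_sorted tr (mask_subseq _ _)); exact: iota_ltn_sorted.
  by move=> x /mem_mask; rewrite mem_iota; lia.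
have [_ _ c1] := comp_of_spec (h b1); have [_ _ c2] := comp_of_spec (h b2).
have em : mask b1 (iota 1 n.-1) = mask b2 (iota 1 n.-1) by rewrite -c1 -c2 eq12.
apply/val_inj/(@eq_from_nth _ false) => [|i]; rewrite !size_tuple // => lt.
have := in_mask (nth 0 (iota 1 n.-1) i) b1 (iota_uniq 1 n.-1).
rewrite em in_mask ?iota_uniq // index_uniq ?size_iota ?iota_uniq //.
by rewrite mem_nth ?size_iota.
Qed.

Lemma sum_indicator (T : eqType) (s : seq T) (x : T) : uniq s ->
  (\sum_(b <- s) Posz (x == b) = Posz (x \in s))%R.
Proof.
elim: s => [|y s IH] /=; first by rewrite big_nil.
case/andP => ys us; rewrite big_cons IH // inE.
by case: eqP => [->|_]; rewrite ?(negPf ys) //= add0r.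
Qed.

Lemma sorted_enum_ord N : sorted (fun u v : 'I_N => u < v) (enum 'I_N).
Proof. by have := iota_ltn_sorted 0 N; rewrite -val_enum_ord sorted_map. Qed.

(** All parts of [a] are positive, so an admissible map must run increasingly through exactly the
    positions of the nonzero entries of [e]. Hence it is unique, and it exists only when these
    entries spell [a]. *)
Lemma monomialE a e : is_comp a -> monomial a e = Posz (flat e == a).
Proof.
move=> ca; rewrite /monomial; congr Posz.
set X := [set _ | _]; set k := size a; set N := size e.
pose ps := [seq v <- enum 'I_N | nth 0 e (v : 'I_N) != 0].
have flatE : flat e = [seq nth 0 e v | v : 'I_N <- ps].
  rewrite /flat -{1}(mkseq_nth 0 e) /mkseq -val_enum_ord -map_comp.
  by rewrite filter_map.
have tr : transitive (fun u v : 'I_N => u < v) by move=> ? ? ?; exact: ltn_trans.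
have sps : sorted (fun u v : 'I_N => u < v) ps.
  apply: sorted_filter => //.
  exact: sorted_enum_ord.
have XE i : (i \in X) = ([seq i p | p <- enum 'I_k] == ps) && (flat e == a).
  rewrite inE; apply/andP/andP => [[/forallP inc /forallP con]|].
    have inc' (p q : 'I_k) : p < q -> i p < i q.
      by move=> lt; have /implyP := forallP (inc p) q; apply.
    have injE : injective i.
      move=> p q eqpq; have [lt|lt|/ord_inj //] := ltngtP p q.
        by have := inc' _ _ lt; rewrite eqpq ltnn.
      by have := inc' _ _ lt; rewrite eqpq ltnn.
    have ea p : nth 0 e (i p) = nth 0 a p.
      rewrite -(eqP (con (i p))) (big_pred1 p) // => q.
      by rewrite /= (inj_eq injE).
    have eqs : [seq i p | p <- enum 'I_k] = ps.
      apply: (irr_sorted_eq tr) => //; first by move=> u; rewrite /= ltnn.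
        rewrite sorted_map.
        apply: (@sub_sorted _ (fun p q : 'I_k => p < q)).
          exact: inc'.
        exact: sorted_enum_ord.
      move=> v; rewrite mem_filter mem_enum andbT.
      apply/mapP/idP => [[p _ ->]|].
        by rewrite ea -lt0n is_comp_nth.
      rewrite -(eqP (con v)) => h.
      case: (pickP (fun p => i p == v)) => [p /eqP <-|h0].
        by exists p; rewrite ?mem_enum.
      by rewrite big_pred0 in h.
    split; apply/eqP => //; rewrite flatE -eqs -map_comp.
    rewrite -[RHS](mkseq_nth 0) /mkseq -val_enum_ord -map_comp.
    by apply: eq_map => p /=.
  case=> /eqP eqs /eqP fe.
  have ea p : nth 0 e (i p) = nth 0 a p.
    have := flatE; rewrite fe -eqs -map_comp -{1}(mkseq_nth 0 a) /mkseq.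
    rewrite -val_enum_ord -map_comp => /eq_in_map h.
    by apply/esym/(h p); rewrite mem_enum.
  have inc (p q : 'I_k) : p < q -> i p < i q.
    move=> lt; have := sps; rewrite -eqs sorted_map => s.
    have := sorted_ltn_nth _ p s; move/(_ _ (val p) (val q)).
    rewrite !inE !size_enum_ord !ltn_ord !nth_ord_enum /=.
    by apply => //= x y z; exact: ltn_trans.
  split.
    apply/forallP => p; apply/forallP => q; apply/implyP; exact: inc.
  apply/forallP => v; case: (boolP (v \in ps)) => vp.
    have /mapP[p _ ->] : v \in [seq i p | p <- enum 'I_k] by rewrite eqs.
    rewrite (big_pred1 p) ?ea // => q /=; apply/eqP/eqP => [|-> //].
    by have [/inc lt|/inc lt|/ord_inj //] := ltngtP q p;
      move=> eqpq; rewrite eqpq ltnn in lt.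
  rewrite big_pred0 => [|p].
    by move: vp; rewrite mem_filter mem_enum andbT negbK eq_sym.
  apply/negP => /eqP ev; case/negP: vp; rewrite -eqs -ev.
  by apply: map_f; rewrite mem_enum.
case: (flat e =P a) => [fe|fe]; last first.
  by apply: eq_card0 => i; rewrite XE andbC; case: eqP.
have sz : size ps == k by rewrite /k -fe flatE size_map.
pose i0 := [ffun p => tnth (Tuple sz) p].
have h0 : [seq i0 p | p <- enum 'I_k] = ps.
  rewrite -[RHS](map_tnth_enum (Tuple sz)).
  by apply: eq_map => p; rewrite ffunE.
rewrite -[RHS](cards1 i0); apply: eq_card => i.
rewrite XE inE fe eqxx andbT; apply/eqP/eqP => [h|-> //].
apply/ffunP => p; move: h; rewrite -h0 => /eq_in_map; apply.
by rewrite mem_enum.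
Qed.

(** Each [monomial b] is the indicator of [flat e == b], so the only summand that can survive is the
    one with [b = flat e]. *)
Lemma fundamentalE a e : is_comp a ->
  fundamental a e =
  Posz ((sumn e == sumn a) && all (mem (cuts (flat e))) (cuts a)).
Proof.
move=> ca; rewrite /fundamental.
rewrite -big_filter (eq_big_seq (fun b => Posz (flat e == b))) => [|b].
  2: by rewrite mem_filter mem_comps => /and3P[_ cb _]; exact: monomialE.
rewrite sum_indicator ?filter_uniq ?uniq_comps //.
by rewrite mem_filter mem_comps is_comp_flat sumn_flat andbC.
Qed.

(** * Expansions *)

(** [expansion] hides its finite list of indices; this moves a sum to any other duplicate-free list
    that contains the support. *)
Lemma big_support (T : eqType) (c F : T -> int) (s t : seq T) :
    uniq s -> uniq t -> (forall a, c a != 0%R -> a \in s) ->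
    (forall a, c a != 0%R -> a \in t) ->
  (\sum_(a <- s) c a * F a = \sum_(a <- t) c a * F a)%R.
Proof.
move=> us ut hs ht.
have E r : (\sum_(a <- r) c a * F a =
    \sum_(a <- [seq a <- r | c a != 0%R]) c a * F a)%R.
  rewrite big_filter [LHS](bigID (fun a => c a != 0%R)) /= [X in (_ + X)%R]big1.
    by rewrite addr0.
  by move=> a /negPn/eqP ->; rewrite mul0r.
rewrite E [RHS]E; apply/perm_big/uniq_perm; rewrite ?filter_uniq // => a.
by rewrite !mem_filter; case: (boolP (c a != 0%R)) => //= h; rewrite hs ?ht.
Qed.

Lemma expansion_on (X : Defs.family) f c (t : seq (seq nat)) :
    expansion X f c -> uniq t -> (forall a, c a != 0%R -> a \in t) ->
  forall e, f e = (\sum_(a <- t) c a * member X a e)%R.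
Proof.
case=> s [us _ s0 fE] ut ht e; rewrite fE; apply: big_support => // a ca.
by apply: contraNT ca => /s0 ->.
Qed.

Lemma expansion_intro (X : Defs.family) f c (t : seq (seq nat)) :
    (forall a, c a != 0%R -> a \in t) ->
    (forall a, c a != 0%R -> indices X a) ->
    (forall e, f e = (\sum_(a <- undup t) c a * member X a e)%R) ->
  expansion X f c.
Proof.
move=> ht hX fE; exists [seq a <- undup t | c a != 0%R]; split.
- by rewrite filter_uniq ?undup_uniq.
- by apply/allP => a; rewrite mem_filter => /andP[/hX].
- move=> a; rewrite mem_filter mem_undup => h; apply/eqP; apply: contraNT h => h.
  by rewrite h ht.
- move=> e; rewrite fE; apply: big_support => [|||a h].
  + exact: undup_uniq.
  + by rewrite filter_uniq ?undup_uniq.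
  + by move=> a h; rewrite mem_undup ht.
  + by rewrite mem_filter h mem_undup ht.
Qed.

Lemma expansion_support (X : Defs.family) f c : expansion X f c ->
  exists t, (forall a, c a != 0%R -> a \in t) /\ all (indices X) t.
Proof.
case=> s [us sX s0 fE]; exists s; split=> // a ca.
by apply: contraNT ca => /s0 ->.
Qed.

Lemma expansion_index (X : Defs.family) f c a :
  expansion X f c -> c a != 0%R -> indices X a.
Proof. by case/expansion_support => t [ht /allP tX] /ht /tX. Qed.

Lemma expansion_ext (X : Defs.family) f g c d :
  f =1 g -> c =1 d -> expansion X f c -> expansion X g d.
Proof.
move=> fg cd [s [us sX s0 fE]]; exists s; split=> // [a /s0|e].
  by rewrite cd.
by rewrite -fg fE; apply: eq_bigr => a _; rewrite cd.
Qed.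

Lemma expansion_lin (X : Defs.family) f g c d (u : int) :
  expansion X f c -> expansion X g d ->
  expansion X (fun e => f e + u * g e)%R (fun a => c a + u * d a)%R.
Proof.
move=> ef eg; have [s [hs sX]] := expansion_support ef.
have [t [ht tX]] := expansion_support eg.
have sub a : (c a + u * d a != 0)%R -> a \in s ++ t.
  rewrite mem_cat; case: (eqVneq (c a) 0%R) => [->|/hs -> //].
  case: (eqVneq (d a) 0%R) => [->|/ht ->]; last by rewrite orbT.
  by rewrite mulr0 addr0 eqxx.
apply: (@expansion_intro _ _ _ (s ++ t)) => // [a /sub|e].
  by rewrite mem_cat => /orP[]; move: a; apply/allP.
rewrite (@expansion_on _ _ _ (undup (s ++ t)) ef) ?undup_uniq //; last first.
  by move=> a /hs; rewrite mem_undup mem_cat => ->.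
rewrite (@expansion_on _ _ _ (undup (s ++ t)) eg) ?undup_uniq //; last first.
  by move=> a /ht; rewrite mem_undup mem_cat orbC => ->.
rewrite big_distrr -big_split /=; apply: eq_bigr => a _.
by rewrite mulrDl mulrA.
Qed.

Lemma expansion_sub (X : Defs.family) f g c d : expansion X f c -> expansion X g d ->
  expansion X (sub_series f g) (fun a => c a - d a)%R.
Proof.
move=> ef eg; apply: expansion_ext (expansion_lin (-1) ef eg) => [e|a];
  by rewrite /sub_series mulN1r.
Qed.

(** * Linear independence by triangularity *)

Definition triangular (X : Defs.family) := exists rk : seq nat -> nat,
  (forall a, indices X a -> member X a a != 0%R) /\
  (forall a b, indices X a -> indices X b -> member X b a != 0%R -> b != a ->
     rk b < rk a).

(** A composition serves both as an index and as an exponent sequence. Evaluating a vanishing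
    combination at [a] leaves [d a] times a nonzero diagonal entry once all indices of smaller rank
    have coefficient 0, so induction on the rank applies. *)
Lemma triangular_zero (X : Defs.family) d :
  triangular X -> expansion X (fun=> 0%R) d -> forall a, d a = 0%R.
Proof.
case=> rk [diag tri] ed; have [t [ht /allP tX]] := expansion_support ed.
suff h n a : rk a < n -> d a = 0%R by move=> a; exact: (h (rk a).+1).
elim: n a => // n IH a ra; apply/eqP; apply/negPn/negP => da.
have := @expansion_on _ _ _ (undup t) ed (undup_uniq _) _ a.
rewrite (bigD1_seq a) ?undup_uniq ?mem_undup ?ht //= big_seq_cond big1.
  rewrite addr0 => /(_ _)/esym/eqP; rewrite mulf_eq0 (negPf da) /=.
  rewrite (negPf (diag _ _)) ?tX ?ht // => /(_ _) F; apply/notF/F.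
  by move=> b; rewrite mem_undup; exact: ht.
move=> b /andP[]; rewrite mem_undup => bt ba.
case: (eqVneq (member X b a) 0%R) => [->|h]; first by rewrite mulr0.
rewrite IH ?mul0r //.
by have := tri a b (tX a (ht a da)) (tX b bt) h ba; lia.
Qed.

Lemma expansion_uniq (X : Defs.family) f c d :
  triangular X -> expansion X f c -> expansion X f d -> c =1 d.
Proof.
move=> tri ec ed a; apply/eqP; rewrite -subr_eq0; apply/eqP.
apply: (@triangular_zero X (fun a => c a - d a)%R tri _ a).
apply: expansion_ext (expansion_sub ec ed).
  by move=> e; rewrite /sub_series subrr.
by [].
Qed.

Lemma triangular_M : triangular bM.
Proof.
exists (fun=> 0); split=> [a ca|a b ca cb]; rewrite /= monomialE // flat_comp //.
  by rewrite eqxx.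
by case: (a =P b) => [->|_]; rewrite ?eqxx.
Qed.

Lemma size_cuts a : size (cuts a) = (size a).-1.
Proof. by rewrite size_map size_iota. Qed.

(** [fundamental b] is nonzero at [a] only if [cuts b] is contained in [cuts a], and two such sets
    of equal size coincide; so the number of parts is a rank. *)
Lemma triangular_F : triangular bF.
Proof.
exists size; split=> [a ca|a b ca cb]; rewrite /= fundamentalE // flat_comp //.
  by rewrite eqxx; case: allP => // -[].
case: (sumn a =P sumn b) => [sab|_] //=.
case: (boolP (all (mem (cuts a)) (cuts b))) => [/allP sub _ ba|//].
rewrite ltnNge.
apply: contra ba => szab.
have c0 : cuts b = cuts a.
  have tr : transitive ltn by move=> ? ? ?; exact: ltn_trans.
  apply: (irr_sorted_eq tr ltnn (sorted_cuts cb) (sorted_cuts ca)).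
  have ub : uniq (cuts b) := sorted_uniq tr ltnn (sorted_cuts cb).
  by have [|//] := uniq_min_size ub sub; rewrite !size_cuts; lia.
by rewrite -(comp_of_cuts ca) -(comp_of_cuts cb) sab c0.
Qed.

(* The situation of Schur functions relative to the bases S and D: every
   index a of X occurs in at most one Schur function, namely that of p a,
   and with coefficient eps a. *)
Record refines (X : Defs.family) (p : seq nat -> seq nat)
    (eps : seq nat -> int) : Prop := Refines {
  refines_tri : triangular X;
  refines_comp : indices X = is_comp;
  refines_sum : forall a, is_comp a -> eps a != 0%R -> sumn (p a) = sumn a;
  refines_part : forall la, is_part la -> p la = la /\ eps la = 1%R;
  refines_schur : forall la e, is_part la -> schur la e =
    (\sum_(a <- comps (sumn la)) (p a == la)%:R * eps a * member X a e)%R }.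

Lemma is_part_comp la : is_part la -> is_comp la.
Proof. by case/andP. Qed.

Section Refines.

Variables (X : Defs.family) (p : seq nat -> seq nat) (eps : seq nat -> int).
Hypothesis ref : refines X p eps.

(** Since [a] occurs in the single Schur function indexed by [p a], its coefficient is one product
    rather than a sum. *)
Definition refined (c : seq nat -> int) : seq nat -> int :=
  fun a => if is_comp a then (eps a * c (p a))%R else 0%R.

Lemma refined_part c la : is_part la -> refined c la = c la.
Proof.
move=> pl; have [pp ep] := refines_part ref pl.
by rewrite /refined is_part_comp // pp ep mul1r.
Qed.

Lemma expansion_refined f c : expansion bs f c -> expansion X f (refined c).
Proof.
move=> ec; have [s [us /allP sX s0 fE]] := ec.
pose t := flatten [seq comps (sumn la) | la <- s].
have memt la a : la \in s -> a \in comps (sumn la) -> a \in t.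
  by move=> las ac; apply/flatten_mapP; exists la.
have sup a : refined c a != 0%R -> a \in t.
  rewrite /refined; case: ifP => ca; rewrite ?eqxx // mulf_eq0.
  case/norP => ea cpa; apply: (memt (p a)).
    by apply: contraNT cpa => /s0 ->.
  by rewrite (refines_sum ref) // mem_comps ca eqxx.
apply: (@expansion_intro _ _ _ t) => // [a|e].
  by rewrite (refines_comp ref) /refined; case: ifP; rewrite ?eqxx.
rewrite fE (eq_big_seq (fun la => \sum_(a <- undup t)
   c la * ((is_comp a && (p a == la))%:R * eps a * member X a e))%R).
  rewrite exchange_big /=; apply: eq_big_seq => a; rewrite mem_undup => at_.
  have ca : is_comp a.
    by case/flatten_mapP: at_ => la _; rewrite mem_comps => /andP[].
  case: (boolP (p a \in s)) => pas.
    rewrite (bigD1_seq (p a)) //= eqxx /refined ca mul1r big1 ?addr0.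
      by rewrite mulrCA mulrA.
    by move=> la; rewrite eq_sym => /negPf ->; rewrite !mul0r mulr0.
  rewrite /refined ca (s0 _ pas) mulr0 mul0r big_seq big1 // => la las.
  by case: eqP las pas => [-> ->|] //=; rewrite !mul0r mulr0.
move=> la las /=; rewrite (refines_schur ref); last exact: sX.
rewrite big_distrr /=.
pose c' a := (c la * ((is_comp a && (p a == la))%:R * eps a))%R.
transitivity (\sum_(a <- undup t) c' a * member X a e)%R; last first.
  by apply: eq_bigr => a _; rewrite /c' !mulrA.
rewrite (@big_support _ c' (fun a => member X a e) _ (comps (sumn la))); first last.
- move=> a; rewrite mulf_eq0 => /norP[_]; rewrite mulf_eq0 => /norP[].
  rewrite pnatr_eq0 eqb0 negbK => /andP[ca /eqP pal] ea.
  by rewrite mem_comps ca -pal (refines_sum ref) ?eqxx.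
- move=> a; rewrite mulf_eq0 => /norP[_]; rewrite mulf_eq0 => /norP[].
  rewrite pnatr_eq0 eqb0 negbK => /andP[ca /eqP pal] ea.
  by rewrite mem_undup; apply: (memt la) => //;
     rewrite mem_comps ca -pal (refines_sum ref) ?eqxx.
- exact: uniq_comps.
- exact: undup_uniq.
apply: eq_big_seq => a; rewrite mem_comps => /andP[ca _].
by rewrite /c' ca /= !mulrA.
Qed.

(** Uniqueness is inherited from [X]: at a partition the coefficient in [X] is the Schur coefficient
    itself, and elsewhere the Schur coefficient is 0. *)
Lemma triangular_schur_of : forall f c d,
  expansion bs f c -> expansion bs f d -> c =1 d.
Proof.
move=> f c d ec ed a; case: (boolP (is_part a)) => pa; last first.
  have z g : expansion bs f g -> g a = 0%R.
    by move=> eg; apply/eqP; apply: contraNT pa; exact: expansion_index eg.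
  by rewrite !z.
rewrite -(refined_part c pa) -(refined_part d pa).
exact: expansion_uniq (refines_tri ref) (expansion_refined ec)
  (expansion_refined ed) a.
Qed.

(** The Schur coefficients are among the coefficients in [X], namely those at partitions. *)
Lemma refined_positive f c : expansion bs f c -> positive X f -> positive bs f.
Proof.
move=> ec [d ed d0]; exists c => // a; case: (boolP (is_part a)) => pa.
  by rewrite -refined_part // (expansion_uniq (refines_tri ref) (expansion_refined ec) ed).
suff -> : c a = 0%R by [].
by apply/eqP; apply: contraNT pa; exact: expansion_index ec.
Qed.

Lemma positive_refined f : (forall a, (0 <= eps a)%R) ->
  positive bs f -> positive X f.
Proof.
move=> eps0 [c ec c0]; exists (refined c); first exact: expansion_refined.
by move=> a; rewrite /refined; case: ifP => // _; rewrite mulr_ge0.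
Qed.

Hypothesis schur_pos : forall A, positive bs (sfun A).

Lemma supp_refined A a :
  supp X A a <-> [/\ is_comp a, eps a != 0%R & supp bs A (p a)].
Proof.
have [c ec c0] := schur_pos A; split.
  case=> d ed da; have dE := expansion_uniq (refines_tri ref) (expansion_refined ec) ed.
  move: da; rewrite -dE /refined; case: ifP => // ca /eqP.
  rewrite mulf_eq0 => /norP[ea /eqP ca']; split=> //; by exists c.
case=> ca ea [d ed da]; exists (refined d); first exact: expansion_refined.
by rewrite /refined ca; apply/eqP; rewrite mulf_neq0 //; apply/eqP.
Qed.

(** Schur coefficients of [sfun A] are nonnegative, so the sign of a coefficient in [X] is that of
    [eps a]. Together with [eps = 1] at partitions this makes both conventions for the support agree
    on containments. *)
Lemma psupp_refined A a :
  psupp X A a <-> [/\ is_comp a, (0 < eps a)%R & supp bs A (p a)].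
Proof.
have [c ec c0] := schur_pos A; split.
  case=> d ed da; have dE := expansion_uniq (refines_tri ref) (expansion_refined ec) ed.
  move: da; rewrite -dE /refined; case: ifP => // ca h.
  have cp : (0 < c (p a))%R.
    by rewrite lt0r c0 andbT; apply: contraTN h => /eqP ->; rewrite mulr0 ltxx.
  split=> //; first by rewrite -(pmulr_lgt0 _ cp).
  by exists c => //; apply/eqP; rewrite gt_eqF.
case=> ca ea [d ed da]; exists (refined d); first exact: expansion_refined.
rewrite /refined ca mulr_gt0 // lt0r; apply/andP; split; first exact/eqP.
by rewrite -(triangular_schur_of ec ed).
Qed.

Lemma supp_contains_refined A B : supp_contains X A B <-> supp_contains bs A B.
Proof.
split=> h a.
  move=> sa; have pa : is_part a.
    by case: sa => c ec /eqP; exact: expansion_index ec.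
  have [pp ep] := refines_part ref pa.
  have /h/supp_refined : supp X B a.
    by apply/supp_refined; rewrite ep pp is_part_comp.
  by rewrite pp => -[].
by case/supp_refined => ca ea /h sa; apply/supp_refined.
Qed.

Lemma psupp_contains_refined A B : psupp_contains X A B <-> supp_contains bs A B.
Proof.
split=> h a.
  move=> sa; have pa : is_part a.
    by case: sa => c ec /eqP; exact: expansion_index ec.
  have [pp ep] := refines_part ref pa.
  have /h/psupp_refined : psupp X B a.
    by apply/psupp_refined; rewrite ep pp is_part_comp.
  by rewrite pp => -[].
by case/psupp_refined => ca ea /h sa; apply/psupp_refined.
Qed.

End Refines.

(** [sfun A] is the difference plus [sfun B], both with nonnegative coefficients, so nothing in the
    support of [B] cancels. *)
Lemma diff_supp_contains X A B :
    (forall f c d, expansion X f c -> expansion X f d -> c =1 d) ->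
    (forall A, positive X (sfun A)) ->
  positive X (diff A B) -> supp_contains X A B.
Proof.
move=> uX pX [c ec c0] a [d ed da]; have [d' ed' d'0] := pX B.
exists (fun a => c a + 1 * d a)%R.
  apply: expansion_ext (expansion_lin 1 ec ed) => // e.
  by rewrite /diff /sub_series mul1r subrK.
apply/eqP; rewrite mul1r gt_eqF // ltr_wpDl // lt0r; apply/andP; split.
  exact/eqP.
by rewrite (uX _ _ _ ed ed').
Qed.

(** * Fillings and chains of shapes *)

(** Reading a matrix at natural numbers, with value 0 outside, allows the combinatorial conditions
    to be stated for arbitrary functions on [nat] while the objects counted stay in a finite
    type. *)
Definition ev B m n (P : 'M['I_B.+1]_(m, n)) (i j : nat) : nat :=
  if (insub i : option 'I_m) is Some i' then
    if (insub j : option 'I_n) is Some j' then P i' j' else 0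
  else 0.

(** [inord] sends values above [B] to 0, so each construction through [mk] has to come with a bound
    on its values. *)
Definition mk B m n (f : nat -> nat -> nat) : 'M['I_B.+1]_(m, n) :=
  (\matrix_(i, j) inord (f i j))%R.

Lemma evE B m n (P : 'M['I_B.+1]_(m, n)) (i : 'I_m) (j : 'I_n) :
  ev P i j = P i j.
Proof. by rewrite /ev !valK. Qed.

Lemma ev_mk B m n f i j :
  i < m -> j < n -> f i j <= B -> ev (mk B m n f) i j = f i j.
Proof.
move=> im jn fB; rewrite -[i]/(val (Ordinal im)) -[j]/(val (Ordinal jn)).
by rewrite evE mxE inordK.
Qed.

Lemma ev_le B m n (P : 'M['I_B.+1]_(m, n)) i j : ev P i j <= B.
Proof. by rewrite /ev; case: insubP => // *; case: insubP => // *; rewrite -ltnS. Qed.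

Lemma ev_out_r B m n (P : 'M['I_B.+1]_(m, n)) i j : n <= j -> ev P i j = 0.
Proof.
move=> h; rewrite /ev; case: insubP => // *.
by rewrite insubF //; apply/negbTE; rewrite -leqNgt.
Qed.

Lemma ev_inj B m n (P Q : 'M['I_B.+1]_(m, n)) :
  (forall i j, i < m -> j < n -> ev P i j = ev Q i j) -> P = Q.
Proof.
move=> h; apply/matrixP => i j; apply/ord_inj; rewrite -!evE.
exact: h.
Qed.

Lemma iota0S n : iota 0 n.+1 = rcons (iota 0 n) n.
Proof. by rewrite -addn1 iotaD cats1. Qed.

(** A downward closed predicate on an initial segment is determined by its count; both translations
    between fillings and chains rest on this. *)
Lemma count_prefix n (q : pred nat) s :
    (forall s s', s <= s' -> s' < n -> q s' -> q s) -> s < n ->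
  q s = (s < count q (iota 0 n)).
Proof.
elim: n s => // n IH s mon; rewrite iota0S -cats1 count_cat /= ltnS addn0.
case: (boolP (q n)) => qn.
  have -> : count q (iota 0 n) = n.
    rewrite -[RHS](size_iota 0 n); apply/eqP; rewrite -all_count.
    by apply/allnP => i lt; apply: mon qn => //; lia.
  by rewrite addn1 ltnS => sn; rewrite sn; apply: mon qn.
rewrite addn0 leq_eqVlt => /orP[/eqP ->|sn].
  rewrite (negPf qn); apply/esym/negbTE; rewrite -leqNgt.
  by rewrite (leq_trans (count_size _ _)) ?size_iota.
by apply: IH => // s1 s2 le lt; apply: mon => //; lia.
Qed.

Lemma leq_eqP x y n : x <= n -> y <= n ->
  (forall s, s < n -> (x <= s) = (y <= s)) -> x = y.
Proof.
move=> xn yn h; apply/eqP; rewrite eqn_leq; apply/andP; split.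
  by case: (ltnP y n) => [lt|]; [rewrite h|lia].
by case: (ltnP x n) => [lt|]; [rewrite -h|lia].
Qed.

Lemma count_range a b c (q : pred nat) : a <= b <= c ->
  count (fun j => (a <= j < b) && q j) (iota 0 c) =
  count (fun d => q (a + d)) (iota 0 (b - a)).
Proof.
move=> /andP[ab bc].
have -> : iota 0 c = iota 0 a ++ iota a (b - a) ++ iota b (c - b).
  have e2 : iota 0 b = iota 0 a ++ iota a (b - a) by rewrite -{1}(subnKC ab) iotaD.
  by rewrite catA -e2 -{1}(subnKC bc) iotaD.
rewrite !count_cat.
rewrite (@eq_in_count _ _ pred0 (iota 0 a)) ?count_pred0; last first.
  by move=> j; rewrite mem_iota /=; lia.
rewrite (@eq_in_count _ _ pred0 (iota b _)) ?count_pred0; last first.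
  by move=> j; rewrite mem_iota /=; lia.
rewrite add0n addn0 -[in iota a _](addn0 a) iotaDl count_map.
rewrite addn0; apply: eq_in_count => d; rewrite mem_iota /= => h.
by rewrite (_ : _ <= _ < _) //; lia.
Qed.

Section Chains.

Variables (mu lam : nat -> nat).

Definition fillP r c (t : nat -> nat -> nat) : Prop :=
  (forall i j, i < r -> j < c -> (t i j != 0) = (mu i <= j < lam i)) /\
  (forall i j j', i < r -> j <= j' -> mu i <= j -> j' < lam i ->
     t i j <= t i j').

(* A filling t with weakly increasing rows is encoded by the lengths p s i that
   row i has once the entries <= s are in place. *)
Definition chainP N r (p : nat -> nat -> nat) : Prop :=
  [/\ forall i, i < r -> p 0 i = mu i, forall i, i < r -> p N i = lam i
    & forall t i, t < N -> i < r -> p t i <= p t.+1 i].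

Lemma chain_mono N r p t t' i : chainP N r p -> t <= t' -> t' <= N -> i < r ->
  p t i <= p t' i.
Proof.
case=> _ _ mon tt' t'N ir; rewrite -(subnKC tt').
have : t' - t <= N - t by lia.
elim: (t' - t) => [|d IH] h; first by rewrite addn0.
by rewrite (leq_trans (IH _)) ?addnS ?mon //; lia.
Qed.

(** The entry is the first [s] whose shape contains the box, obtained as the number of shapes that
    miss it. *)
Definition fill_of N (p : nat -> nat -> nat) i j :=
  if mu i <= j < lam i then count (fun s => p s i <= j) (iota 0 N.+1) else 0.

Definition chain_of c (t : nat -> nat -> nat) s i :=
  mu i + count (fun j => (mu i <= j < lam i) && (t i j <= s)) (iota 0 c).

(** A box lies in the shape of index [s] exactly when its entry is at most [s]. This equivalence and
    its counterpart [chain_of_galois] make the two translations mutually inverse. *)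
Lemma fill_of_galois N r p i j s : chainP N r p -> i < r -> mu i <= j < lam i ->
  s <= N -> (fill_of N p i j <= s) = (j < p s i).
Proof.
move=> ch ir ij sN; rewrite /fill_of ij leqNgt.
rewrite -(@count_prefix N.+1 (fun s => p s i <= j)) ?ltnS -?ltnNge //.
by move=> s1 s2 le lt; apply: leq_trans; apply: (chain_mono ch).
Qed.

Lemma fill_of_le N p r i j : chainP N r p -> i < r -> fill_of N p i j <= N.
Proof.
move=> ch ir; case: (boolP (mu i <= j < lam i)) => ij; last by rewrite /fill_of (negPf ij).
have [_ pN _] := ch; rewrite (fill_of_galois ch) ?pN //; by case/andP: ij.
Qed.

Lemma fill_ofP N r c p : chainP N r p -> fillP r c (fill_of N p).
Proof.
move=> ch; split=> [i j ir jc|i j j' ir jj' mj jl].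
  case: (boolP (mu i <= j < lam i)) => ij; last by rewrite /fill_of (negPf ij).
  have [p0 _ _] := ch; rewrite -lt0n ltnNge (fill_of_galois ch) ?p0 //.
  by rewrite -leqNgt; case/andP: ij.
rewrite (fill_of_galois ch) ?(fill_of_le _ ch) //; last lia.
have h : j' < p (fill_of N p i j') i.
  by rewrite -(fill_of_galois ch) ?(fill_of_le _ ch) //; lia.
lia.
Qed.

Variables (r c : nat).
Hypothesis mulam : forall i, i < r -> mu i <= lam i <= c.

Lemma chain_of_galois t i j s : fillP r c t -> i < r -> mu i <= j < lam i ->
  (j < chain_of c t s i) = (t i j <= s).
Proof.
move=> [_ mon] ir ij; rewrite /chain_of count_range ?mulam //.
rewrite -{1}(subnKC (proj1 (andP ij))) ltn_add2l.
rewrite -(@count_prefix _ (fun d => t i (mu i + d) <= s)); last by lia.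
  by rewrite subnKC //; case/andP: ij.
by move=> s1 s2 le lt; apply: leq_trans; apply: mon => //; lia.
Qed.

Lemma chain_of_bound t i s : i < r ->
  mu i <= chain_of c t s i <= lam i.
Proof.
move=> ir; have := mulam ir => h; rewrite /chain_of count_range //.
by have := count_size (fun d => t i (mu i + d) <= s) (iota 0 (lam i - mu i));
   rewrite size_iota; lia.
Qed.

Lemma chain_ofP N t : fillP r c t -> (forall i j, i < r -> j < c -> t i j <= N) ->
  chainP N r (chain_of c t).
Proof.
move=> ft tN; have [f0 mon] := ft; split=> [i ir|i ir|s i sN ir].
- rewrite /chain_of (@eq_in_count _ _ pred0) ?count_pred0 ?addn0 //.
  move=> j; rewrite mem_iota /= => jc; rewrite leqn0.
  by rewrite -f0 //; case: eqP.
- have := mulam ir => h; rewrite /chain_of count_range //.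
  rewrite (@eq_in_count _ _ predT) ?count_predT ?size_iota; first lia.
  by move=> d; rewrite mem_iota /= => ?; apply: tN; lia.
- rewrite /chain_of leq_add2l; apply: sub_count => j /andP[-> /=].
  exact: leqW.
Qed.

Lemma chain_fillK N p s i : chainP N r p -> s <= N -> i < r ->
  chain_of c (fill_of N p) s i = p s i.
Proof.
move=> ch sN ir; have [p0 pN _] := ch.
have b1 := chain_of_bound (fill_of N p) s ir.
have b2 : mu i <= p s i <= lam i.
  by rewrite -p0 // -pN // !(chain_mono ch).
apply: (@leq_eqP _ _ (lam i)); try lia.
move=> j jl; case: (ltnP j (mu i)) => jm; first by apply/idP/idP; lia.
rewrite leqNgt chain_of_galois ?jm // ?(fill_of_galois ch) ?jm // -?leqNgt //.
exact: fill_ofP ch.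
Qed.

Lemma fill_chainK N t i j : fillP r c t -> 
  (forall i j, i < r -> j < c -> t i j <= N) -> i < r -> j < c ->
  fill_of N (chain_of c t) i j = t i j.
Proof.
move=> ft tN ir jc; have [f0 _] := ft.
have ch := chain_ofP ft tN.
case: (boolP (mu i <= j < lam i)) => ij; last first.
  rewrite /fill_of (negPf ij); apply/esym.
  by have := f0 i j ir jc; rewrite (negPf ij) => /negbFE/eqP.
apply: (@leq_eqP _ _ N); rewrite ?(fill_of_le _ ch) ?tN // => s sN.
by rewrite (fill_of_galois ch) ?chain_of_galois // ltnW.
Qed.

Variables (N B : nat).
Hypothesis lamB : forall i, i < r -> lam i <= B.

Definition T2P (T : 'M['I_N.+1]_(r, c)) : 'M['I_B.+1]_(N.+1, r) :=
  mk B N.+1 r (chain_of c (ev T)).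

Lemma ev_T2P T s i : s <= N -> i < r -> ev (T2P T) s i = chain_of c (ev T) s i.
Proof.
move=> sN ir; rewrite ev_mk //; have := lamB ir; have := chain_of_bound (ev T) s ir.
lia.
Qed.

Lemma chainP_ext p q : (forall s i, s <= N -> i < r -> p s i = q s i) ->
  chainP N r p -> chainP N r q.
Proof.
move=> pq [p0 pN mon]; split=> [i ir|i ir|s i sN ir].
- by rewrite -pq // p0.
- by rewrite -pq // pN.
- by rewrite -!pq ?mon // ltnW.
Qed.

Lemma T2P_chain T : fillP r c (ev T) -> chainP N r (ev (T2P T)).
Proof.
move=> ft; apply: chainP_ext (chain_ofP ft _) => [s i sN ir|i j _ _].
  by rewrite ev_T2P.
exact: ev_le.
Qed.

Lemma T2P_galois T i j s : fillP r c (ev T) -> i < r -> mu i <= j < lam i ->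
  s <= N -> (j < ev (T2P T) s i) = (ev T i j <= s).
Proof. by move=> ft ir ij sN; rewrite ev_T2P // chain_of_galois. Qed.

Lemma T2P_inj T T' : fillP r c (ev T) -> fillP r c (ev T') ->
  T2P T = T2P T' -> T = T'.
Proof.
move=> f1 f2 e12; apply: ev_inj => i j ir jc.
have b1 (U : 'M['I_N.+1]_(r, c)) i' j' : i' < r -> j' < c -> ev U i' j' <= N.
  by move=> _ _; exact: ev_le.
rewrite -(fill_chainK f1 (b1 T) ir jc) -(fill_chainK f2 (b1 T') ir jc).
rewrite /fill_of; case: ifP => // _; apply: eq_in_count => s.
by rewrite mem_iota add0n ltnS /= => sN; rewrite -!ev_T2P // e12.
Qed.

Lemma T2P_onto P : chainP N r (ev P) -> exists2 T, fillP r c (ev T) & T2P T = P.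
Proof.
move=> ch; pose T : 'M['I_N.+1]_(r, c) := mk N r c (fill_of N (ev P)).
have eT i j : i < r -> j < c -> ev T i j = fill_of N (ev P) i j.
  by move=> ir jc; rewrite ev_mk // (fill_of_le _ ch).
exists T.
  have [f1 f2] := @fill_ofP N r c _ ch.
  split=> [i j ir jc|i j j' ir jj' mj jl]; first by rewrite eT ?f1.
  by have := mulam ir => h; rewrite !eT ?f2 //; lia.
apply: ev_inj => s i; rewrite ltnS => sN ir; rewrite ev_T2P //.
rewrite -(chain_fillK ch sN ir) /chain_of; congr addn.
by apply: eq_in_count => j; rewrite mem_iota /= => jc; rewrite eT.
Qed.

Lemma card_ord_range a b : b <= c -> #|[set j : 'I_c | a <= j < b]| = b - a.
Proof.
move=> bc; rewrite cardE -(size_map val) -[RHS](size_iota a).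
apply/perm_size/uniq_perm; rewrite ?iota_uniq ?map_inj_uniq ?enum_uniq //.
  exact: val_inj.
move=> j; rewrite mem_iota; apply/mapP/idP => [[k]|h].
  by rewrite mem_enum inE => /= ? ->; lia.
have jc : j < c by lia.
by exists (Ordinal jc); rewrite // mem_enum inE /=; lia.
Qed.

Lemma occE m n (T : 'M['I_N.+1]_(m, n)) v :
  occ T v = \sum_(i < m) #|[set j : 'I_n | ev T i j == v]|.
Proof.
rewrite /occ -sum1dep_card.
rewrite -(pair_big_dep xpredT (fun i j => T i j == v :> nat) (fun _ _ => 1)) /=.
by apply: eq_bigr => i _; rewrite sum1dep_card; apply: eq_card => j; rewrite !inE evE.
Qed.

(** In row [i] the entries [v.+1] fill the columns by which the row grows from shape [v] to shape
    [v.+1]. *)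
Lemma T2P_occ T v : fillP r c (ev T) -> v < N ->
  occ T v.+1 = \sum_(i < r) (ev (T2P T) v.+1 i - ev (T2P T) v i).
Proof.
move=> ft vN; rewrite occE; apply: eq_bigr => i _.
have [p0 pN mon] := T2P_chain ft; have := mulam (ltn_ord i) => h.
rewrite -card_ord_range; last first.
  have := @chain_mono N r _ v.+1 N i (T2P_chain ft); rewrite pN //.
  by move=> /(_ vN (leqnn _) (ltn_ord _)); lia.
apply: eq_card => j; rewrite !inE.
have b1 : mu i <= ev (T2P T) v i.
  by rewrite -p0 //; apply: (chain_mono (T2P_chain ft)) => //; lia.
have b2 : ev (T2P T) v.+1 i <= lam i.
  by rewrite -pN //; apply: (chain_mono (T2P_chain ft)).
case: (boolP (mu i <= j < lam i)) => ij.
  rewrite [ev _ v i <= j]leqNgt !T2P_galois //; last lia.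
  by rewrite -ltnNge; apply/eqP/idP; lia.
have [f0 _] := ft; have := f0 i j (ltn_ord i) (ltn_ord j).
by rewrite (negPf ij) => /negbFE/eqP ->; apply/esym/negbTE; lia.
Qed.

End Chains.

(** * Standard tableaux as words *)

(* A standard tableau is encoded by the word of the rows of 1, 2, ..., n;
   shape m w is the shape reached by adding the boxes of w to m. *)
Definition shape (m : nat -> nat) (w : seq nat) i := m i + count_mem i w.

Definition valid (m l : nat -> nat) (w : seq nat) : Prop :=
  (forall k i, shape m (take k w) i.+1 <= shape m (take k w) i) /\
  (forall i, shape m w i = l i).

(** Computable on purpose: this enumeration indexes the sums in the general proofs and is evaluated
    by [vm_compute] in the separating examples. The comparison with row [i.-1] keeps every
    intermediate shape a partition. *)
Fixpoint words (l s : seq nat) n : seq (seq nat) :=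
  if n is n'.+1 then
    flatten [seq [seq i :: w | w <- words l (incr_nth s i) n']
            | i <- iota 0 (size l) & (nth 0 s i < nth 0 l i) &&
                 ((i == 0) || (nth 0 s i < nth 0 s i.-1))]
  else [:: [::]].

(** The row of the entry [k] stands at index [k.-1], so this compares the rows of [k] and [k.+1]. *)
Definition wdesc (w : seq nat) : seq nat :=
  [seq k <- iota 1 (size w).-1 | nth 0 w k.-1 < nth 0 w k].

Lemma shape_cons m i w j : shape m (i :: w) j = shape (fun k => m k + (i == k)) w j.
Proof. by rewrite /shape /= addnA. Qed.

Lemma eq_shape m m' w : m =1 m' -> shape m w =1 shape m' w.
Proof. by move=> h i; rewrite /shape h. Qed.

(** Only rows that receive a box are ever compared with [l], which explains the guard in the last
    clause. *)
Lemma mem_words l s n w : (forall i, nth 0 s i.+1 <= nth 0 s i) ->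
  reflect [/\ size w = n,
              forall k i, shape (nth 0 s) (take k w) i.+1 <=
                          shape (nth 0 s) (take k w) i
            & forall i, 0 < count_mem i w -> shape (nth 0 s) w i <= nth 0 l i]
          (w \in words l s n).
Proof.
elim: n s w => [|n IH] s w dec /=.
  rewrite inE; apply: (iffP eqP) => [-> | [/size0nil -> //]].
  by split=> // k i; rewrite /shape /= !addn0.
have incE i j : nth 0 (incr_nth s i) j = nth 0 s j + (i == j).
  by rewrite nth_incr_nth addnC.
apply: (iffP flatten_mapP) => [[i]|[]].
  rewrite mem_filter mem_iota /= => /andP[/andP[lt1 lt2] il] /mapP[w' w'in ->].
  have dec' j : nth 0 (incr_nth s i) j.+1 <= nth 0 (incr_nth s i) j.
    rewrite !incE; have := dec j; case: (i =P j.+1) lt2 => [->|] /=; lia.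
  have [sz h1 h2] := IH _ _ dec' w'in; split=> [|[|k] j|j cj] /=.
  - by rewrite sz.
  - by rewrite /shape /= !addn0.
  - by rewrite !shape_cons -!(eq_shape _ (incE i)).
  - rewrite shape_cons -(eq_shape _ (incE i)).
    case: (posnP (count_mem j w')) => [c0|/h2 //].
    rewrite /shape c0 addn0 incE.
    by move: cj; rewrite /= c0 addn0; case: eqP => // <- _; rewrite addn1.
case: w => // i w [sz] h1 h2.
have e1 k j : shape (nth 0 s) (take k.+1 (i :: w)) j =
    shape (nth 0 (incr_nth s i)) (take k w) j.
  by rewrite /= shape_cons -(eq_shape _ (incE i)).
have si : nth 0 s i < nth 0 l i.
  by have := h2 i; rewrite /shape /= eqxx; lia.
exists i.
  rewrite mem_filter mem_iota /= si andTb add0n.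
  have il : i < size l.
    by rewrite ltnNge; apply/negP => h; rewrite (nth_default _ h) in si.
  rewrite il andbT; case: i il si e1 h1 h2 {incE} => // i il si e1 h1 h2.
  by have := h1 1 i; rewrite /= take0 /shape /= eqxx; case: eqP => /=; lia.
apply: map_f; apply/IH => [j|].
  by have := h1 1 j; rewrite !e1 take0 /shape /= !addn0.
split=> // [k j|j cj]; first by rewrite -!e1.
by rewrite (eq_shape _ (incE i)) -shape_cons; apply: h2; rewrite /= addn_gt0 cj orbT.
Qed.

Lemma uniq_words l s n : uniq (words l s n).
Proof.
elim: n s => //= n IH s; move: (iota_uniq 0 (size l)).
elim: (iota _ _) => //= i r IHr /andP[ir ur]; case: ifP => _ /=; last exact: IHr.
rewrite cat_uniq IHr // andbT map_inj_uniq ?IH; last by move=> ? ? [].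
apply/hasPn => w /flatten_mapP[j]; rewrite mem_filter => /andP[_ jr] /mapP[w' _ ->].
by apply/mapP => -[w'' _ [ji]]; rewrite ji (negPf ir) in jr.
Qed.

Lemma sum_count_mem r w : all (fun x => x < r) w ->
  \sum_(i < r) count_mem (i : nat) w = size w.
Proof.
elim: w => [|x w IH] /=; first by rewrite big1.
case/andP => xr /IH <-; rewrite big_split /= -add1n; congr (_ + _).
rewrite (bigD1 (Ordinal xr)) //= eqxx big1 ?addn0 // => i ne.
by apply/eqP; rewrite eqb0; apply: contra ne => /eqP xi; apply/eqP/ord_inj.
Qed.

Lemma is_part_nth l i : is_part l -> nth 0 l i.+1 <= nth 0 l i.
Proof.
case/andP => sl _; case: (ltnP i.+1 (size l)) => h; last by rewrite nth_default.
have tr : transitive geq by move=> x y z /= h1 h2; exact: leq_trans h2 h1.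
by apply: (sorted_leq_nth tr (fun x => leqnn x) 0 sl); rewrite ?inE //; lia.
Qed.

Lemma nonincr (f : nat -> nat) : (forall i, f i.+1 <= f i) ->
  forall i j, i <= j -> f j <= f i.
Proof.
move=> h i j ij; rewrite -(subnKC ij); elim: (j - i) => [|d IH]; rewrite ?addn0 //.
by rewrite addnS (leq_trans (h _)).
Qed.

Lemma nth_maxpart l i : nth 0 l i <= maxpart l.
Proof.
case: (ltnP i (size l)) => h; last by rewrite nth_default.
by apply: leq_bigmax_seq => //; exact: mem_nth.
Qed.

Lemma skew_sizeE l m :
  skew_size l m = \sum_(i < size l) (nth 0 l i - nth 0 m i).
Proof.
rewrite /skew_size -sum1dep_card.
rewrite -(pair_big_dep xpredT (fun (i : 'I_(size l)) (j : 'I_(maxpart l)) =>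
  skew_diagram l m i j) (fun _ _ => 1)) /=.
apply: eq_bigr => i _; rewrite sum1dep_card.
by rewrite -(@card_ord_range (maxpart l)) ?nth_maxpart.
Qed.

(** No row exceeds that of [l], and with exactly [skew_size l m] letters the totals agree; hence
    every row is full. *)
Lemma mem_words_valid l m w : is_part m ->
    (forall i, nth 0 m i <= nth 0 l i) ->
  reflect (valid (nth 0 m) (nth 0 l) w) (w \in words l m (skew_size l m)).
Proof.
move=> pm ml; apply: (iffP (mem_words _ _ _ (fun i => is_part_nth i pm))).
  case=> sz h1 h2; split=> // i.
  have ha : all (fun x => x < size l) w.
    apply/allP => x xw; rewrite ltnNge; apply/negP => h.
    have cx : 0 < count_mem x w by rewrite -has_count has_pred1.
    by have := h2 x cx; rewrite /shape (nth_default _ h); lia.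
  have h3 j : shape (nth 0 m) w j <= nth 0 l j.
    case: (posnP (count_mem j w)) => [c0|]; last exact: h2.
    by rewrite /shape c0 addn0.
  case: (ltnP i (size l)) => il; last first.
    by apply/eqP; move: (h3 i); rewrite (nth_default _ il) leqn0.
  have := sum_count_mem ha; rewrite sz skew_sizeE => /eqP.
  rewrite -(eqn_add2l (\sum_(i < size l) nth 0 m i)) -!big_split /=.
  rewrite [X in _ == X](eq_bigr (fun j : 'I_(size l) => nth 0 l j)) => [|j _]; last first.
    by rewrite subnKC.
  move=> /eqP tot; apply/eqP; rewrite eqn_leq h3 /= leqNgt; apply/negP => lt.
  suff : \sum_(j < size l) (nth 0 m j + count_mem (j : nat) w) <
     \sum_(j < size l) nth 0 l j by rewrite tot ltnn.
  rewrite (bigD1 (Ordinal il)) //= [X in _ < X](bigD1 (Ordinal il)) //=.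
  by rewrite -addSn leq_add // leq_sum // => j _; exact: h3.
case=> h1 h2; split=> // [|i _]; last by rewrite h2.
have ha : all (fun x => x < size l) w.
  apply/allP => x xw; rewrite ltnNge; apply/negP => h.
  have cx : 0 < count_mem x w by rewrite -has_count has_pred1.
  by have := h2 x; rewrite /shape (nth_default _ h); lia.
rewrite -(sum_count_mem ha) skew_sizeE; apply: eq_bigr => i _.
by rewrite -h2 /shape addKn.
Qed.

Section Syt.

Variables (l m : seq nat).
Hypotheses (pl : is_part l) (pm : is_part m).
Hypothesis ml : forall i, nth 0 m i <= nth 0 l i.

Let r := size l.
Let c := maxpart l.
Let n := skew_size l m.
Let L := nth 0 l.
Let M := nth 0 m.
Let T2P' := @T2P M L r c n c.

Let mulam i : i < r -> M i <= L i <= c.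
Proof. by move=> _; rewrite /M /L ml nth_maxpart. Qed.

Let lamB i : i < r -> L i <= c.
Proof. by move=> _; rewrite nth_maxpart. Qed.

Definition one_step (p : nat -> nat -> nat) v := 
  exists2 i, i < r & forall j, j < r -> p v.+1 j = p v j + (i == j).

Lemma one_stepP p v : (forall i, i < r -> p v i <= p v.+1 i) ->
  \sum_(i < r) (p v.+1 i - p v i) = 1 <-> one_step p v.
Proof.
move=> mon; split=> [/eqP s1|[i ir h]].
  case: (pickP (fun i : 'I_r => p v i < p v.+1 i)) => [i lt|h]; last first.
    move: s1; rewrite big1 // => i _; have := h i; have := mon i (ltn_ord i); lia.
  exists i => // j jr; case: (eqVneq (i : nat) j) => [<-|ij].
    by move: s1; rewrite (bigD1 i) //=; lia.
  rewrite addn0; apply/eqP; rewrite eqn_leq mon // andbT leqNgt; apply/negP => lt'.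
  move: s1; rewrite (bigD1 i) //= (bigD1 (Ordinal jr)) /=; first by lia.
  by apply: contra ij => /eqP <-.
rewrite (bigD1 (Ordinal ir)) //= h // eqxx big1; first lia.
move=> j ne; rewrite h //; case: eqP => [ij|_]; last by lia.
by case/eqP: ne; exact/ord_inj.
Qed.

(** Using each entry once means that each step adds one box, and the column condition means that
    every intermediate shape is a partition. *)
Lemma sytP T : is_syt m T <-> 
  [/\ fillP M L r c (ev T), forall v, v < n -> one_step (ev (T2P' T)) v
    & forall t i, t <= n -> ev (T2P' T) t i.+1 <= ev (T2P' T) t i].
Proof.
split.
  case/and4P => /forallP fl /forallP oc /forallP rw /forallP cl.
  have ft : fillP M L r c (ev T).
    split=> [i j ir jc|i j j' ir jj' mj jl].
      have /forallP/(_ (Ordinal jc))/eqP := fl (Ordinal ir).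
      by rewrite -evE.
    have j'c : j' < c by have := lamB ir; lia.
    have jc : j < c by lia.
    move: jj'; rewrite leq_eqVlt => /orP[/eqP -> //|jj'].
    have /forallP/(_ (Ordinal jc))/forallP/(_ (Ordinal j'c)) := rw (Ordinal ir).
    rewrite /= /skew_diagram -/M -/L jj' mj jl -!evE /=.
    by rewrite (leq_trans mj) ?(leq_ltn_trans _ jl) ?(ltnW jj') //= => /ltnW.
  have ch := T2P_chain mulam lamB ft.
  have [p0 pN mon] := ch.
  split=> // [v vn|t i tn].
    apply/one_stepP; first by move=> i ir; apply: mon.
    by rewrite -(T2P_occ mulam lamB) //; exact/eqP/(oc (Ordinal vn)).
  case: (ltnP i.+1 r) => ir; last by rewrite ev_out_r.
  have ir' := ltnW ir.
  have c1 : ev (T2P' T) t i.+1 <= L i.+1 by rewrite -pN // (chain_mono ch).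
  have c2 : M i <= ev (T2P' T) t i by rewrite -p0 // (chain_mono ch).
  (* If row [i.+1] reaches beyond [M i], its last box lies under a box of row [i], whose entry is
     smaller and hence also at most [t]. *)
  have [le|lt] := leqP (ev (T2P' T) t i.+1) (M i); first exact: leq_trans le c2.
  have e : ev (T2P' T) t i.+1 = (ev (T2P' T) t i.+1).-1.+1 by lia.
  rewrite e; set j := _.-1.
  have Mi := is_part_nth i pm; have Li := is_part_nth i pl.
  have ij : M i <= j < L i by rewrite /L /M in c1 lt *; lia.
  have i1j : M i.+1 <= j < L i.+1 by rewrite /L /M in c1 lt *; lia.
  have jc : j < c by have := lamB ir; lia.
  have /forallP/(_ (Ordinal ir))/forallP/(_ (Ordinal jc)) := cl (Ordinal ir').
  rewrite /= /skew_diagram -/M -/L ij i1j ltnSn -!evE /= => h.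
  rewrite (T2P_galois mulam lamB) //.
  have := T2P_galois mulam lamB ft ir i1j tn.
  by rewrite -/T2P' e ltnSn => /esym; apply: leq_trans; exact: ltnW.
case=> ft one dec; have ch := T2P_chain mulam lamB ft; have [p0 pN mon] := ch.
have gal i j s : i < r -> M i <= j < L i -> s <= n ->
    (j < ev (T2P' T) s i) = (ev T i j <= s).
  by move=> ir ij sn; rewrite (T2P_galois mulam lamB).
have pos i j : i < r -> j < c -> M i <= j < L i -> 
    exists2 v, ev T i j = v.+1 & v < n.
  move=> ir jc ij; have [f0 _] := ft; have := f0 i j ir jc; rewrite ij => h.
  by exists (ev T i j).-1; have := ev_le T i j; lia.
apply/and4P; split.
- apply/forallP => i; apply/forallP => j; rewrite -evE; apply/eqP.
  by have [f0 _] := ft; exact: f0.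
- apply/forallP => v; rewrite (T2P_occ mulam lamB) //; apply/eqP/one_stepP.
    by move=> i ir; exact: mon.
  exact: one.
- apply/forallP => i; apply/forallP => j; apply/forallP => j'; apply/implyP.
  rewrite /skew_diagram -/M -/L -!evE => /and3P[jj' ij ij'].
  have [v e vn] := pos i j (ltn_ord i) (ltn_ord j) ij.
  have [i0 _ h] := one v vn; rewrite ltnNge; apply/negP => le.
  have := gal i j v (ltn_ord i) ij (ltnW vn); rewrite e ltnn => h1.
  have h2 := gal i j' v.+1 (ltn_ord i) ij' vn; rewrite -{2}e le h // in h2.
  by move: h1 h2; case: (i0 == i); lia.
- apply/forallP => i; apply/forallP => i'; apply/forallP => j; apply/implyP.
  rewrite /skew_diagram -/M -/L -!evE => /and3P[ii' ij i'j].
  have [v e vn] := pos i' j (ltn_ord i') (ltn_ord j) i'j.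
  have [i0 _ h] := one v vn.
  have := gal i' j v (ltn_ord i') i'j (ltnW vn); rewrite e ltnn => h1.
  have := gal i' j v.+1 (ltn_ord i') i'j vn; rewrite e leqnn h // => h2.
  (* Step [v.+1] adds its box in row [i'], so row [i], which is longer than [j] afterwards because
     the shape is a partition, had this length before. *)
  rewrite ltnS -gal // ?(ltnW vn) //.
  have d1 := nonincr (fun k => dec v k (ltnW vn)) (ltnW ii').
  have d2 := nonincr (fun k => dec v.+1 k vn) (ltnW ii').
  move: d2; rewrite !h //.
  by move: h1 h2; case: (i0 =P i') => [->|] //=; case: eqP => /=; lia.
Qed.

Definition sytw (T : 'M['I_n.+1]_(r, c)) : seq nat :=
  [seq find (fun i => ev (T2P' T) v i < ev (T2P' T) v.+1 i) (iota 0 r) | v <- iota 0 n].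

Lemma size_sytw T : size (sytw T) = n.
Proof. by rewrite size_map size_iota. Qed.

Lemma nth_sytw T v i : v < n -> i < r ->
  (forall j, j < r -> ev (T2P' T) v.+1 j = ev (T2P' T) v j + (i == j)) ->
  nth 0 (sytw T) v = i.
Proof.
move=> vn ir h; rewrite (nth_map 0) ?size_iota // nth_iota // add0n.
rewrite (@eq_in_find _ _ (pred1 i)) => [|j].
  by rewrite -[RHS](@index_uniq _ 0 i (iota 0 r)) ?iota_uniq ?size_iota ?nth_iota.
rewrite mem_iota => jr; rewrite h // /= [i == j]eq_sym.
by case: (j == i); lia.
Qed.

Lemma sytw_shape T t i : (forall v, v < n -> one_step (ev (T2P' T)) v) ->
  chainP M L n r (ev (T2P' T)) -> t <= n -> i < r ->
  shape M (take t (sytw T)) i = ev (T2P' T) t i.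
Proof.
move=> one [p0 _ _] tn ir; elim: t tn => [|t IH] tn.
  by rewrite take0 /shape /= addn0 p0.
rewrite (take_nth 0) ?size_sytw // /shape -cats1 count_cat addnA -/(shape _ _ _).
rewrite IH ?(ltnW tn) //; have [i0 i0r h] := one t tn.
by rewrite (nth_sytw tn i0r h) h //= addn0.
Qed.

Lemma sytw_lt_r T : (forall v, v < n -> one_step (ev (T2P' T)) v) ->
  forall x, x \in sytw T -> x < r.
Proof.
move=> one x /(nthP 0)[v]; rewrite size_sytw => vn <-.
by have [i0 i0r h] := one v vn; rewrite (nth_sytw vn i0r h).
Qed.

Lemma sytw_valid T : is_syt m T -> valid M L (sytw T).
Proof.
case/sytP => ft one dec; have ch := T2P_chain mulam lamB ft.
have out t i : r <= i -> shape M (take t (sytw T)) i = 0.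
  move=> ri; rewrite /shape; have := ml i; rewrite [nth 0 l i]nth_default // -/M.
  rewrite leqn0 => /eqP ->; apply/count_memPn/negP => /mem_take.
  by move/(sytw_lt_r one); rewrite ltnNge ri.
have sh t i : t <= n -> i < r -> shape M (take t (sytw T)) i = ev (T2P' T) t i.
  exact: sytw_shape.
split=> [k i|i].
  wlog kn : k / k <= n.
    move=> H; case: (leqP k n) => [/H //|nk]; have := H n (leqnn _).
    by rewrite !take_oversize ?size_sytw // ltnW.
  case: (ltnP i.+1 r) => ir; last by rewrite out.
  by rewrite !sh ?dec // ltnW.
rewrite -[sytw T]take_size size_sytw.
case: (ltnP i r) => ir; last by rewrite out // /L nth_default.
by have [_ pN _] := ch; rewrite sh // /T2P' pN.
Qed.

Lemma sytw_inj T T' : is_syt m T -> is_syt m T' -> sytw T = sytw T' -> T = T'.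
Proof.
case/sytP => ft one dec /sytP[ft' one' dec'] eqw.
have ch := T2P_chain mulam lamB ft; have ch' := T2P_chain mulam lamB ft'.
apply: (T2P_inj mulam lamB ft ft'); apply: ev_inj => t i tn ir.
by rewrite -!sytw_shape ?eqw.
Qed.

Lemma valid_lt_r w x : valid M L w -> x \in w -> x < r.
Proof.
case=> _ h xw; rewrite ltnNge; apply/negP => rx.
have cx : 0 < count_mem x w by rewrite -has_count has_pred1.
by have := h x; rewrite /shape /L (nth_default _ rx); lia.
Qed.

Lemma valid_size w : valid M L w -> size w = n.
Proof.
move=> vw; rewrite -(@sum_count_mem r) ?/n ?skew_sizeE; last first.
  by apply/allP => x; exact: valid_lt_r.
by apply: eq_bigr => i _; rewrite -/M -/L; have [_ <-] := vw; rewrite /shape addKn.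
Qed.

Lemma sytw_onto w : valid M L w -> exists2 T, is_syt m T & sytw T = w.
Proof.
move=> vw; have sz := valid_size vw; have [h1 h2] := vw.
pose p t i := shape M (take t w) i.
have step v i : v < n -> p v.+1 i = p v i + (nth 0 w v == i).
  by move=> vn; rewrite /p (take_nth 0) ?sz // /shape -cats1 count_cat /= addn0 addnA.
have chp : chainP M L n r p.
  split=> [i ir|i ir|t i tn ir].
  - by rewrite /p take0 /shape addn0.
  - by rewrite /p -sz take_size.
  - by rewrite step // leq_addr.
pose P := mk c n.+1 r p.
have eP t i : t <= n -> i < r -> ev P t i = p t i.
  move=> tn ir; rewrite ev_mk // (leq_trans _ (lamB ir)) //.
  by rewrite -h2 /p /shape leq_add2l -{2}(cat_take_drop t w) count_cat leq_addr.
have chP : chainP M L n r (ev P).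
  by apply: chainP_ext chp => t i tn ir; rewrite eP.
have [T ft TP] := T2P_onto mulam lamB chP.
have one v : v < n -> one_step (ev (T2P' T)) v.
  move=> vn; exists (nth 0 w v) => [|j jr].
    by apply: (valid_lt_r vw); rewrite mem_nth ?sz.
  by rewrite /T2P' TP !eP ?step // ltnW.
have ST : is_syt m T.
  apply/sytP; split=> // t i tn; rewrite /T2P' TP.
  case: (ltnP i.+1 r) => ir; last by rewrite ev_out_r.
  by rewrite !eP ?(ltnW ir) //; exact: h1.
exists T => //; apply: (@eq_from_nth _ 0); rewrite size_sytw // => v vn.
apply: nth_sytw => // [|j jr].
  by apply: (valid_lt_r vw); rewrite mem_nth ?sz.
by rewrite /T2P' TP !eP ?step // ltnW.
Qed.

Lemma syt_row T (i : 'I_r) (j : 'I_c) v : is_syt m T -> T i j = v.+1 :> nat ->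
  nth 0 (sytw T) v = i.
Proof.
case/sytP => ft one dec eT; rewrite -evE in eT.
have vn : v < n by rewrite -ltnS -eT ltnS ev_le.
have [i0 i0r h] := one v vn; rewrite (nth_sytw vn i0r h).
have [f0 _] := ft; have := f0 i j (ltn_ord i) (ltn_ord j); rewrite eT => /esym ij.
have := T2P_galois mulam lamB ft (ltn_ord i) ij vn; rewrite eT leqnn -/T2P' h //.
have := T2P_galois mulam lamB ft (ltn_ord i) ij (ltnW vn); rewrite eT ltnn -/T2P'.
by case: (i0 =P i) => //=; lia.
Qed.

Lemma syt_box (T : 'M['I_n.+1]_(r, c)) v : is_syt m T -> v < n ->
  exists x : 'I_r * 'I_c, T x.1 x.2 = v.+1 :> nat.
Proof.
case/and4P => _ /forallP oc _ _ vn; have /eqP := oc (Ordinal vn).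
rewrite /occ /= => h.
have /card_gt0P[x] : 0 < #|[set x : 'I_r * 'I_c | T x.1 x.2 == v.+1 :> nat]|.
  by rewrite h.
by rewrite inE => /eqP; exists x.
Qed.

Lemma syt_descent T k : is_syt m T -> 0 < k < n ->
  is_descent T k = (nth 0 (sytw T) k.-1 < nth 0 (sytw T) k).
Proof.
move=> sT /andP[k0 kn]; apply/existsP/idP.
  case=> x /existsP[y /and3P[/eqP ex /eqP ey xy]].
  by rewrite (syt_row sT ey) (@syt_row T x.1 x.2) // prednK.
have [x ex] := @syt_box T k.-1 sT (leq_ltn_trans (leq_pred _) kn).
have [y ey] := syt_box sT kn.
rewrite (syt_row sT ex) (syt_row sT ey) => lt.
by exists x; apply/existsP; exists y; rewrite ex ey lt prednK ?eqxx.
Qed.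

Lemma syt_desc_comp T : is_syt m T -> desc_comp T = comp_of n (wdesc (sytw T)).
Proof.
move=> sT; rewrite /desc_comp /wdesc size_sytw; congr comp_of.
by apply: eq_in_filter => k; rewrite mem_iota => h; apply: syt_descent => //; lia.
Qed.

Lemma sum_syt (R : nmodType) (F : seq nat -> R) :
  (\sum_(T : 'M['I_n.+1]_(r, c) | is_syt m T) F (desc_comp T) =
   \sum_(w <- words l m n) F (comp_of n (wdesc w)))%R.
Proof.
rewrite (eq_bigr (fun T => F (comp_of n (wdesc (sytw T))))); last first.
  by move=> T sT; rewrite syt_desc_comp.
rewrite -big_filter -(big_map sytw xpredT (fun w => F (comp_of n (wdesc w)))).
apply: perm_big; apply: uniq_perm.
- rewrite map_inj_in_uniq ?filter_uniq ?index_enum_uniq // => T T'.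
  by rewrite !mem_filter => /andP[sT _] /andP[sT' _]; exact: sytw_inj.
- exact: uniq_words.
move=> w; apply/mapP/mem_words_valid => //.
  by case=> T; rewrite mem_filter => /andP[sT _] ->; exact: sytw_valid.
by case/sytw_onto => T sT <-; exists T; rewrite ?mem_filter ?sT ?mem_index_enum.
Qed.

Lemma skew_schur_words e : skew_schur l m e =
  (\sum_(w <- words l m n) fundamental (comp_of n (wdesc w)) e)%R.
Proof. exact: (@sum_syt int (fun a => fundamental a e)). Qed.

End Syt.

(** * Semistandard tableaux as Gelfand-Tsetlin patterns *)

Definition cont r (p : nat -> nat -> nat) t := \sum_(i < r) (p t.+1 i - p t i).

(* Gelfand-Tsetlin patterns: p t is the shape formed by the entries <= t of a
   semistandard tableau of shape l/m. *)
Definition gtb (m l : nat -> nat) N r (p : nat -> nat -> nat) : bool :=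
  [&& alln r (fun i => p 0 i == m i), alln r (fun i => p N i == l i)
    & alln N (fun t => alln r (fun i =>
        (p t i <= p t.+1 i) && ((i.+1 < r) ==> (p t.+1 i.+1 <= p t i))))].

Definition gt_card B N r (m l e : nat -> nat) : nat :=
  #|[set P : 'M['I_B.+1]_(N.+1, r) |
      gtb m l N r (ev P) && alln N (fun t => cont r (ev P) t == e t)]|.

Lemma gtP m l N r p :
  reflect (chainP m l N r p /\
           forall t i, t < N -> i.+1 < r -> p t.+1 i.+1 <= p t i)
          (gtb m l N r p).
Proof.
apply: (iffP and3P).
  case=> /allnP h0 /allnP hN /allnP h; split; last first.
    by move=> t i tN ir; have /allnP/(_ i (ltnW ir)) := h t tN; rewrite ir => /andP[].
  split=> [i ir|i ir|t i tN ir]; [exact/eqP/h0|exact/eqP/hN|].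
  by have /allnP/(_ i ir)/andP[] := h t tN.
case=> -[h0 hN mon] h; split; apply/allnP => i ir; rewrite ?h0 ?hN //.
apply/allnP => j jr; rewrite mon //=; apply/implyP; exact: h.
Qed.

Definition psum (e : seq nat) t := sumn (take t e).

Lemma psumS e t : psum e t.+1 = psum e t + nth 0 e t.
Proof.
rewrite /psum; case: (ltnP t (size e)) => h.
  by rewrite (take_nth 0) // sumn_rcons.
by rewrite nth_default // addn0 !take_oversize // ltnW.
Qed.

Lemma psum_size e : psum e (size e) = sumn e.
Proof. by rewrite /psum take_size. Qed.

Lemma leq_psum e s t : s <= t -> psum e s <= psum e t.
Proof.
move=> st; rewrite -(subnKC st); elim: (t - s) => [|d IH]; first by rewrite addn0.
by rewrite addnS psumS (leq_trans IH) // leq_addr.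
Qed.

Lemma psum_le e t : psum e t <= sumn e.
Proof. by rewrite -{2}(cat_take_drop t e) sumn_cat leq_addr. Qed.

(** The letters of [w] that all become the value [s.+1] when a standard tableau is turned into a
    semistandard one of content [e]. *)
Definition block (e : seq nat) s (w : seq nat) := drop (psum e s) (take (psum e s.+1) w).

Lemma size_block e s w : size w = sumn e -> size (block e s w) = nth 0 e s.
Proof.
move=> sz; rewrite size_drop size_takel ?sz ?psum_le // psumS; lia.
Qed.

Lemma cat_block e s w : take (psum e s.+1) w = take (psum e s) w ++ block e s w.
Proof.
rewrite /block -{1}(cat_take_drop (psum e s) (take (psum e s.+1) w)).
by rewrite take_takel // leq_psum.
Qed.

(** A zero entry of [e] only repeats a partial sum, so dropping zeros does not change the set of
    partial sums. *)
Lemma mem_cuts_flat e k : 0 < k < sumn e ->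
  reflect (exists2 t, t < size e & psum e t = k) (k \in cuts (flat e)).
Proof.
elim: e k => [|x e IH] k /=; first by lia.
case: x => [|x] /= kx.
  apply: (iffP (IH k _)) => [|[t ts <-]|[t ts ek]]; first lia.
    by exists t.+1.
  by case: t ts ek => [|t] ts ek; [move: ek; rewrite /psum /=; lia|exists t].
have cE : cuts (x.+1 :: flat e) = if flat e is [::] then [::] else
    x.+1 :: [seq x.+1 + k | k <- cuts (flat e)].
  rewrite /cuts /=; case: (flat e) => // y f /=; rewrite addn0.
  congr (_ :: _); rewrite -map_comp -[2]/(1 + 1) iotaDl -map_comp.
  by apply: eq_map => i /=.
rewrite [cuts _]cE; case fe: (flat e) => [|y f].
  have : sumn e = 0 by rewrite -sumn_flat fe.
  move=> se; constructor=> -[[|t] /=]; first by rewrite /psum /=; lia.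
  rewrite /psum /= => _; have := psum_le e t; rewrite /psum; lia.
rewrite inE -fe; apply: (iffP orP) => [[/eqP ->|/mapP[j jc ->]]|[[|t] ts ek]].
- by exists 1 => //=; [case: (e) fe|rewrite /psum /= take0 addn0].
- have /IH : 0 < j < sumn e by rewrite -sumn_flat mem_cuts ?is_comp_flat.
  by case/(_ jc) => t ts <-; exists t.+1.
- by move: ek kx; rewrite /psum /=; lia.
- move: ek; rewrite /psum /= => ek; case: (posnP (sumn (take t e))) => t0.
    by left; apply/eqP; lia.
  right; apply/mapP; exists (sumn (take t e)); last by lia.
  by apply/IH; [lia|exists t].
Qed.

(** A position that is not a partial sum of [e] lies inside a block, so [wdesc w] stays within the
    partial sums exactly when no block contains an ascent. *)
Lemma wdesc_blocks e w : size w = sumn e ->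
  all (mem (cuts (flat e))) (wdesc w) =
  alln (size e) (fun t => sorted geq (block e t w)).
Proof.
move=> sz; apply/allP/allnP => h.
  move=> t ts; apply/(sortedP 0) => k; rewrite size_block // => kt.
  have kt' : psum e t + k.+1 < psum e t.+1 by rewrite psumS; lia.
  rewrite /geq /= /block !nth_drop !nth_take ?(leq_trans _ kt') //; last lia.
  rewrite leqNgt; apply/negP => lt.
  have ks : psum e t.+1 <= sumn e := psum_le _ _.
  have /h : psum e t + k.+1 \in wdesc w.
    by rewrite mem_filter mem_iota sz [in _.-1]addnS /= lt /=; lia.
  rewrite /= => /mem_cuts_flat -[|t' t's et']; first by lia.
  case: (leqP t' t) => [/(leq_psum e)|]; first by lia.
  by move/(leq_psum e); lia.
move=> k; rewrite mem_filter mem_iota => /andP[lt kw] /=.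
have kb : 0 < k < sumn e by lia.
apply/mem_cuts_flat => //.
have ex : exists t, k < psum e t by exists (size e); rewrite psum_size; lia.
case: (ex_minnP ex) => -[|t] kt min; first by move: kt; rewrite /psum take0 ltn0.
have tk : psum e t <= k by rewrite leqNgt; apply/negP => /min; rewrite ltnn.
have ts : t < size e.
  rewrite ltnNge; apply/negP => h'; have := leq_psum e h'; rewrite psum_size.
  by have := psum_le e t.+1; lia.
exists t => //; apply/eqP; rewrite eqn_leq tk /= leqNgt; apply/negP => lt'.
have /(sortedP 0)/(_ (k.-1 - psum e t)) := h t ts.
rewrite size_block // /geq /= /block !nth_drop !nth_take; try lia.
rewrite subnKC; last lia.
have -> : psum e t + (k.-1 - psum e t).+1 = k by lia.
by have := psumS e t; lia.
Qed.

Lemma take_sorted_geq i u : sorted geq u ->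
  take (count (ltn i) u) u = filter (ltn i) u.
Proof.
elim: u => //= x u IH; case: ifP => [ix|/negbT ix] su.
  by rewrite /= IH // (path_sorted su).
have h : all (predC (ltn i)) u.
  have tr : transitive geq by move=> y z t /= h1 h2; exact: leq_trans h2 h1.
  move: su; rewrite path_sortedE // => /andP[/allP h _].
  by apply/allP => y /h /=; rewrite -leqNgt -leqNgt in ix *; move/leq_trans; apply.
have c0 : count (ltn i) u = 0.
  by apply/eqP; rewrite -leqn0 leqNgt -has_count -all_predC.
by rewrite c0; apply/esym/eqP; rewrite -size_eq0 size_filter c0.
Qed.

(* A weakly decreasing word adds its boxes from the bottom row upwards, so its
   intermediate shapes are partitions only if it adds a horizontal strip. *)
Lemma hstrip_of_dec m u : sorted geq u ->
  (forall k i, shape m (take k u) i.+1 <= shape m (take k u) i) ->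
  forall i, shape m u i.+1 <= m i.
Proof.
move=> su h i; have := h (count (ltn i) u) i; rewrite take_sorted_geq // /shape.
rewrite !count_filter (@eq_count _ _ (pred1 i.+1) _ u); last first.
  by move=> x /=; case: eqP => [->|]; rewrite ?ltnSn.
rewrite (@eq_count _ (predI _ _) pred0) ?count_pred0 ?addn0 // => x /=.
by case: eqP => [->|]; rewrite ?ltnn.
Qed.

Lemma dec_word_exists r (q : nat -> nat) : exists2 u, sorted geq u &
  forall i, count_mem i u = if i < r then q i else 0.
Proof.
elim: r => [|r [u su cu]]; first by exists [::].
exists (sort geq (nseq (q r) r ++ u)) => [|i].
  by apply: sort_sorted => x y; exact: leq_total.
rewrite (seq.permP (permEl (perm_sort _ _))) count_cat cu count_nseq /= ltnS.
by case: (ltngtP i r) => [|//|->]; rewrite ?ltnn ?mul1n ?addn0 // /= mul0n.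
Qed.

Lemma shape_cat m u w i : shape m (u ++ w) i = shape (shape m u) w i.
Proof. by rewrite /shape count_cat addnA. Qed.

Lemma shape_take_le m k u i : shape m (take k u) i <= shape m u i.
Proof. by rewrite /shape -{2}(cat_take_drop k u) count_cat leq_add2l leq_addr. Qed.

Lemma valid_prefix m l w k i : valid m l w ->
  shape m (take k w) i.+1 <= shape m (take k w) i.
Proof. by case. Qed.

Lemma prefix_cat m u w :
  (forall k i, shape m (take k u) i.+1 <= shape m (take k u) i) ->
  (forall k i, shape (shape m u) (take k w) i.+1 <= shape (shape m u) (take k w) i) ->
  forall k i, shape m (take k (u ++ w)) i.+1 <= shape m (take k (u ++ w)) i.
Proof.
move=> hu hw k i; rewrite take_cat; case: ltnP => _; first exact: hu.
by rewrite !shape_cat.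
Qed.

Lemma prefix_hstrip m u : (forall i, shape m u i.+1 <= m i) ->
  forall k i, shape m (take k u) i.+1 <= shape m (take k u) i.
Proof.
move=> h k i; apply: leq_trans (shape_take_le _ _ _ _) _.
by apply: leq_trans (h i) _; rewrite /shape leq_addr.
Qed.

Section GT.

Variables (l m : seq nat).
Hypotheses (pl : is_part l) (pm : is_part m).
Hypothesis ml : forall i, nth 0 m i <= nth 0 l i.

Let r := size l.
Let n := skew_size l m.
Let L := nth 0 l.
Let M := nth 0 m.

Lemma skew_schurE e : skew_schur l m e =
  Posz (if sumn e == n then
    count (fun w => all (mem (cuts (flat e))) (wdesc w)) (words l m n) else 0).
Proof.
rewrite skew_schur_words // -/n.
rewrite (eq_big_seq (fun w => Posz ((sumn e == n) &&
    all (mem (cuts (flat e))) (wdesc w)))) => [|w wV].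
  case: eqP => _ /=; last by rewrite big1.
  elim: (words _ _ _) => [|w s IH]; first by rewrite big_nil.
  by rewrite big_cons IH.
have sz : size w = n.
  by apply: (valid_size pl pm); exact/(mem_words_valid _ pm ml).
have [n0|n0] := posnP n.
  by rewrite fundamentalE n0 // /wdesc sz n0.
have [|ca cs cc] := @comp_of_spec n (wdesc w); last by rewrite fundamentalE // cs cc.
apply: path_rcons_ltn => // [|x].
  apply: sorted_filter; last exact: iota_ltn_sorted.
  by move=> ? ? ?; exact: ltn_trans.
by rewrite mem_filter mem_iota sz => /andP[_]; lia.
Qed.

Lemma skew_schur_flat e : skew_schur l m (flat e) = skew_schur l m e.
Proof. by rewrite !skew_schurE sumn_flat (flat_comp (is_comp_flat e)). Qed.

Lemma skew_schur_0 e : sumn e != n -> skew_schur l m e = 0%R.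
Proof. by rewrite skew_schurE => /negPf ->. Qed.

(** Standardization: a word with weakly decreasing blocks corresponds to the sequence of shapes at
    the ends of its blocks, because such a block is determined by its multiset of letters and adds a
    horizontal strip. The number [B] only fixes the finite type of patterns. *)
Lemma skew_schur_gt B e : (forall i, L i <= B) -> sumn e = n ->
  skew_schur l m e = Posz (gt_card B (size e) r M L (nth 0 e)).
Proof.
move=> LB sume; rewrite skew_schurE sume eqxx; congr Posz.
set N := size e; pose p w t i := shape M (take (psum e t) w) i.
pose P w : 'M['I_B.+1]_(N.+1, r) := mk B N.+1 r (p w).
rewrite -size_filter /gt_card cardE -(size_map P).
have vP w : valid M L w -> forall t i, t <= N -> i < r -> ev (P w) t i = p w t i.
  move=> [_ wL] t i tN ir; rewrite ev_mk // (leq_trans _ (LB i)) // -wL.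
  exact: shape_take_le.
have pcount w t i : p w t.+1 i = p w t i + count_mem i (block e t w).
  by rewrite /p cat_block /shape count_cat addnA.
apply/perm_size/uniq_perm; rewrite ?enum_uniq //.
  rewrite map_inj_in_uniq ?filter_uniq ?uniq_words // => w w'.
  rewrite !mem_filter => /andP[dw /(mem_words_valid _ pm ml) vw] /andP[dw' /(mem_words_valid _ pm ml) vw'].
  move=> eP.
  have sz := valid_size pl pm vw; have sz' := valid_size pl pm vw'.
  rewrite wdesc_blocks ?sz // in dw; rewrite wdesc_blocks ?sz' // in dw'.
  have ep t i : t <= N -> p w t i = p w' t i.
    move=> tN; case: (ltnP i r) => ir; first by rewrite -!vP // eP.
    have out w1 : valid M L w1 -> p w1 t i = M i.
      move=> v1; rewrite /p /shape (_ : count_mem i _ = 0) ?addn0 //.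
      apply/count_memPn/negP => /mem_take /(valid_lt_r pl pm v1).
      by rewrite ltnNge ir.
    by rewrite !out.
  suff : take (psum e N) w = take (psum e N) w'.
    by rewrite psum_size sume /n -{1}sz take_size -sz' take_size.
  have : N <= N by []; elim: {-2}N => [|t IH] tN; first by rewrite /psum !take0.
  rewrite !cat_block IH ?(ltnW tN) //; congr (_ ++ _).
  have tr : transitive geq by move=> x y z /= h1 h2; exact: leq_trans h2 h1.
  have asym : antisymmetric geq by move=> x y /=; rewrite andbC -eqn_leq => /eqP.
  apply: (sorted_eq tr asym); first exact: (elimT (allnP _ _) dw t tN).
    exact: (elimT (allnP _ _) dw' t tN).
  apply/allP => i _ /=; apply/eqP.
  have := pcount w t i; have := pcount w' t i.
  by rewrite !ep ?(ltnW tN) // => ->; move/eqP; rewrite eqn_add2l => /eqP.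
move=> Q; rewrite mem_enum inE; apply/mapP/andP.
  case=> w; rewrite mem_filter => /andP[dw /(mem_words_valid _ pm ml) vw] ->.
  have sz := valid_size pl pm vw.
  rewrite wdesc_blocks ?sz // in dw.
  split.
    apply/gtP; split; first split=> [i ir|i ir|t i tN ir].
    - by rewrite vP // /p /psum !take0 /shape addn0.
    - by rewrite vP // /p psum_size sume /n -sz take_size; have [_ ->] := vw.
    - by rewrite !vP ?(ltnW tN) // pcount leq_addr.
    - move=> t i tN ir; rewrite !vP ?(ltnW tN) ?(ltnW ir) //.
      rewrite {1}/p cat_block shape_cat.
      apply: (@hstrip_of_dec (shape M (take (psum e t) w)) (block e t w)).
        exact: (elimT (allnP _ _) dw t tN).
      move=> k j; rewrite -!shape_cat.
      have [le|lt] := leqP k (size (block e t w)).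
        have -> : take (psum e t) w ++ take k (block e t w) =
            take (psum e t + k) w.
          rewrite size_block ?sz // in le.
          rewrite /block takeD; congr (_ ++ _); rewrite take_drop take_takel.
            by rewrite take_drop.
          by rewrite psumS addnC leq_add2l.
        exact: valid_prefix vw.
      by rewrite (@take_oversize _ k) ?(ltnW lt) // -cat_block; exact: valid_prefix vw.
  apply/allnP => t tN; apply/eqP; rewrite -(@size_block e t w) ?sz //.
  rewrite -(@sum_count_mem r).
    by apply: eq_bigr => i _; rewrite !vP ?(ltnW tN) // pcount addKn.
  by apply/allP => x /mem_drop /mem_take; exact: (valid_lt_r pl pm).
case=> /gtP[chQ hsQ] /allnP cQ; have [Q0 QN Qmon] := chQ.
(* The term [M i] compensates the value 0 that [ev] returns from row [r] on. *)
suff [w [sw shw vw dw]] : exists w, [/\ size w = psum e N,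
    forall t i, t <= N -> p w t i = ev Q t i + (if i < r then 0 else M i),
    forall k i, shape M (take k w) i.+1 <= shape M (take k w) i
    & forall t, t < N -> sorted geq (block e t w)].
  have vwL : valid M L w.
    split=> // i; have := shw N i (leqnn N); rewrite /p -sw take_size => ->.
    case: ltnP => ir; first by rewrite addn0 QN.
    by rewrite ev_out_r // /L nth_default //; have := ml i; rewrite (nth_default _ ir) leqn0 => /eqP.
  exists w; last first.
    apply: ev_inj => t i tN ir; rewrite vP // shw // ir addn0 //.
  rewrite mem_filter; apply/andP; split; last exact/(mem_words_valid _ pm ml).
  by rewrite wdesc_blocks ?sw ?psum_size //; apply/allnP.
have Mout i : r <= i -> M i = 0.
  by move=> ir; have := ml i; rewrite (nth_default _ ir) leqn0 => /eqP.
suff ex t0 : t0 <= N -> exists w, [/\ size w = psum e t0,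
    forall t i, t <= t0 -> p w t i = ev Q t i + (if i < r then 0 else M i),
    forall k i, shape M (take k w) i.+1 <= shape M (take k w) i
    & forall t, t < t0 -> sorted geq (block e t w)] by exact: (ex N).
elim: t0 => [|t0 IH] tN.
  exists [::]; split=> // [|t i|k i].
  - by rewrite /psum take0.
  - rewrite leqn0 => /eqP ->; rewrite /p /psum take0 /shape addn0 /=.
    by case: ltnP => ir; [rewrite Q0 // addn0|rewrite ev_out_r].
  - by rewrite /shape /= !addn0; exact: is_part_nth.
have [w [sw shw vw dw]] := IH (ltnW tN).
(* The next block is the weakly decreasing word that adds the strip prescribed by the pattern. *)
have [u su cu] := dec_word_exists r (fun i => ev Q t0.+1 i - ev Q t0 i).
have su' : size u = nth 0 e t0.
  rewrite -(eqP (cQ t0 tN)) -(@sum_count_mem r).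
    by apply: eq_bigr => i _; rewrite cu ltn_ord.
  apply/allP => x xu; rewrite ltnNge; apply/negP => rx.
  by move: xu; rewrite -has_pred1 has_count cu [x < r]ltnNge rx.
have wu t i : t <= t0 -> p (w ++ u) t i = p w t i.
  by move=> tt; rewrite /p takel_cat // sw leq_psum.
have wuS i : p (w ++ u) t0.+1 i = p w t0 i + count_mem i u.
  rewrite /p psumS take_oversize ?size_cat ?sw ?su' // shape_cat -{1}sw.
  by rewrite -{1}[w]take_size sw.
exists (w ++ u); split.
- by rewrite size_cat sw su' psumS.
- move=> t i; rewrite leq_eqVlt ltnS => /orP[/eqP ->|tt]; last first.
    by rewrite wu // shw.
  rewrite wuS cu shw //; case: ltnP => ir; last by rewrite !ev_out_r ?addn0.
  by have := Qmon t0 i tN ir; lia.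
- apply: prefix_cat => //; apply: prefix_hstrip => i.
  have e1 j : shape M w j = p w t0 j by rewrite /p -sw take_size.
  have -> : shape (shape M w) u i.+1 = p (w ++ u) t0.+1 i.+1.
    by rewrite wuS -e1.
  rewrite wuS e1 !shw // cu; case: ltnP => ir; last by rewrite ev_out_r // Mout.
  rewrite (ltnW ir) !addn0 subnKC ?Qmon //; exact: hsQ.
- move=> t; rewrite ltnS leq_eqVlt => /orP[/eqP ->|tt].
    rewrite /block take_oversize; last by rewrite size_cat sw su' psumS.
    by rewrite -sw drop_size_cat.
  by rewrite /block takel_cat ?dw // sw leq_psum.
Qed.

End GT.

(** * Bender-Knuth involutions *)

(* The Bender-Knuth involution on the letters k and k.+1 in the columns < j:
   each entry of row k.+1 of the pattern which is at most j is reflected in the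
   interval that its neighbours, cut off at j, allow. *)
Section BenderKnuth.

Variables (j k : nat) (p : nat -> nat -> nat).

Definition bk_lo i := maxn (minn (p k i) j) (minn (p k.+2 i.+1) j).

Definition bk_hi i := if i is i'.+1
  then minn (minn (p k.+2 i) j) (minn (p k i') j) else minn (p k.+2 0) j.

Definition bk t i :=
  if (t == k.+1) && (p t i <= j) then bk_lo i + bk_hi i - p t i else p t i.

End BenderKnuth.

Definition interlaced N (p : nat -> nat -> nat) :=
  (forall t i, t < N -> p t i <= p t.+1 i) /\
  (forall t i, t < N -> p t.+1 i.+1 <= p t i).

(** Counts the entries [t.+1] in the columns before [j]: truncating the row lengths at [j] discards
    the rest. [high_cont] counts those in the columns from [j] on. *)
Definition low_cont r j (p : nat -> nat -> nat) t :=
  \sum_(i < r) (minn (p t.+1 i) j - minn (p t i) j).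

Definition high_cont r j (p : nat -> nat -> nat) t :=
  \sum_(i < r) (maxn (p t.+1 i) j - maxn (p t i) j).

Lemma cont_split N r j p t : interlaced N p -> t < N ->
  cont r p t = high_cont r j p t + low_cont r j p t.
Proof.
case=> mon _ tN; rewrite /cont /high_cont /low_cont -big_split /=.
by apply: eq_bigr => i _; have := mon t i tN; lia.
Qed.

Definition ends_sum (a b : nat -> nat) i :=
  maxn (a i) (b i.+1) + (if i is i'.+1 then minn (b i) (a i') else b 0).

(** The lower end in row [i] and the upper end in row [i.+1] are the maximum and the minimum of the
    same two numbers [a i] and [b i.+1], so together they contribute [a i + b i.+1]. Only the last
    row leaves a boundary term. *)
Lemma sum_bk_bounds r (a b : nat -> nat) :
  \sum_(i < r) ends_sum a b i +
    (if r is r'.+1 then a r' else 0) =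
  \sum_(i < r) a i + \sum_(i < r) b i +
    (if r is r'.+1 then maxn (a r') (b r) else 0).
Proof.
elim: r => [|r IH]; first by rewrite !big_ord0.
rewrite !big_ord_recr /=; case: r IH => [|r] IH; first by rewrite !big_ord0 /ends_sum; lia.
have e : ends_sum a b r.+1 + maxn (a r) (b r.+1) = maxn (a r.+1) (b r.+2) + a r + b r.+1.
  by rewrite /ends_sum; lia.
move: IH e; move: (bigop _ _ _) (bigop _ _ _) (bigop _ _ _) => S1 S2 S3 IH e.
lia.
Qed.

Section BK.

Variables (N r j k : nat) (p : nat -> nat -> nat).
Hypothesis kN : k.+1 < N.
Hypothesis ip : interlaced N p.

Let mon t i : t < N -> p t i <= p t.+1 i. Proof. by case: ip => h _; exact: h. Qed.
Let inter t i : t < N -> p t.+1 i.+1 <= p t i.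
Proof. by case: ip => _ h; exact: h. Qed.

Lemma bk_range i : p k.+1 i <= j -> bk_lo j k p i <= p k.+1 i <= bk_hi j k p i.
Proof.
move=> h; have h1 := mon i (ltnW kN); have h2 := mon i kN.
have h3 := inter i kN; rewrite /bk_lo /bk_hi; case: i h h1 h2 h3 => [|i] *; first lia.
by have := inter i (ltnW kN); lia.
Qed.

Lemma bk_hi_le i : bk_hi j k p i <= j.
Proof. by rewrite /bk_hi; case: i => [|i]; lia. Qed.

Lemma bk_other t i : t != k.+1 -> bk j k p t i = p t i.
Proof. by rewrite /bk => /negPf ->. Qed.

Lemma bk_mid i : bk j k p k.+1 i =
  if p k.+1 i <= j then bk_lo j k p i + bk_hi j k p i - p k.+1 i else p k.+1 i.
Proof. by rewrite /bk eqxx. Qed.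

Lemma bk_max j' t i : j <= j' -> maxn (bk j k p t i) j' = maxn (p t i) j'.
Proof.
move=> jj'; rewrite /bk; case: eqP => [->|] //=; case: leqP => // h.
by have := bk_range h; have := bk_hi_le i; lia.
Qed.

Lemma bkK t i : bk j k (bk j k p) t i = p t i.
Proof.
have lo' i' : bk_lo j k (bk j k p) i' = bk_lo j k p i'.
  by rewrite /bk_lo !bk_other //; apply/eqP; lia.
have hi' i' : bk_hi j k (bk j k p) i' = bk_hi j k p i'.
  by rewrite /bk_hi; case: i' => [|i']; rewrite !bk_other //; apply/eqP; lia.
case: (eqVneq t k.+1) => [->|ne]; last by rewrite /bk (negPf ne).
rewrite {1}/bk eqxx /= lo' hi' bk_mid; case: (leqP (p k.+1 i) j) => h.
  have := bk_range h; have := bk_hi_le i => h1 h2.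
  by rewrite (_ : _ + _ - _ <= j); lia.
by rewrite leqNgt h.
Qed.

Lemma bk_interlaced : interlaced N (bk j k p).
Proof.
have out t : t != k.+1 -> forall i, bk j k p t i = p t i.
  by move=> ne i; exact: bk_other.
have bd i : p k i <= bk j k p k.+1 i <= p k.+2 i /\
    (p k.+2 i.+1 <= bk j k p k.+1 i) /\
    (if i is i'.+1 then bk j k p k.+1 i <= p k i' else true).
  have h1 := mon i (ltnW kN); have h2 := mon i kN; have h3 := inter i kN.
  rewrite bk_mid; case: (leqP (p k.+1 i) j) => h; last first.
    rewrite h1 h2 h3; split=> //; split=> //.
    by case: i {h h1 h2 h3} => // i; exact: inter (ltnW kN).
  have := bk_range h; rewrite /bk_lo /bk_hi.
  case: i h h1 h2 h3 => [|i] h h1 h2 h3 hr; first lia.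
  by have := inter i (ltnW kN); lia.
split=> t i tN.
  case: (eqVneq t k.+1) => [->|ne].
    by rewrite (out k.+2); [have := bd i; lia|apply/eqP; lia].
  case: (eqVneq t k) => [->|ne'].
    by rewrite (out k); [have := bd i; lia|apply/eqP; lia].
  by rewrite !out ?mon // eqSS.
case: (eqVneq t k.+1) => [->|ne].
  by rewrite (out k.+2); [have := bd i; lia|apply/eqP; lia].
case: (eqVneq t k) => [->|ne'].
  by rewrite (out k); [have := bd i.+1; lia|apply/eqP; lia].
by rewrite !out ?eqSS //; exact: inter.
Qed.

Lemma bk_high j' t : j <= j' -> high_cont r j' (bk j k p) t = high_cont r j' p t.
Proof. by move=> jj'; apply: eq_bigr => i _; rewrite !bk_max. Qed.

Hypothesis col0 : forall i, i < r -> p k i <= j -> p k.+1 i <= j.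
Hypothesis out : forall t i, t <= N -> r <= i -> p t i = 0.

(** Reflection replaces an entry by the sum of its two ends minus itself. In a row with [p k.+1 i]
    above [j], which is not reflected, [col0] and interlacing force both truncated ends to equal
    [j], so the identity holds there too. *)
Lemma sum_bk_mid :
  \sum_(i < r) minn (bk j k p k.+1 i) j + \sum_(i < r) minn (p k.+1 i) j =
  \sum_(i < r) minn (p k i) j + \sum_(i < r) minn (p k.+2 i) j.
Proof.
have := sum_bk_bounds r (fun i => minn (p k i) j) (fun i => minn (p k.+2 i) j).
set S := (X in X + _ = _) => h.
have -> : \sum_(i < r) minn (p k i) j + \sum_(i < r) minn (p k.+2 i) j = S.
  suff e : (if r is r'.+1 then maxn (minn (p k r') j) (minn (p k.+2 r) j) else 0) =
      (if r is r'.+1 then minn (p k r') j else 0) by rewrite e in h; lia.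
  by case: (r) out => [|r'] //= o; rewrite (o k.+2 r'.+1) //; lia.
rewrite /S -big_split /=; apply: eq_bigr => i _; rewrite bk_mid.
have hl := bk_hi_le i.
rewrite /ends_sum; case: (leqP (p k.+1 i) j) => h'.
  by have := bk_range h'; rewrite /bk_lo /bk_hi; case: (i : nat) => [|i']; lia.
have c0 := col0 (ltn_ord i); have h1 := mon i kN; rewrite /bk_lo /bk_hi.
case: (i : nat) h' c0 h1 => [|i'] h' c0 h1; first lia.
by have := inter i' (ltnW kN); lia.
Qed.

Lemma low_contE q t : (forall i, q t i <= q t.+1 i) ->
  low_cont r j q t = \sum_(i < r) minn (q t.+1 i) j - \sum_(i < r) minn (q t i) j.
Proof. by move=> h; rewrite /low_cont sumnB // => i _; have := h i; lia. Qed.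

Lemma bk_low t : t < N -> low_cont r j (bk j k p) t =
  low_cont r j p (if t == k then k.+1 else if t == k.+1 then k else t).
Proof.
move=> tN; have [bm _] := bk_interlaced; have e := sum_bk_mid.
have le1 : \sum_(i < r) minn (p k i) j <= \sum_(i < r) minn (p k.+1 i) j.
  by apply: leq_sum => i _; have := mon i (ltnW kN); lia.
have le2 : \sum_(i < r) minn (p k.+1 i) j <= \sum_(i < r) minn (p k.+2 i) j.
  by apply: leq_sum => i _; have := mon i kN; lia.
have o1 (q : nat) : q != k.+1 -> \sum_(i < r) minn (bk j k p q i) j =
    \sum_(i < r) minn (p q i) j.
  by move=> ne; apply: eq_bigr => i _; rewrite bk_other.
case: (eqVneq t k) => [->|ne].
  rewrite !low_contE //; try (by move=> i; exact: mon); last by move=> i; apply: bm; lia.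
  by rewrite (o1 k); [lia|apply/eqP; lia].
case: (eqVneq t k.+1) => [->|ne'].
  rewrite !low_contE //; try (by move=> i; apply: mon; lia); last by move=> i; exact: bm.
  by rewrite (o1 k.+2); [lia|apply/eqP; lia].
by apply: eq_bigr => i _; rewrite !bk_other // eqSS.
Qed.

End BK.

Section PatternSets.

Variables (B N r : nat) (m l : nat -> nat).

Lemma gtb_interlaced (P : 'M['I_B.+1]_(N.+1, r)) :
  gtb m l N r (ev P) -> interlaced N (ev P).
Proof.
case/gtP => -[_ _ mon] h; split=> t i tN.
  by case: (ltnP i r) => ir; [exact: mon|rewrite ev_out_r].
by case: (ltnP i.+1 r) => ir; [exact: h|rewrite ev_out_r].
Qed.

Definition bkP j k (P : 'M['I_B.+1]_(N.+1, r)) : 'M['I_B.+1]_(N.+1, r) :=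
  mk B N.+1 r (bk j k (ev P)).

Lemma ev_bkP j k P t i : k.+1 < N -> gtb m l N r (ev P) -> t <= N ->
  ev (bkP j k P) t i = bk j k (ev P) t i.
Proof.
move=> kN gP tN; have iP := gtb_interlaced gP.
case: (ltnP i r) => ir.
  rewrite ev_mk //; have [_ _] := bk_interlaced j kN iP.
  rewrite /bk; case: ifP => [/andP[/eqP -> h]|_]; last exact: ev_le.
  have [mon _] := bk_interlaced j kN iP; have := mon k.+1 i kN.
  rewrite bk_mid h bk_other; last by apply/eqP; lia.
  by move=> h'; apply: leq_trans h' (ev_le _ _ _).
rewrite ev_out_r //; have [mon int] := bk_interlaced j kN iP.
case: (eqVneq t k.+1) => [->|ne]; last by rewrite bk_other // ev_out_r.
have := mon k.+1 i kN; rewrite [bk _ _ _ k.+2 _]bk_other ?ev_out_r //; first lia.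
by apply/eqP; lia.
Qed.

Lemma eq_bk j k p q t i : (forall s, s <= k.+2 -> p s =1 q s) -> t <= k.+2 ->
  bk j k p t i = bk j k q t i.
Proof.
move=> pq tk; rewrite /bk /bk_lo /bk_hi; case: i => [|i];
by rewrite !pq //; lia.
Qed.

Lemma bkP_gtb j k P : k.+1 < N -> gtb m l N r (ev P) ->
  gtb m l N r (ev (bkP j k P)).
Proof.
move=> kN gP; have iP := gtb_interlaced gP; have [mon int] := bk_interlaced j kN iP.
have [[h0 hN hm] hs] := gtP _ _ _ _ _ gP.
apply/gtP; split; first split=> [i ir|i ir|t i tN ir].
- by rewrite ev_bkP ?bk_other ?h0.
- by rewrite ev_bkP ?bk_other ?hN //; apply/eqP; lia.
- by rewrite !ev_bkP // ?mon // ltnW.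
- by move=> t i tN ir; rewrite !ev_bkP // ?int // ltnW.
Qed.

Lemma bkPK j k P : k.+1 < N -> gtb m l N r (ev P) -> bkP j k (bkP j k P) = P.
Proof.
move=> kN gP; apply: ev_inj => t i tN ir; rewrite ev_bkP ?bkP_gtb //.
case: (leqP t k.+2) => tk.
  rewrite (@eq_bk j k _ (bk j k (ev P))) ?(bkK j kN (gtb_interlaced gP)) //.
  by move=> s sk x; rewrite ev_bkP //; lia.
by rewrite bk_other ?ev_bkP ?bk_other //; apply/eqP; lia.
Qed.

Lemma bkP_low j k P t : k.+1 < N -> gtb m l N r (ev P) ->
    (forall i, i < r -> ev P k i <= j -> ev P k.+1 i <= j) -> t < N ->
  low_cont r j (ev (bkP j k P)) t =
  low_cont r j (ev P) (if t == k then k.+1 else if t == k.+1 then k else t).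
Proof.
move=> kN gP c0 tN; rewrite -(bk_low kN (gtb_interlaced gP) c0) //.
  by apply: eq_bigr => i _; rewrite !ev_bkP // ltnW.
by move=> s i _ ri; rewrite ev_out_r.
Qed.

Lemma bkP_high j j' k P t : k.+1 < N -> gtb m l N r (ev P) -> j <= j' -> t < N ->
  high_cont r j' (ev (bkP j k P)) t = high_cont r j' (ev P) t.
Proof.
move=> kN gP jj' tN; rewrite -(bk_high _ kN (gtb_interlaced gP) _ jj').
by apply: eq_bigr => i _; rewrite !ev_bkP // ltnW.
Qed.

(** With [j = B] no column is cut off, so the full contents of the two letters are exchanged. *)
Lemma bkP_cont k P t : k.+1 < N -> gtb m l N r (ev P) -> t < N ->
  cont r (ev (bkP B k P)) t =
  cont r (ev P) (if t == k then k.+1 else if t == k.+1 then k else t).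
Proof.
move=> kN gP tN; have iP := gtb_interlaced gP.
have iP' := gtb_interlaced (bkP_gtb B kN gP).
have h0 (Q : 'M['I_B.+1]_(N.+1, r)) s : high_cont r B (ev Q) s = 0.
  by apply: big1 => i _; have := ev_le Q s i; have := ev_le Q s.+1 i; lia.
rewrite (cont_split _ B iP') // (cont_split _ B iP); last first.
  by case: eqP => // _; case: eqP => // _; lia.
rewrite !h0 bkP_low // => i ir _; exact: ev_le.
Qed.

Lemma gt_card_swap k (e : nat -> nat) : k.+1 < N ->
  gt_card B N r m l
    (fun t => e (if t == k then k.+1 else if t == k.+1 then k else t)) =
  gt_card B N r m l e.
Proof.
move=> kN; apply: (@bij_card _ _ _ _ (bkP B k)).
- move=> P Q; rewrite !inE => /andP[gP _] /andP[gQ _] ePQ.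
  by rewrite -(bkPK B kN gP) ePQ bkPK.
- move=> P; rewrite !inE => /andP[gP /allnP cP]; rewrite bkP_gtb //=.
  apply/allnP => t tN; rewrite bkP_cont //; set s := if _ then _ else _.
  have sN : s < N by rewrite /s; do 2?case: eqP => // _; lia.
  rewrite (eqP (cP s sN)) /s; apply/eqP; congr e.
  by case: (eqVneq t k) => [->|]; rewrite ?eqxx; do ?case: eqP; lia.
- move=> Q; rewrite inE => /andP[gQ /allnP cQ].
  exists (bkP B k Q); last exact: bkPK.
  rewrite inE bkP_gtb //=; apply/allnP => t tN; rewrite bkP_cont //.
  by apply: cQ; do 2?case: eqP => // _; lia.
Qed.

Lemma eq_gt_card (e e' : nat -> nat) : (forall t, t < N -> e t = e' t) ->
  gt_card B N r m l e = gt_card B N r m l e'.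
Proof.
move=> h; apply: eq_card => P; rewrite !inE; congr (_ && _).
by apply: eq_in_all => t; rewrite mem_iota => /= tN; rewrite h.
Qed.

(** Adjacent transpositions suffice: the head of [e] is located in [e'] and moved to the front,
    while the entries already matched stay in the prefix [s0]. *)
Lemma gt_card_perm (e e' : seq nat) : size e = N -> perm_eq e e' ->
  gt_card B N r m l (nth 0 e) = gt_card B N r m l (nth 0 e').
Proof.
move=> se.
have sw s1 a b s2 : size (s1 ++ a :: b :: s2) = N ->
    gt_card B N r m l (nth 0 (s1 ++ a :: b :: s2)) =
    gt_card B N r m l (nth 0 (s1 ++ b :: a :: s2)).
  rewrite size_cat /= => sz.
  rewrite -(@gt_card_swap (size s1) (nth 0 (s1 ++ b :: a :: s2))); last lia.
  apply: eq_gt_card => t tN; rewrite !nth_cat.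
  case: (ltngtP t (size s1)) => [lt|gt|->].
  - by rewrite (ltn_eqF (leqW lt)) lt.
  - case: (t =P (size s1).+1) => [->|ne]; first by rewrite ltnn subnn subSnn.
    rewrite ltnNge ltnW //= .
    by have -> : t - size s1 = (t - size s1 - 2).+2 by lia.
  - by rewrite ltnNge leqnSn subnn subSnn /=.
have mv s0 s1 a s2 : size (s0 ++ s1 ++ a :: s2) = N ->
    gt_card B N r m l (nth 0 (s0 ++ s1 ++ a :: s2)) =
    gt_card B N r m l (nth 0 (s0 ++ a :: s1 ++ s2)).
  elim: s1 s0 => // b s1 IH s0 sz.
  rewrite [LHS](_ : _ = gt_card B N r m l (nth 0 ((rcons s0 b) ++ s1 ++ a :: s2))).
    rewrite IH; last by move: sz; rewrite !size_cat size_rcons /= ?size_cat /=; lia.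
    rewrite cat_rcons; apply: sw; move: sz; rewrite !size_cat /= ?size_cat /=; lia.
  by rewrite cat_rcons.
suff h s0 : size (s0 ++ e) = N -> perm_eq e e' -> gt_card B N r m l (nth 0 (s0 ++ e)) =
    gt_card B N r m l (nth 0 (s0 ++ e')).
  exact: (h [::]).
move=> {se}; elim: e s0 e' => [|a e IH] s0 e' sz pe.
  by rewrite (perm_nilP (_ : perm_eq e' [::])) // perm_sym.
have ae' : a \in e' by rewrite -(perm_mem pe) mem_head.
case/splitPr: e' / ae' pe => s1 s2 pe.
have pe' : perm_eq e (s1 ++ s2).
  by rewrite -(perm_cons a); apply: perm_trans pe _; rewrite -cat1s perm_catCA.
rewrite [RHS]mv; last first.
  by rewrite -sz; apply/esym/perm_size; rewrite perm_cat2l.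
by rewrite -!cat_rcons; apply: IH => //; rewrite cat_rcons.
Qed.

End PatternSets.

(** * Schur-positivity of skew Schur functions *)

Definition swap k t := if t == k then k.+1 else if t == k.+1 then k else t.

(* For strictly decreasing y this is the sign of the permutation that sorts x
   into y, and 0 when there is none. *)
Definition match_sign N (x y : nat -> nat) : int :=
  (\det (\matrix_(i < N, j < N) ((x i == y j)%:R : int)))%R.

Lemma match_signE N x y : match_sign N x y =
  (\sum_(s : 'S_N) (-1) ^+ s * ([forall i : 'I_N, x i == y (s i)])%:R)%R.
Proof.
apply: eq_bigr => s _; congr (_ * _)%R.
case: forallP => [h|h]; first by rewrite big1 // => i _; rewrite mxE (eqP (h i)) eqxx.
have /forallPn[i xi] : ~~ [forall i : 'I_N, x i == y (s i)] by apply/forallP.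
by rewrite (bigD1 i) //= mxE (negPf xi) mul0r.
Qed.

Lemma eq_match_sign N x x' y y' : (forall i, i < N -> x i = x' i) ->
  (forall i, i < N -> y i = y' i) -> match_sign N x y = match_sign N x' y'.
Proof.
by move=> hx hy; congr (\det _)%R; apply/matrixP => i j; rewrite !mxE hx ?hy.
Qed.

Lemma match_sign_swap N k x y : k.+1 < N ->
  match_sign N (x \o swap k) y = (- match_sign N x y)%R.
Proof.
move=> kN; rewrite /match_sign; set A := (X in _ = (- \det X)%R).
pose i1 := Ordinal (ltnW kN); pose i2 := Ordinal kN.
have ne : i1 != i2 by rewrite -val_eqE /=; lia.
rewrite [X in (\det X)%R](_ : _ = row_perm (tperm i1 i2) A).
  by rewrite row_permE det_mulmx det_perm odd_tperm ne expr1 mulN1r.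
apply/matrixP => i j; rewrite !mxE /swap /=.
case: tpermP => [->|->|n1 n2] /=; rewrite ?eqxx //.
  by rewrite (_ : k.+1 == k = false) //; apply/eqP; lia.
have {}n1 : (i : nat) != k by apply/eqP => e; apply: n1; exact/ord_inj.
have {}n2 : (i : nat) != k.+1 by apply/eqP => e; apply: n2; exact/ord_inj.
by rewrite (negPf n1) (negPf n2).
Qed.

Lemma match_sign_row0 N x y i : i < N -> (forall j, j < N -> x i != y j) ->
  match_sign N x y = 0%R.
Proof.
move=> iN h; rewrite /match_sign (expand_det_row _ (Ordinal iN)) big1 // => j _.
by rewrite mxE /= (negPf (h j _)) // mul0r.
Qed.

Lemma match_sign_col0 N x y j : j < N -> (forall i, i < N -> x i != y j) ->
  match_sign N x y = 0%R.
Proof.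
move=> jN h; rewrite /match_sign (expand_det_col _ (Ordinal jN)) big1 // => i _.
by rewrite mxE /= (negPf (h i _)) // mul0r.
Qed.

Lemma match_sign_dup N x y i i' : i < N -> i' < N -> i != i' -> x i = x i' ->
  match_sign N x y = 0%R.
Proof.
move=> iN i'N ne e; apply: (@determinant_alternate _ _ _ (Ordinal iN) (Ordinal i'N)).
  by rewrite -val_eqE.
by move=> j; rewrite !mxE /= e.
Qed.

(** Both sequences are injective. If every [x i] is some [y j], the two sets of values agree and so
    do their decreasing listings; otherwise a row of the matrix vanishes. *)
Lemma match_sign_sorted N x y :
  (forall i j, i < j -> j < N -> x j < x i) ->
  (forall i j, i < j -> j < N -> y j < y i) ->
  match_sign N x y = (alln N (fun i => x i == y i))%:R%R.
Proof.
move=> sx sy; have xne i j : i < N -> j < N -> i != j -> x i != x j.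
  move=> iN jN; rewrite neq_ltn => /orP[] lt; first by rewrite gtn_eqF ?sx.
  by rewrite ltn_eqF ?sx.
case: (boolP (alln _ _)) => [/allnP h|/allnP h].
  rewrite /match_sign [X in (\det X)%R](_ : _ = 1%:M)%R ?det1 //.
  apply/matrixP => i j; rewrite !mxE -(eqP (h j (ltn_ord j))).
  case: (eqVneq i j) => [->|ne]; first by rewrite eqxx.
  by rewrite (negPf (xne _ _ _ _ _)).
case: (boolP (alln N (fun i => ~~ alln N (fun j => x i != y j)))) => [/allnP h1|].
  case: h => i iN.
  have xy : [seq x i | i <- iota 0 N] =i [seq y i | i <- iota 0 N].
    have ux : uniq [seq x i | i <- iota 0 N].
      rewrite map_inj_in_uniq ?iota_uniq // => a b; rewrite !mem_iota => /= aN bN.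
      by move/eqP; apply: contraTeq; exact: xne.
    have sub : {subset [seq x i | i <- iota 0 N] <= [seq y i | i <- iota 0 N]}.
      move=> z /mapP[a]; rewrite mem_iota /= => aN ->.
      have := h1 a aN; rewrite -has_predC => /hasP[b]; rewrite mem_iota /= => bN.
      by rewrite negbK => /eqP ->; apply/mapP; exists b; rewrite ?mem_iota.
    by have [|_ ] := uniq_min_size ux sub; rewrite ?size_map.
  have srt (z : nat -> nat) : (forall i j, i < j -> j < N -> z j < z i) ->
      sorted gtn [seq z i | i <- iota 0 N].
    move=> sz; apply/(sortedP 0) => k; rewrite size_map size_iota => kN.
    rewrite !(nth_map 0) ?size_iota //; try lia.
    by rewrite !nth_iota ?add0n //; [exact: sz|lia].
  have tr : transitive gtn by move=> a b c /= h2 h3; exact: ltn_trans h3 h2.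
  have := irr_sorted_eq tr ltnn (srt x sx) (srt y sy) xy.
  move/(congr1 (fun s => nth 0 s i)).
  by rewrite !(nth_map 0) ?size_iota // nth_iota // add0n => ->.
case/allPn => i; rewrite mem_iota negbK => /= iN /allnP hi.
exact: match_sign_row0 hi.
Qed.

(** Fixed points are allowed: the sum equals its own opposite, which over the integers forces 0. *)
Lemma sum_involution (T : finType) (A : pred T) (phi : T -> T) (F : T -> int) :
  (forall x, A x -> A (phi x)) -> (forall x, A x -> phi (phi x) = x) ->
  (forall x, A x -> F (phi x) = - F x)%R -> (\sum_(x | A x) F x = 0)%R.
Proof.
move=> pA pK pF; set S := (\sum_(x | A x) F x)%R.
have : S = (- S)%R.
  rewrite {1}/S (reindex_onto phi phi) //= /S -sumrN; apply: eq_big => [x|x /andP[Ax /eqP e]].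
    apply/andP/idP => [[Ap /eqP <-]|Ax]; first exact: pA.
    by rewrite pA ?pK.
  by rewrite pF // -e pA.
by move=> h; lia.
Qed.

Definition rho_shift N (c : nat -> nat) t := c t + (N.-1 - t).

Section Stembridge.

Variables (B N r : nat) (m l : nat -> nat).

Notation pat := 'M['I_B.+1]_(N.+1, r).

Definition viol p j k := high_cont r j p k < high_cont r j p k.+1.

(* The reverse reading word is a lattice word: the part of the tableau in the
   columns >= j has weakly decreasing content, for every j. *)
Definition lattice p := alln B.+1 (fun j => alln N.-1 (fun k => ~~ viol p j k)).

(** The canonical violation: the largest cut [j], then the smallest letter [k]. It is defined by the
    columns from [j] on, and the flip acts on the columns before [j], so the same violation is
    selected afterwards. *)
Definition sel p j k := [&& j < B.+1, k.+1 < N, viol p j k,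
  alln B.+1 (fun j' => (j < j') ==> alln N.-1 (fun k' => ~~ viol p j' k'))
  & alln k (fun k' => ~~ viol p j k')].

Lemma sel_exists p : ~~ lattice p -> exists j k, sel p j k.
Proof.
case/allPn => j0; rewrite mem_iota => /= j0B hj0.
pose Q j := (j < B.+1) && ~~ alln N.-1 (fun k => ~~ viol p j k).
have exQ : exists j, Q j by exists j0; apply/andP.
have bQ j : Q j -> j <= B by case/andP.
case: (ex_maxnP exQ bQ) => j /andP[jB hj] maxj.
case/allPn: hj => k0; rewrite mem_iota negbK => /= k0N vk0.
have exk : exists k, viol p j k by exists k0.
case: (ex_minnP exk) => k vk mink; exists j, k.
have kk0 := mink _ vk0.
rewrite /sel jB vk /=; apply/and3P; split; first lia.
  apply/allnP => j' j'B; apply/implyP => jj'; apply/negPn/negP => h.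
  by have := maxj j'; rewrite /Q j'B h => /(_ isT); lia.
by apply/allnP => k' k'k; apply/negP => /mink; lia.
Qed.

Lemma sel_uniq p j k j' k' : sel p j k -> sel p j' k' -> j = j' /\ k = k'.
Proof.
case/and5P => jB kN v /allnP hj /allnP hk /and5P[j'B k'N v' /allnP hj' /allnP hk'].
have ejj : j = j'.
  have [lt|lt|//] := ltngtP j j'.
    by have /implyP/(_ lt)/allnP/(_ k') := hj j' j'B; rewrite v'; lia.
  by have /implyP/(_ lt)/allnP/(_ k) := hj' j jB; rewrite v; lia.
subst j'; split=> //; have [lt|lt|//] := ltngtP k k'.
  by have := hk' k lt; rewrite v.
by have := hk k' lt; rewrite v'.
Qed.

Definition flip (P : pat) : pat :=
  if [pick jk : 'I_B.+1 * 'I_N | sel (ev P) jk.1 jk.2] is Some jk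
  then bkP jk.1 jk.2 P else P.

Lemma flipE P j k : sel (ev P) j k -> flip P = bkP j k P.
Proof.
move=> s; rewrite /flip; case: pickP => [jk s'|h].
  by have [-> ->] := sel_uniq s s'.
have [jB kN _ _ _] := and5P s.
by have := h (Ordinal jB, Ordinal (ltnW kN)); rewrite /= s.
Qed.

Lemma sel_bk (P : pat) j k : gtb m l N r (ev P) -> sel (ev P) j k ->
  sel (ev (bkP j k P)) j k.
Proof.
move=> gP; case/and5P => jB kN v /allnP hj /allnP hk.
have e j' k' : j <= j' -> k'.+1 < N ->
    viol (ev (bkP j k P)) j' k' = viol (ev P) j' k'.
  by move=> jj' k'N; rewrite /viol !(bkP_high kN gP) // ltnW.
rewrite /sel jB kN e // v /=; apply/andP; split; apply/allnP => x xb.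
  apply/implyP => jx; apply/allnP => k' k'N; rewrite e ?(ltnW jx) //; last lia.
  by have /implyP/(_ jx)/allnP/(_ k' k'N) := hj x xb.
by rewrite e ?hk //; lia.
Qed.

Definition col_cont (p : nat -> nat -> nat) j t :=
  \sum_(i < r) ((p t i <= j) && (j < p t.+1 i) : nat).

Lemma high_contS p j t : (forall i, p t i <= p t.+1 i) ->
  high_cont r j p t = high_cont r j.+1 p t + col_cont p j t.
Proof.
move=> mon; rewrite /high_cont /col_cont -big_split /=; apply: eq_bigr => i _.
by have := mon i; case: (leqP (p t i) j); case: (ltnP j (p t.+1 i)) => /=; lia.
Qed.

Lemma interlaced_anti p t i i' : t < N -> interlaced N p -> i < i' ->
  p t.+1 i' <= p t i.
Proof.
move=> tN [mon int] ii'; apply: leq_trans (int t i tN).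
rewrite -(subnKC ii'); elim: (i' - i.+1) => [|d IH]; rewrite ?addn0 //.
rewrite addnS; apply: leq_trans IH; apply: leq_trans (int _ _ tN) (mon _ _ tN).
Qed.

Lemma col_cont_le1 p j t : t < N -> interlaced N p -> col_cont p j t <= 1.
Proof.
move=> tN ip; rewrite /col_cont.
case: (pickP (fun i : 'I_r => (p t i <= j) && (j < p t.+1 i))) => [i hi|h]; last first.
  by rewrite big1 // => i _; rewrite h.
rewrite (bigD1 i) //= hi big1 // => i' ne; apply/eqP; rewrite eqb0; apply/negP => hi'.
have := ne; rewrite -val_eqE neq_ltn /= => /orP[] lt;
by have := interlaced_anti tN ip lt; lia.
Qed.

(** There is no violation at [j.+1], and column [j] contains each letter at most once; so in the
    columns from [j] on the content of [k.+1] exceeds that of [k] by exactly 1, and column [j] has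
    no letter of index [k]. Exchanging the contents of the earlier columns then exchanges the two
    entries of the rho-shifted content. *)
Lemma flip_sign P (nu : nat -> nat) : gtb m l N r (ev P) -> ~~ lattice (ev P) ->
  match_sign N (rho_shift N (cont r (ev (flip P)))) nu =
  (- match_sign N (rho_shift N (cont r (ev P))) nu)%R.
Proof.
move=> gP /sel_exists[j [k s]]; rewrite (flipE s); have iP := gtb_interlaced gP.
have [jB kN v /allnP hj _] := and5P s.
rewrite -(match_sign_swap _ _ kN); apply: eq_match_sign => // t tN.
have mon t' i : t' < N -> ev P t' i <= ev P t'.+1 i by case: iP => h _; exact: h.
(* There are no boxes from column [B] on, hence no violation at the cut [B]; this makes [j.+1] a
   legitimate cut. *)
have jltB : j < B.
  rewrite ltn_neqAle -ltnS jB andbT; apply/eqP => ej; move: v; rewrite /viol ej.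
  have h0 s' : high_cont r B (ev P) s' = 0.
    by apply: big1 => i _; have := ev_le P s' i; have := ev_le P s'.+1 i; lia.
  by rewrite !h0.
have := hj j.+1; rewrite !ltnS => /(_ jltB)/implyP/(_ (leqnn _))/allnP/(_ k).
have kN1 : k < N.-1 by lia.
move/(_ kN1); rewrite /viol -leqNgt => nv.
have hS s' : s' < N -> high_cont r j (ev P) s' =
    high_cont r j.+1 (ev P) s' + col_cont (ev P) j s'.
  by move=> sN; apply: high_contS => i; exact: mon.
move: v; rewrite /viol (hS _ kN) (hS _ (ltnW kN)).
have := col_cont_le1 j kN iP; have := col_cont_le1 j (ltnW kN) iP => c1 c2 v.
have ck0 : col_cont (ev P) j k = 0 by lia.
have hk : high_cont r j (ev P) k.+1 = (high_cont r j (ev P) k).+1.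
  by rewrite (hS _ kN) (hS _ (ltnW kN)); lia.
have c0 i : i < r -> ev P k i <= j -> ev P k.+1 i <= j.
  move=> ir h; rewrite leqNgt; apply/negP => h'; move/eqP: ck0.
  by rewrite /col_cont (bigD1 (Ordinal ir)) //= h h'.
have gP' := bkP_gtb j kN gP.
rewrite /= /rho_shift (cont_split _ j (gtb_interlaced gP')) // (bkP_high kN gP) //.
rewrite (bkP_low kN gP) // /= -/(swap k t).
rewrite (cont_split _ j iP); last by rewrite /swap; do 2?case: eqP => // _; lia.
rewrite /swap; case: (t =P k) => [->|nk]; first by rewrite hk; lia.
by case: (t =P k.+1) => [->|nk']; rewrite ?hk; lia.
Qed.

Lemma flip_gtb P : gtb m l N r (ev P) -> ~~ lattice (ev P) ->
  gtb m l N r (ev (flip P)) && ~~ lattice (ev (flip P)).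
Proof.
move=> gP /sel_exists[j [k s]]; rewrite (flipE s).
have [jB kN _ _ _] := and5P s; rewrite bkP_gtb //=.
have /and5P[_ _ v _ _] := sel_bk gP s.
apply/negP => /allnP/(_ j jB)/allnP/(_ k); rewrite v.
by have kN1 : k < N.-1 by [lia]; move/(_ kN1).
Qed.

Lemma flipK P : gtb m l N r (ev P) -> ~~ lattice (ev P) -> flip (flip P) = P.
Proof.
move=> gP /sel_exists[j [k s]]; rewrite (flipE s) (flipE (sel_bk gP s)).
by have [jB kN _ _ _] := and5P s; rewrite (bkPK j kN gP).
Qed.

Definition lr_card (nu : nat -> nat) :=
  #|[set P : pat | gtb m l N r (ev P) && lattice (ev P) &&
       alln N (fun t => cont r (ev P) t == nu t)]|.

(** A lattice pattern has weakly decreasing content, as the cut at column 0 shows, so there the sign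
    is the indicator that the content is [nu]. All other patterns cancel under [flip]. *)
Lemma stembridge nu : (forall i j, i <= j -> j < N -> nu j <= nu i) ->
  (\sum_(P : pat | gtb m l N r (ev P))
     match_sign N (rho_shift N (cont r (ev P)))
                  (rho_shift N nu))%R = Posz (lr_card nu).
Proof.
move=> dec; rewrite (bigID (fun P : pat => lattice (ev P))) /=.
rewrite [X in (_ + X)%R](@sum_involution _ _ flip) ?addr0; first last.
- by move=> P /andP[gP lP]; exact: flip_sign.
- by move=> P /andP[gP lP]; exact: flipK.
- by move=> P /andP[gP lP]; exact: flip_gtb.
rewrite /lr_card -sum1dep_card (big_morph Posz PoszD (erefl _)) [RHS]big_mkcondr /=.
apply: eq_bigr => P /andP[gP lP]; have iP := gtb_interlaced gP.
have h0 t : t < N -> high_cont r 0 (ev P) t = cont r (ev P) t.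
  by move=> tN; apply: eq_bigr => i _; rewrite !maxn0.
have decS t : t.+1 < N -> cont r (ev P) t.+1 <= cont r (ev P) t.
  move=> tN; rewrite -!h0 ?(ltnW tN) // leqNgt.
  have tN1 : t < N.-1 by lia.
  by have /allnP/(_ t tN1) := elimT (allnP _ _) lP 0 (ltn0Sn _).
have decP i j : i <= j -> j < N -> cont r (ev P) j <= cont r (ev P) i.
  move=> ij; rewrite -(subnKC ij); elim: (j - i) => [|d IH]; first by rewrite addn0.
  by rewrite addnS => h; apply: leq_trans (decS _ h) (IH _); lia.
rewrite match_sign_sorted; first last.
- by move=> i j ij jN; rewrite /rho_shift; have := dec i j (ltnW ij) jN; lia.
- by move=> i j ij jN; rewrite /rho_shift; have := decP i j (ltnW ij) jN; lia.
rewrite (_ : alln N _ = alln N (fun t => cont r (ev P) t == nu t)); last first.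
  by apply: eq_all => t; rewrite /rho_shift eqn_add2r.
by case: (alln N _).
Qed.

End Stembridge.

Section Straight.

Variables (B N r : nat) (m l : nat -> nat).
Hypothesis m0 : forall i, m i = 0.
Hypothesis ldec : forall i j, i <= j -> l j <= l i.
Hypothesis lout : forall i, r <= i -> l i = 0.
Hypothesis lB : forall i, l i <= B.
Hypothesis rN : r <= N.

Notation pat := 'M['I_B.+1]_(N.+1, r).

(** Row [i] of the tableau consists of the letter [i.+1] only; this is the one lattice tableau of a
    straight shape. *)
Definition highest t i := if i < t then l i else 0.

Definition highestP : pat := mk B N.+1 r highest.

Lemma ev_highestP t i : t <= N -> i < r -> ev highestP t i = highest t i.
Proof.
by move=> tN ir; rewrite ev_mk // /highest; case: ifP => // _; exact: lB.
Qed.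

(* In a lattice tableau of straight shape the last entry of the first row that
   is not constant would have no matching smaller entry weakly to its right. *)
Lemma lattice_highest (P : pat) : gtb m l N r (ev P) -> lattice B N r (ev P) ->
  P = highestP.
Proof.
move=> gP lP; have iP := gtb_interlaced gP; have [mon int] := iP.
have [[h0 hN _] _] := gtP _ _ _ _ _ gP.
have mon' t t' i : t <= t' -> t' <= N -> ev P t i <= ev P t' i.
  move=> tt; rewrite -(subnKC tt); elim: (t' - t) => [|d IH]; rewrite ?addn0 //.
  by rewrite addnS => h; apply: leq_trans (IH _) (mon _ _ h); lia.
have low t i : t <= N -> t <= i -> ev P t i = 0.
  elim: t i => [|t IH] i tN ti.
    by case: (ltnP i r) => ir; [rewrite h0|rewrite ev_out_r].
  case: i ti => // i ti; apply/eqP; rewrite -leqn0 -(IH i (ltnW tN) ti).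
  exact: int.
suff full i t : i < r -> i < t -> t <= N -> ev P t i = l i.
  apply: ev_inj => t i tN ir; rewrite ltnS in tN.
  by rewrite ev_highestP // /highest; case: ltnP => it; [exact: full|exact: low].
elim/ltn_ind: i t => i IH t ir it tN.
apply/eqP; rewrite eqn_leq -{1}hN // mon' //= leqNgt; apply/negP => lt.
have exk : exists k, (k <= N) && (l i <= ev P k i) by exists N; rewrite hN // !leqnn.
case: (ex_minnP exk) => -[|k] /andP[kN lk] mink.
  by rewrite h0 // m0 in lk; move: lt; rewrite leqn0 in lk; rewrite (eqP lk).
have kt : t <= k.
  by rewrite leqNgt; apply/negP => h; have := mon' k.+1 t i h tN; lia.
have lk' : ev P k i < l i.
  by rewrite ltnNge; apply/negP => h; have := mink k; rewrite h (ltnW kN) => /(_ isT); lia.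
have li0 : 0 < l i by lia.
case: k kN lk mink kt lk' => [|k] kN lk mink kt lk'; first by lia.
have := elimT (allnP _ _) lP (l i).-1; have := lB i => lBi.
have jB : (l i).-1 < B.+1 by lia.
have kN1 : k < N.-1 by lia.
move=> /(_ jB)/allnP/(_ k kN1); rewrite /viol -leqNgt => hle.
have pos : 0 < high_cont r (l i).-1 (ev P) k.+1.
  by rewrite /high_cont (bigD1 (Ordinal ir)) //=; lia.
have : 0 < high_cont r (l i).-1 (ev P) k by exact: leq_trans hle.
rewrite /high_cont lt0n sum_nat_eq0 => /forallPn[i'].
rewrite /= -lt0n subn_gt0 => hi'.
have hi1 : ev P k i' < ev P k.+1 i' by lia.
have hi2 : (l i).-1 < ev P k.+1 i' by lia.
have [lt'|gt'|e'] := ltngtP (i' : nat) i.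
- have l1 := ltn_ord i'.
  by have := IH _ lt' k l1; have := IH _ lt' k.+1 l1; lia.
- have := interlaced_anti (ltnW kN) iP gt'; have := mon k i; lia.
- by rewrite e' in hi2; lia.
Qed.

Lemma cont_highest t : t < N -> cont r (ev highestP) t = l t.
Proof.
move=> tN; rewrite /cont; case: (ltnP t r) => tr.
  rewrite (bigD1 (Ordinal tr)) //= !ev_highestP ?(ltnW tN) // /highest ltnSn ltnn.
  rewrite subn0 big1 ?addn0 // => i; rewrite -val_eqE /= => ne.
  rewrite !ev_highestP ?(ltnW tN) // /highest ltnS leq_eqVlt (negPf ne) /=.
  by rewrite subnn.
rewrite lout // big1 // => i _; rewrite !ev_highestP ?(ltnW tN) // /highest.
by have := ltn_ord i => h; rewrite !(leq_trans h) ?subnn // ltnW.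
Qed.

Lemma highest_gtb : gtb m l N r (ev highestP).
Proof.
apply/gtP; split; first split=> [i ir|i ir|t i tN ir].
- by rewrite ev_highestP // m0.
- by rewrite ev_highestP // /highest (leq_trans ir).
- rewrite !ev_highestP ?(ltnW tN) // /highest.
  by case: (ltnP i t) => // h; rewrite (leq_trans h).
- move=> t i tN ir; rewrite !ev_highestP ?(ltnW tN) ?(ltnW ir) // /highest ltnS.
  by case: ifP => // _; exact: ldec.
Qed.

Lemma highest_lattice : lattice B N r (ev highestP).
Proof.
have hE j t : t < N -> high_cont r j (ev highestP) t = l t - j.
  move=> tN; rewrite /high_cont; case: (ltnP t r) => tr.
    rewrite (bigD1 (Ordinal tr)) //= !ev_highestP ?(ltnW tN) // /highest ltnSn ltnn.
    rewrite big1 => [|i]; first by lia.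
    rewrite -val_eqE /= => ne.
    rewrite !ev_highestP ?(ltnW tN) // /highest ltnS leq_eqVlt (negPf ne) /=.
    by rewrite subnn.
  rewrite lout // big1 // => i _; rewrite !ev_highestP ?(ltnW tN) // /highest.
  by have := ltn_ord i => h; rewrite !(leq_trans h) ?subnn // ltnW.
apply/allnP => j _; apply/allnP => k kN; rewrite /viol -leqNgt !hE; try lia.
by have := ldec (leqnSn k); lia.
Qed.

Lemma lr_card_straight nu :
  lr_card B N r m l nu = alln N (fun t => l t == nu t).
Proof.
rewrite /lr_card; case: (boolP (alln _ _)) => h.
  rewrite -[RHS](cards1 highestP); apply: eq_card => P; rewrite !inE.
  apply/idP/eqP => [/andP[/andP[gP lP] _]|->]; first exact: lattice_highest.
  rewrite highest_gtb highest_lattice /=; apply/allnP => t tN.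
  by rewrite cont_highest //; exact: (elimT (allnP _ _) h).
apply: eq_card0 => P; rewrite !inE; apply/negP => /andP[/andP[gP lP] /allnP c].
case/negP: h; apply/allnP => t tN.
by rewrite -(cont_highest tN) -(lattice_highest gP lP) c.
Qed.

End Straight.

Lemma eq_lr_card B N r m l nu nu' : (forall t, t < N -> nu t = nu' t) ->
  lr_card B N r m l nu = lr_card B N r m l nu'.
Proof.
move=> h; apply: eq_card => P; rewrite !inE; congr (_ && _).
by apply: eq_in_all => t; rewrite mem_iota => /= tN; rewrite h.
Qed.

Lemma sumn_nth e : sumn e = \sum_(i < size e) nth 0 e i.
Proof. by rewrite sumnE (big_nth 0) big_mkord. Qed.

Lemma skew_size_nil la : skew_size la [::] = sumn la.
Proof.
by rewrite skew_sizeE sumn_nth; apply: eq_bigr => i _; rewrite nth_nil subn0.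
Qed.

Lemma size_comp_le a : is_comp a -> size a <= sumn a.
Proof. by elim: a => //= x a IH; rewrite is_comp_cons => /andP[x0 /IH]; lia. Qed.

(* The exponents of the terms of the Jacobi-Trudi determinant. *)
Definition jt_ok n nu (s : 'S_n) :=
  [forall i : 'I_n, n.-1 - i <= rho_shift n nu (s i)].

Definition jt_exp n nu (s : 'S_n) : seq nat :=
  [seq rho_shift n nu (s i) - (n.-1 - i) | i : 'I_n].

Lemma big_image_ord n (f : 'I_n -> nat) (g : nat -> nat) :
  \sum_(x <- [seq f i | i : 'I_n]) g x = \sum_(i < n) g (f i).
Proof. by rewrite big_map big_enum; apply: eq_bigl. Qed.

Lemma size_jt_exp n nu (s : 'S_n) : size (jt_exp nu s) = n.
Proof. by rewrite size_map size_enum_ord. Qed.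

Lemma nth_jt_exp n nu (s : 'S_n) (i : 'I_n) :
  nth 0 (jt_exp nu s) i = rho_shift n nu (s i) - (n.-1 - i).
Proof. by rewrite (nth_map i) ?size_enum_ord // nth_ord_enum. Qed.

Lemma sumn_jt_exp n nu (s : 'S_n) : jt_ok nu s ->
  sumn (jt_exp nu s) = \sum_(i < n) nu i.
Proof.
move=> /forallP ok; rewrite sumnE big_image_ord.
rewrite sumnB => [|i _]; last exact: ok.
have -> : \sum_(i < n) rho_shift n nu (s i) = \sum_(i < n) rho_shift n nu i.
  by rewrite [RHS](reindex_inj (@perm_inj _ s)).
by rewrite /rho_shift big_split /= addnK.
Qed.

Section JacobiTrudi.

Variables (l m : seq nat).
Hypotheses (pl : is_part l) (pm : is_part m).
Hypothesis ml : forall i, nth 0 m i <= nth 0 l i.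
Variable n : nat.
Hypothesis nE : skew_size l m = n.

(** Expanding [match_sign] over permutations and exchanging the sums turns each permutation into a
    coefficient of the skew function, at the exponent for which the shifted content is the permuted
    shifted [nu]. When [jt_ok] fails this exponent has a negative entry and no pattern
    contributes. *)
Lemma jacobi_trudi nu : (forall i j, i <= j -> j < n -> nu j <= nu i) ->
    \sum_(i < n) nu i = n ->
  (\sum_(s : 'S_n) (-1) ^+ s *
     (if jt_ok nu s then skew_schur l m (jt_exp nu s) else 0))%R =
  Posz (lr_card (maxpart l) n (size l) (nth 0 m) (nth 0 l) nu).
Proof.
move=> dec sn; rewrite -stembridge //.
under [RHS]eq_bigr => P _ do rewrite match_signE.
rewrite exchange_big /=; apply: eq_bigr => s _; rewrite -big_distrr /=.
congr (_ * _)%R; case: (boolP (jt_ok nu s)) => ok.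
  rewrite (@skew_schur_gt _ _ pl pm ml (maxpart l)); first last.
  - by rewrite nE sumn_jt_exp.
  - exact: nth_maxpart.
  rewrite size_jt_exp /gt_card -sum1dep_card (big_morph Posz PoszD (erefl _)).
  rewrite big_mkcondr /=; apply: eq_bigr => P _.
  rewrite (_ : alln n _ = [forall i : 'I_n,
    rho_shift n (cont (size l) (ev P)) i == rho_shift n nu (s i)]).
    by case: ifP.
  apply/allnP/forallP => h i.
    have := h i (ltn_ord i); rewrite nth_jt_exp => /eqP e.
    by rewrite {1}/rho_shift e subnK //; exact: (forallP ok).
  move=> iN; have := h (Ordinal iN); rewrite {1}/rho_shift => /eqP e.
  by have := nth_jt_exp nu s (Ordinal iN); rewrite /= -e => ->; rewrite addnK.
rewrite big1 // => P _; case: forallP => // h; case/negP: ok; apply/forallP => i.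
by rewrite -(eqP (h i)) /rho_shift leq_addl.
Qed.

Lemma skew_schur_perm e e' : size e = n -> sumn e = n -> perm_eq e e' ->
  skew_schur l m e = skew_schur l m e'.
Proof.
move=> se sume pe; rewrite !(@skew_schur_gt _ _ pl pm ml (maxpart l)) ?nE //.
- by rewrite -(perm_size pe) se (gt_card_perm _ _ _ _ se pe).
- exact: nth_maxpart.
- by rewrite -(perm_sumn pe).
- exact: nth_maxpart.
Qed.

End JacobiTrudi.

(** A measure that sees the largest exponents first: in base [n.+1] one exponent outweighs [n]
    smaller ones. It is symmetric and bounded, hence fit for a downward induction. *)
Definition powersum n (e : seq nat) := \sum_(x <- e) n.+1 ^ x.

Lemma powersum_perm n e e' : perm_eq e e' -> powersum n e = powersum n e'.
Proof. exact: perm_big. Qed.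

Lemma powersum_bound n e : size e = n -> sumn e = n ->
  powersum n e <= n * n.+1 ^ n.
Proof.
move=> se sume; rewrite -{2}se /powersum -sum1_size big_distrl /=.
rewrite big_seq [X in _ <= X]big_seq; apply: leq_sum => x xe.
rewrite mul1n leq_pexp2l // -sume; elim: (e) xe => //= y s IH.
by rewrite inE => /orP[/eqP ->|/IH]; lia.
Qed.

(** Reindexed by the inverse of [s], the exponent at [j] is [nu j] plus the displacement of [j].
    Indices before the first moved one are unchanged; that one moves up, so its exponent exceeds
    [nu] at every index from there on. *)
Lemma powersum_jt n nu (s : 'S_n) : (forall i j, i <= j -> j < n -> nu j <= nu i) ->
  jt_ok nu s -> s != 1%g ->
  powersum n [seq nu i | i : 'I_n] < powersum n (jt_exp nu s).
Proof.
move=> dec /forallP ok s1; rewrite /powersum !big_image_ord.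
have [j0 uj0 minj0] : exists2 j : 'I_n, (s^-1)%g j != j &
    forall i : 'I_n, i < j -> (s^-1)%g i = i.
  have ex : exists k, (k < n) && [exists j : 'I_n, (j == k :> nat) && ((s^-1)%g j != j)].
    case: (pickP (fun j => (s^-1)%g j != j)) => [j hj|h].
      by exists j; rewrite ltn_ord; apply/existsP; exists j; rewrite eqxx.
    case/eqP: s1; apply: invg_inj; rewrite invg1; apply/permP => j.
    by rewrite perm1; apply/eqP/negbFE/h.
  case: (ex_minnP ex) => k /andP[kn /existsP[j /andP[/eqP jk hj]]] mink.
  exists j => // i ij; apply/eqP; apply: contraTT ij => hi; rewrite -leqNgt jk.
  by apply: mink; rewrite ltn_ord; apply/existsP; exists i; rewrite eqxx.
rewrite [X in _ < X](reindex_inj (@perm_inj _ (s^-1)%g)) /=.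
have big_j0 : j0 < (s^-1)%g j0.
  have [lt|//|e] := ltngtP ((s^-1)%g j0) j0; last by case/eqP: uj0; exact/ord_inj.
  by have /perm_inj e := minj0 _ lt; rewrite e eqxx in uj0.
rewrite (bigID (fun j : 'I_n => j < j0)) [X in _ < X](bigID (fun j : 'I_n => j < j0)) /=.
have -> : \sum_(i < n | i < j0) n.+1 ^ (rho_shift n nu (s ((s^-1)%g i)) - (n.-1 - (s^-1)%g i))
    = \sum_(i < n | i < j0) n.+1 ^ nu i.
  by apply: eq_bigr => i ij; rewrite permKV minj0 // /rho_shift addnK.
rewrite ltn_add2l [X in _ < X](bigD1 j0) /= -?leqNgt //.
have le1 : \sum_(i < n | ~~ (i < j0)) n.+1 ^ nu i <= n * n.+1 ^ nu j0.
  rewrite -[X in X * _]card_ord -sum_nat_const big_mkcond /=.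
  apply: leq_sum => i _; case: ltnP => //= ji.
  by rewrite leq_pexp2l // dec.
apply: leq_ltn_trans le1 _; apply: leq_trans (leq_addr _ _).
apply: (@leq_trans (n.+1 ^ (nu j0).+1)).
  by rewrite expnS ltn_pmul2r ?expn_gt0.
rewrite leq_pexp2l // permKV /rho_shift.
by have := ltn_ord ((s^-1)%g j0); lia.
Qed.

Lemma comp_eq_nth a b : is_comp a -> is_comp b ->
  (forall i, nth 0 a i = nth 0 b i) -> a = b.
Proof.
move=> ca cb h; suff sz : size a = size b by apply: (eq_from_nth sz) => i _.
have [lt|lt|//] := ltngtP (size a) (size b).
  by have := is_comp_nth cb lt; rewrite -h nth_default.
by have := is_comp_nth ca lt; rewrite h nth_default.
Qed.

Definition parts n : seq (seq nat) := [seq la <- comps n | is_part la].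

Lemma mem_parts n la : (la \in parts n) = is_part la && (sumn la == n).
Proof.
rewrite mem_filter mem_comps; case: (boolP (is_part la)) => //= pl.
by rewrite is_part_comp.
Qed.

Lemma is_part_decr la i j : is_part la -> i <= j -> nth 0 la j <= nth 0 la i.
Proof. by move=> pl; apply: nonincr => k; exact: is_part_nth. Qed.

Lemma part_sorted_flat e : sorted geq e -> is_part (flat e) /\
  (forall i, nth 0 (flat e) i = nth 0 e i).
Proof.
move=> se; have tr : transitive geq by move=> x y z /= h1 h2; exact: leq_trans h2 h1.
split; first by rewrite /is_part is_comp_flat andbT sorted_filter.
elim: e se => //= x e IH; rewrite path_sortedE // => /andP[/allP xe se] i.
case: x xe => [|x] xe /=; last by case: i => [|i] //=; exact: IH.
have z y : y \in e -> y = 0 by move/xe => /=; case: y.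
have -> : flat e = [::].
  apply/eqP; rewrite -size_eq0 size_filter -leqn0 leqNgt -has_count.
  by apply/hasPn => y /z ->.
case: i => [|i] //=; rewrite ?nth_nil //.
case: (ltnP i (size e)) => h; last by rewrite nth_default.
by rewrite (z _ (mem_nth 0 h)).
Qed.

(** The difference [g] of the two sides is symmetric and its alternating sums vanish, since for
    straight shapes [lr_card] is a Kronecker delta that isolates one coefficient [c]. In such a sum
    the identity contributes [g] at the sorted exponent and every other term has larger [powersum],
    so induction gives [g = 0]. *)
Theorem schur_expansion l m : is_part l -> is_part m ->
    (forall i, nth 0 m i <= nth 0 l i) ->
  exists c : seq nat -> nat, forall e, skew_schur l m e =
    (\sum_(la <- parts (skew_size l m)) Posz (c la) * schur la e)%R.
Proof.
move=> pl pm ml; set n := skew_size l m.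
pose c la := lr_card (maxpart l) n (size l) (nth 0 m) (nth 0 l) (nth 0 la).
exists c; pose g e := (skew_schur l m e -
  \sum_(la <- parts n) Posz (c la) * schur la e)%R.
have pn : is_part [::] by [].
have nl (la : seq nat) i : nth 0 [::] i <= nth 0 la i by rewrite nth_nil.
have inparts la : la \in parts n -> is_part la /\ skew_size la [::] = n.
  by rewrite mem_parts skew_size_nil => /andP[? /eqP].
suff main e : g e = 0%R by move=> e; apply/eqP; rewrite -subr_eq0; apply/eqP/main.
have gperm e1 e2 : size e1 = n -> sumn e1 = n -> perm_eq e1 e2 -> g e1 = g e2.
  move=> s1 s2 pe; rewrite /g (skew_schur_perm pl pm ml (erefl n) s1 s2 pe); congr (_ - _)%R.
  apply: eq_big_seq => la /inparts[pla sla].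
  by rewrite /schur (skew_schur_perm pla pn (nl la) sla s1 s2 pe).
have gflat e1 : g (flat e1) = g e1.
  rewrite /g skew_schur_flat //; congr (_ - _)%R.
  by apply: eq_big_seq => la /inparts[pla sla]; rewrite /schur skew_schur_flat.
have gbig e1 : size e1 = n -> sumn e1 = n -> g e1 = 0%R.
  have [k] := ubnP (n * n.+1 ^ n - powersum n e1).
  elim: k e1 => // k IH e1 hk s1 s2.
  have {}IH e2 : size e2 = n -> sumn e2 = n -> powersum n e1 < powersum n e2 ->
      g e2 = 0%R.
    by move=> s1' s2' lt; apply: IH => //; have := powersum_bound s1' s2'; lia.
  set e' := sort geq e1.
  have pe : perm_eq e1 e' by rewrite perm_sym; apply/permPl/perm_sort.
  have se' : sorted geq e' by apply: sort_sorted => x y; exact: leq_total.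
  have [pf nf] := part_sorted_flat se'.
  have sz' : size e' = n by rewrite -(perm_size pe).
  have sm' : sumn e' = n by rewrite -(perm_sumn pe).
  pose nu := nth 0 e'.
  have dec i j : i <= j -> j < n -> nu j <= nu i.
    by move=> ij _; rewrite /nu -!nf; exact: is_part_decr.
  have snu : \sum_(i < n) nu i = n by rewrite -[RHS]sm' sumn_nth sz'.
  have e'E : [seq nu i | i : 'I_n] = e'.
    apply: (@eq_from_nth _ 0); rewrite size_map size_enum_ord // => i lt.
    by rewrite (nth_map (Ordinal lt)) ?size_enum_ord // nth_enum_ord.
  rewrite (gperm _ _ s1 s2 pe).
  have : (\sum_(s : 'S_n) (-1) ^+ s *
      (if jt_ok nu s then g (jt_exp nu s) else 0) = 0)%R.
    rewrite (eq_bigr (fun s : 'S_n => (-1) ^+ s * (if jt_ok nu s then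
        skew_schur l m (jt_exp nu s) else 0) - \sum_(la <- parts n) Posz (c la) *
        ((-1) ^+ s * (if jt_ok nu s then schur la (jt_exp nu s) else 0)))%R); last first.
      move=> s _; case: ifP => _; rewrite /g ?mulrBr ?mulr0.
        by congr (_ - _)%R; rewrite big_distrr; apply: eq_bigr => la _; rewrite mulrCA.
      by rewrite big1 ?subr0 // => la _; rewrite mulr0.
    rewrite sumrB (jacobi_trudi pl pm ml (erefl n) dec snu) exchange_big /=.
    rewrite (eq_big_seq (fun la => Posz (c la) * Posz (flat e' == la))%R) => [|la lap].
      have fp : flat e' \in parts n by rewrite mem_parts pf sumn_flat sm' eqxx.
      rewrite (bigD1_seq (flat e')) ?filter_uniq ?uniq_comps //= eqxx big1.
        rewrite mulr1 addr0 /c; apply/eqP; rewrite subr_eq0; apply/eqP; congr Posz.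
        by apply: eq_lr_card => t _; rewrite nf.
      by move=> la; rewrite eq_sym => /negPf ->; rewrite mulr0.
    have [pla sla] := inparts la lap; rewrite -big_distrr /=; congr (_ * _)%R.
    rewrite (jacobi_trudi pla pn (nl la) sla dec snu) lr_card_straight.
    - congr Posz; congr nat_of_bool; apply/allnP/eqP => [h|<- i _]; last by rewrite nf.
      apply: comp_eq_nth; rewrite ?is_comp_flat ?is_part_comp // => i.
      case: (ltnP i n) => lt; first by rewrite nf (eqP (h i lt)).
      have szl : size la <= n by rewrite -sla skew_size_nil size_comp_le ?is_part_comp.
      have szf : size (flat e') <= n by rewrite -sz' size_filter count_size.
      by rewrite !nth_default // (leq_trans _ lt).
    - by move=> i; rewrite nth_nil.
    - by move=> i j; exact: is_part_decr.
    - by move=> i; exact: nth_default.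
    - exact: nth_maxpart.
    - by rewrite -sla skew_size_nil size_comp_le ?is_part_comp.
  rewrite (bigD1 1%g) //= odd_perm1 mul1r big1 => [|s s1g]; last first.
    case: ifP => ok; last by rewrite mulr0.
    rewrite IH ?mulr0 ?size_jt_exp ?sumn_jt_exp //.
    by have := powersum_jt dec ok s1g; rewrite e'E (powersum_perm _ pe).
  rewrite addr0; have ok1 : jt_ok nu (1%g : 'S_n).
    by apply/forallP => i; rewrite perm1 leq_addl.
  rewrite ok1 (_ : jt_exp nu 1%g = e') // -e'E.
  by apply: eq_map => i; rewrite perm1 /rho_shift addnK.
case: (eqVneq (sumn e) n) => se; last first.
  rewrite /g skew_schur_0 // big_seq big1 ?subr0 // => la /inparts[pla sla].
  by rewrite /schur skew_schur_0 ?mulr0 // sla.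
(* The alternating sums concern exponent sequences of length [n]. At most [n] entries of [e] are
   nonzero, so padding with zeros reaches this length. *)
rewrite -gflat; pose e2 := flat e ++ nseq (n - size (flat e)) 0.
have fe2 : flat e2 = flat e.
  rewrite /e2 /flat filter_cat (_ : [seq x <- nseq _ _ | _] = [::]) ?cats0.
    by rewrite filter_id.
  by elim: (n - _).
rewrite -fe2 gflat; apply: gbig.
  have h := size_comp_le (is_comp_flat e); rewrite sumn_flat se in h.
  by rewrite size_cat size_nseq subnKC.
by rewrite sumn_cat sumn_flat sumn_nseq addn0.
Qed.

(** * Dual immaculate functions *)

Lemma sumn_map_iota k f : sumn [seq f i | i <- iota 0 k] = \sum_(i < k) f i.
Proof. by rewrite sumnE big_map -(big_mkord xpredT f) /index_iota subn0. Qed.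

(** The third clause is the strict first column: a row starts only after the row above it has
    started. The final row lengths are left free, so that one signed set covers all the [D_a] with
    [k] parts. *)
Definition imm_chain N k (e : nat -> nat) p :=
  [&& alln k (fun i => p 0 i == 0),
      alln N (fun t => alln k (fun i => p t i <= p t.+1 i)),
      alln N (fun t => alln k.-1 (fun i => (0 < p t.+1 i.+1) ==> (0 < p t i)))
    & alln N (fun t => cont k p t == e t)].

Lemma imm_chainP N k e p : reflect
  [/\ forall i, i < k -> p 0 i = 0,
      forall t i, t < N -> i < k -> p t i <= p t.+1 i,
      forall t i, t < N -> i.+1 < k -> 0 < p t.+1 i.+1 -> 0 < p t i
    & forall t, t < N -> cont k p t = e t] (imm_chain N k e p).
Proof.
apply: (iffP and4P) => [[/allnP h0 /allnP h1 /allnP h2 /allnP h3]|[h0 h1 h2 h3]].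
  split=> [i ik|t i tN|t i tN ik|t tN].
  - exact/eqP/h0.
  - exact: (elimT (allnP _ _) (h1 t tN)).
  - have ik1 : i < k.-1 by lia.
    exact/implyP/(elimT (allnP _ _) (h2 t tN) i ik1).
  - exact/eqP/h3.
split; apply/allnP => t tN; rewrite ?h0 ?h3 //; apply/allnP => i ik.
  exact: h1.
by apply/implyP; apply: h2 => //; lia.
Qed.

Lemma dual_immaculateE B a e : is_comp a -> (forall i, nth 0 a i <= B) ->
  dual_immaculate a e =
  Posz #|[set R : 'M['I_B.+1]_((size e).+1, size a) |
     imm_chain (size e) (size a) (nth 0 e) (ev R) &&
     alln (size a) (fun i => ev R (size e) i == nth 0 a i)]|.
Proof.
move=> ca aB; rewrite /dual_immaculate; congr Posz.
set N := size e; set k := size a; set c := maxpart a; set L := nth 0 a.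
pose Z (i : nat) := 0.
have mulam i : i < k -> Z i <= L i <= c by move=> _; rewrite nth_maxpart.
have lamB i : i < k -> L i <= B by move=> _; exact: aB.
have c0 i : i < k -> 0 < c.
  by move=> ik; apply: leq_trans (is_comp_nth ca ik) (nth_maxpart _ _).
have fillE (T : 'M['I_N.+1]_(k, c)) : is_immaculate T ->
    fillP Z L k c (ev T).
  case/and3P => /forallP fl /forallP rw _; split=> [i j ik jc|i j j' ik jj' _ jl].
    have /forallP/(_ (Ordinal jc))/eqP := fl (Ordinal ik); by rewrite -evE.
  have := mulam i ik => h; have jc : j' < c by lia.
  move: jj'; rewrite leq_eqVlt => /orP[/eqP -> //|jj'].
  have jc' : j < c by lia.
  have /forallP/(_ (Ordinal jc'))/forallP/(_ (Ordinal jc)) := rw (Ordinal ik).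
  by rewrite /comp_diagram -/L jj' jl -!evE.
have fcE (T : 'M['I_N.+1]_(k, c)) : fillP Z L k c (ev T) ->
    (first_col_incr T <-> forall t i, t < N -> i.+1 < k ->
       0 < ev (T2P Z L B T) t.+1 i.+1 -> 0 < ev (T2P Z L B T) t i).
  move=> ft; have gal t i : t <= N -> i < k ->
      (0 < ev (T2P Z L B T) t i) = (ev T i 0 <= t).
    by move=> tN ik; apply: (T2P_galois mulam lamB ft ik _ tN); apply: is_comp_nth.
  split.
    move=> /forallP fc t i tN ik; rewrite !gal ?(ltnW tN) ?(ltnW ik) //.
    have /forallP/(_ (Ordinal ik))/forallP/(_ (Ordinal (c0 _ ik))) := fc (Ordinal (ltnW ik)).
    by rewrite /= ltnSn -!evE /=; lia.
  move=> h; have st i : i.+1 < k -> ev T i 0 < ev T i.+1 0.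
    move=> ik; have [f0 _] := ft; have := f0 i.+1 0 ik (c0 _ ik).
    rewrite (is_comp_nth ca ik : 0 < L i.+1) leq0n => h1.
    have hN := ev_le T i.+1 0; have t1 : (ev T i.+1 0).-1 < N by lia.
    have := h (ev T i.+1 0).-1 i t1 ik.
    by rewrite gal // gal ?(ltnW ik) ?(ltnW t1) // prednK ?lt0n // leqnn => /(_ isT); lia.
  apply/forallP => i; apply/forallP => i'; apply/forallP => j; apply/implyP.
  rewrite -!evE => /andP[/eqP -> ii'].
  have := ltn_ord i'; rewrite -(subnKC ii').
  elim: (i' - i.+1) => [|d IH]; first by rewrite addn0; exact: st.
  rewrite addnS => ik; exact: ltn_trans (IH (ltnW ik)) (st _ ik).
apply: (@bij_card _ _ _ _ (T2P Z L B)).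
- move=> T T'; rewrite !inE => /andP[iT _] /andP[iT' _].
  by apply: (T2P_inj mulam lamB); exact: fillE.
- move=> T; rewrite !inE => /andP[iT /forallP cT].
  have ft := fillE _ iT; have [h0 hN mon] := T2P_chain mulam lamB ft.
  apply/andP; split; last by apply/allnP => i ik; rewrite hN.
  apply/imm_chainP; split=> // [|t tN].
    by apply/(fcE _ ft); case/and3P: iT.
  by rewrite /cont -(T2P_occ mulam lamB ft tN); exact/eqP/(cT (Ordinal tN)).
- move=> R; rewrite inE => /andP[/imm_chainP[h0 mon fc cR] /allnP hN].
  have ch : chainP Z L N k (ev R).
    by split=> // i ik; exact/eqP/hN.
  have [T ft TR] := T2P_onto mulam lamB ch; exists T => //; rewrite inE.
  have fcT : first_col_incr T by apply/(fcE _ ft); rewrite TR.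
  have [f0 f1] := ft; apply/andP; split.
    apply/and3P; split=> //.
      apply/forallP => i; apply/forallP => j; rewrite -evE; apply/eqP.
      exact: f0.
    apply/forallP => i; apply/forallP => j; apply/forallP => j'; apply/implyP.
    by case/andP => jj' jl; rewrite -!evE; apply: f1 => //; exact: ltnW.
  apply/forallP => v; rewrite (T2P_occ mulam lamB ft) // TR.
  exact/eqP/cR.
Qed.

Section TailSwap.

Variables (N k : nat) (e : nat -> nat).

(* From the first violation of the column condition on, rows i and i.+1
   exchange their rho-shifted lengths, which flips the sign of the term. *)
Definition tail_swap v i (p : nat -> nat -> nat) t j :=
  if v < t then
    if j == i then (p t i.+1).-1 else if j == i.+1 then (p t i).+1 else p t j
  else p t j.

Definition iviol (p : nat -> nat -> nat) v i := p v i < p v.+1 i.+1.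

(** The earliest step [v] and, at that step, the largest [i]. The exchange alters only rows [i] and
    [i.+1] after [v], which leaves the tests at earlier steps and for larger [i] untouched; so the
    selection is stable. *)
Definition isel p v i := [&& v < N, i.+1 < k, iviol p v i,
  alln v (fun v' => alln k.-1 (fun i' => ~~ iviol p v' i'))
  & alln k.-1 (fun i' => (i < i') ==> ~~ iviol p v i')].

Definition iinter p := alln N (fun v => alln k.-1 (fun i => ~~ iviol p v i)).

Lemma isel_exists p : ~~ iinter p -> exists v i, isel p v i.
Proof.
case/allPn => v0; rewrite mem_iota => /= v0N hv0.
pose Q v := ~~ alln k.-1 (fun i => ~~ iviol p v i).
have exQ : exists v, Q v by exists v0.
case: (ex_minnP exQ) => v hv minv; have vv0 := minv _ hv0.
case/allPn: (hv) => i0; rewrite mem_iota negbK => /= i0k vi0.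
pose Q' i := (i < k.-1) && iviol p v i.
have exQ' : exists i, Q' i by exists i0; rewrite /Q' i0k.
have bQ' i : Q' i -> i <= k by case/andP; lia.
case: (ex_maxnP exQ' bQ') => i /andP[ik vi] maxi; exists v, i.
rewrite /isel vi; apply/and5P; split=> //; try lia.
  apply/allnP => v' v'v; apply/negPn/negP => /minv; lia.
apply/allnP => i' i'k; apply/implyP => ii'; apply/negP => vi'.
by have := maxi i'; rewrite /Q' i'k vi' => /(_ isT); lia.
Qed.

Lemma isel_uniq p v i v' i' : isel p v i -> isel p v' i' -> v = v' /\ i = i'.
Proof.
case/and5P => vN ik h /allnP hv /allnP hi /and5P[v'N i'k h' /allnP hv' /allnP hi'].
have evv : v = v'.
  have [lt|lt|//] := ltngtP v v'.
    by have /allnP/(_ i) := hv' _ lt; rewrite h; lia.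
  by have /allnP/(_ i') := hv _ lt; rewrite h'; lia.
subst v'; split=> //; have [lt|lt|//] := ltngtP i i'.
  have i1 : i' < k.-1 by lia.
  by have /implyP/(_ lt) := hi i' i1; rewrite h'.
have i1 : i < k.-1 by lia.
by have /implyP/(_ lt) := hi' i i1; rewrite h.
Qed.

Section OneSwap.

Variables (p : nat -> nat -> nat) (v i : nat).
Hypothesis ip : imm_chain N k e p.
Hypothesis sp : isel p v i.

Let q := tail_swap v i p.

Lemma swap_facts : [/\ v < N, i.+1 < k, p v i < p v.+1 i.+1, 0 < p v i
  & forall t, v < t -> t <= N -> 0 < p t i.+1].
Proof.
have [vN ik h _ _] := and5P sp; have [h0 mon fc _] := imm_chainP _ _ _ _ ip.
split=> // [|t vt tN]; first by apply: fc => //; rewrite /iviol in h; lia.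
rewrite /iviol in h; suff : p v.+1 i.+1 <= p t i.+1 by lia.
rewrite -(subnKC vt) in tN *; elim: (t - v.+1) tN => [|d IH]; first by rewrite addn0.
by rewrite addnS => tN; apply: leq_trans (IH _) (mon _ _ _ ik); lia.
Qed.

Lemma sum_tail_swap t : t <= N -> \sum_(j < k) q t j = \sum_(j < k) p t j.
Proof.
have [vN ik _ _ pos] := swap_facts => tN.
rewrite /q /tail_swap; case: ltnP => vt //.
pose i1 := Ordinal (ltnW ik); pose i2 := Ordinal ik.
have ne : i2 != i1 by rewrite -val_eqE /=; apply/eqP; lia.
rewrite (bigD1 i1) //= (bigD1 i2) //= [RHS](bigD1 i1) //= [in RHS](bigD1 i2) //=.
rewrite eqxx (_ : i.+1 == i = false) ?eqxx; last by apply/eqP; lia.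
have -> : \sum_(j < k | (j != i1) && (j != i2)) (if (j : nat) == i then (p t i.+1).-1 else
   if (j : nat) == i.+1 then (p t i).+1 else p t j) = 
   \sum_(j < k | (j != i1) && (j != i2)) p t j.
  by apply: eq_bigr => j; rewrite -!val_eqE /= => /andP[/negPf -> /negPf ->].
by have := pos t vt tN; rewrite !addnA => h; congr (_ + _); lia.
Qed.

Lemma imm_mono t t' j : t <= t' -> t' <= N -> j < k -> p t j <= p t' j.
Proof.
clear -ip; have [_ mon _ _] := imm_chainP _ _ _ _ ip => tt; rewrite -(subnKC tt).
elim: (t' - t) => [|d IH]; first by rewrite addn0.
by rewrite addnS => tN jk; apply: leq_trans (IH _ jk) (mon _ _ _ jk); lia.
Qed.

(** The critical point is the passage from [v] to [v.+1]: row [i] does not shrink because of the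
    violation itself, and row [i.+1] does not because there is no violation at [v.-1]. *)
Lemma tail_swap_chain : imm_chain N k e q.
Proof.
have [vN ik vio pvi pos] := swap_facts; have mono := imm_mono.
have [_ _ _ /allnP mv _] := and5P sp; have [h0 mon fc cE] := imm_chainP _ _ _ _ ip.
have qmon t j : t < N -> j < k -> q t j <= q t.+1 j.
  move=> tN jk; rewrite /q /tail_swap ltnS.
  have m1 := mon t i tN (ltnW ik); have m2 := mon t i.+1 tN ik.
  have m3 := mon t j tN jk.
  have [lt|gt|tv] := ltngtP t v => //.
    have := pos t gt (ltnW tN); case: eqP => _; first by lia.
    by case: eqP => _; lia.
  subst t; case: eqP => [ej|_]; first by rewrite ej; lia.
  case: eqP => [ej|_] //; rewrite ej.
  case: (posnP v) => [v0|v0]; first by rewrite {1}v0 h0.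
  have vN' : v.-1 < N by lia.
  have v1 : v.-1 < v by lia.
  have i1 : i < k.-1 by lia.
  have := elimT (allnP _ _) (mv _ v1) i i1; rewrite /iviol -leqNgt prednK // => h.
  have := mono v.-1 v.+1 i; rewrite vN (ltnW ik) => /(_ _ isT isT); lia.
have v0 : 0 < v by case: (posnP v) pvi => // ->; rewrite h0 // ltnW.
have above j t : i = j.+1 -> v <= t -> t <= N -> 0 < p t j.
  move=> ij vt tN; have v1 : v.-1 < N by lia.
  have := fc v.-1 j v1; rewrite -ij prednK // (ltnW ik) pvi => /(_ isT isT).
  by have := mono v.-1 t j; have := ik; lia.
have big t : v < t -> t <= N -> 1 < p t i.+1.
  by move=> vt tN; have := mono v.+1 t i.+1 vt tN ik; lia.
apply/imm_chainP; split=> // [t j tN jk|t tN].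
- rewrite /q /tail_swap ltnS.
  have [lt|gt|tv] := ltngtP t v.
  + exact: fc.
  + case: (j =P i) => [_ _|ji]; first by have := big t gt (ltnW tN); lia.
    case: (j =P i.+1) => [_ //|ji'].
    case: (j.+1 =P i) => [ij _|_]; first by apply: above; [rewrite ij|exact: ltnW|exact: ltnW].
    by rewrite eqSS (introF eqP ji); exact: fc.
  + subst t; case: (j.+1 =P i) => [ij _|_]; first by apply: above; [rewrite ij| |exact: ltnW].
    by rewrite eqSS; case: (j =P i) => [-> //|_]; exact: fc.
- rewrite -cE // /cont !sumnB => [|j _|j _]; try exact: mon; try exact: qmon.
  by rewrite !sum_tail_swap // ltnW.
Qed.

Lemma tail_swap_sel : isel q v i.
Proof.
have [vN ik vio pvi pos] := swap_facts.
have [_ _ _ /allnP mv /allnP mi] := and5P sp; have [_ mon _ _] := imm_chainP _ _ _ _ ip.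
apply/and5P; split=> //.
- by rewrite /iviol /q /tail_swap ltnn ltnSn eqxx (_ : i.+1 == i = false) ?ltnS ?mon ?(ltnW ik) //;
    apply/eqP; lia.
- apply/allnP => v' v'v; apply/allnP => i' i'k; rewrite /iviol /q /tail_swap.
  have -> : (v < v') = false by lia.
  have -> : (v < v'.+1) = false by lia.
  exact: (elimT (allnP _ _) (mv v' v'v) i' i'k).
- apply/allnP => i' i'k; apply/implyP => ii'; have /implyP/(_ ii') := mi i' i'k.
  rewrite /iviol /q /tail_swap ltnn ltnSn eqSS (_ : i'.+1 == i = false); last by apply/eqP; lia.
  by rewrite (_ : i' == i = false) //; apply/eqP; lia.
Qed.

Lemma tail_swapK t j : t <= N -> tail_swap v i q t j = p t j.
Proof.
have [vN ik _ _ pos] := swap_facts => tN.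
have ne : (i.+1 == i) = false by apply/eqP; lia.
rewrite /q /tail_swap; case: ltnP => // vt; have := pos t vt tN => h.
case: (j =P i) => [->|_]; first by rewrite ne eqxx.
by case: (j =P i.+1) => [->|_] //; rewrite eqxx; lia.
Qed.

Lemma tail_swap_last j : j < k -> (forall j, j < k -> 0 < p N j) -> 0 < q N j.
Proof.
have [vN ik vio pvi pos] := swap_facts; have mono := imm_mono => jk h.
rewrite /q /tail_swap vN; case: eqP => [_|_].
  by have := mono v.+1 N i.+1 vN (leqnn _) ik; lia.
by case: eqP => // _; exact: h.
Qed.

Lemma tail_swap_rho j : j < k ->
  rho_shift k (q N) j = (rho_shift k (p N) \o swap i) j.
Proof.
have [vN ik vio pvi pos] := swap_facts => jk; have := pos N vN (leqnn _).
rewrite /rho_shift /q /tail_swap /swap vN /=; case: eqP => [->|_]; first by lia.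
by case: eqP => [->|_]; lia.
Qed.

End OneSwap.

Lemma imm_sum p t : imm_chain N k e p -> t <= N ->
  \sum_(j < k) p t j = \sum_(s < t) e s.
Proof.
case/imm_chainP => h0 mon _ cE; elim: t => [|t IH] tN.
  by rewrite big_ord0 big1 // => j _; exact: h0.
rewrite big_ord_recr /= -IH ?(ltnW tN) // -cE // /cont sumnB => [|j _]; last exact: mon.
by rewrite subnKC // leq_sum // => j _; exact: mon.
Qed.

Lemma imm_chain_ext p q : (forall t j, t <= N -> j < k -> p t j = q t j) ->
  imm_chain N k e p -> imm_chain N k e q.
Proof.
move=> pq /imm_chainP[h0 mon fc cE]; apply/imm_chainP; split.
- by move=> j jk; rewrite -pq ?h0.
- by move=> t j tN jk; rewrite -!pq ?mon // ltnW.
- by move=> t j tN jk; rewrite -!pq ?(ltnW tN) ?(ltnW jk) //; exact: fc.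
- move=> t tN; rewrite -cE //; apply: eq_bigr => j _; rewrite !pq // ltnW //.
Qed.

Lemma isel_ext p q v i : (forall t j, t <= N -> j < k -> p t j = q t j) ->
  isel p v i -> isel q v i.
Proof.
move=> pq /and5P[vN ik h /allnP mv /allnP mi].
have e1 v' i' : v' < N -> i'.+1 < k -> iviol q v' i' = iviol p v' i'.
  by move=> v'N i'k; rewrite /iviol !pq // ltnW.
apply/and5P; split=> //; first by rewrite e1.
  apply/allnP => v' v'v; apply/allnP => i' i'k; rewrite e1; try lia.
  exact: (elimT (allnP _ _) (mv v' v'v) i' i'k).
apply/allnP => i' i'k; rewrite e1; [exact: mi|exact: vN|lia].
Qed.

Variable B : nat.
Hypothesis eB : \sum_(s < N) e s <= B.

Notation arr := 'M['I_B.+1]_(N.+1, k).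

Definition imm_set (R : arr) :=
  imm_chain N k e (ev R) && alln k (fun i => 0 < ev R N i).

Definition tflip (R : arr) : arr :=
  if [pick vi : 'I_N * 'I_k | isel (ev R) vi.1 vi.2] is Some vi
  then mk B N.+1 k (tail_swap vi.1 vi.2 (ev R)) else R.

Lemma tflipE (R : arr) v i : isel (ev R) v i ->
  tflip R = mk B N.+1 k (tail_swap v i (ev R)).
Proof.
move=> s; rewrite /tflip; case: pickP => [vi s'|h].
  by have [-> ->] := isel_uniq s s'.
have [vN ik _ _ _] := and5P s.
by have := h (Ordinal vN, Ordinal (ltnW ik)); rewrite /= s.
Qed.

Lemma ev_tswap (R : arr) v i t j : imm_chain N k e (ev R) -> isel (ev R) v i ->
  t <= N -> j < k ->
  ev (mk B N.+1 k (tail_swap v i (ev R))) t j = tail_swap v i (ev R) t j.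
Proof.
move=> iR s tN jk; rewrite ev_mk //; apply: leq_trans eB.
apply: (@leq_trans (\sum_(j < k) tail_swap v i (ev R) t j)).
  by rewrite (bigD1 (Ordinal jk)) //= leq_addr.
rewrite sum_tail_swap // imm_sum // -(subnKC tN) big_split_ord /= leq_addr //.
Qed.

Lemma eq_tail_swap v i p q t j : (forall j, j < k -> p t j = q t j) ->
  i.+1 < k -> j < k -> tail_swap v i p t j = tail_swap v i q t j.
Proof. by move=> h ik jk; rewrite /tail_swap !h // ltnW. Qed.

Lemma tflip_facts (R : arr) : imm_set R -> ~~ iinter (ev R) ->
  [/\ imm_set (tflip R), ~~ iinter (ev (tflip R)), tflip (tflip R) = R
    & forall y, match_sign k (rho_shift k (ev (tflip R) N)) y =
       (- match_sign k (rho_shift k (ev R N)) y)%R].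
Proof.
case/andP => iR /allnP pR /isel_exists[v [i s]]; rewrite (tflipE s).
set R' := mk _ _ _ _; have eR' t j : t <= N -> j < k ->
    ev R' t j = tail_swap v i (ev R) t j by move=> tN jk; exact: ev_tswap.
have iR' : imm_chain N k e (ev R').
  by apply: imm_chain_ext (tail_swap_chain iR s) => t j tN jk; rewrite eR'.
have s' : isel (ev R') v i.
  by apply: isel_ext (tail_swap_sel iR s) => t j tN jk; rewrite eR'.
have [vN ik _ _ _] := and5P s; split.
- apply/andP; split=> //; apply/allnP => j jk; rewrite eR' //.
  exact: tail_swap_last.
- have [_ _ h _ _] := and5P s'; apply/negP => /allnP/(_ v vN)/allnP/(_ i).
  by rewrite h; have i1 : i < k.-1 by [lia]; move/(_ i1).
- rewrite (tflipE s'); apply: ev_inj => t j tN jk; rewrite ltnS in tN.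
  rewrite ev_tswap // -(tail_swapK iR s j tN); apply: eq_tail_swap => // j' j'k.
  exact: eR'.
- move=> y; rewrite -(match_sign_swap _ _ ik); apply: eq_match_sign => // j jk.
  by rewrite -(tail_swap_rho iR s jk) /rho_shift eR'.
Qed.

Lemma imm_sign_sum y : (\sum_(R : arr | imm_set R)
    match_sign k (rho_shift k (ev R N)) y =
  \sum_(R : arr | imm_set R && iinter (ev R))
    match_sign k (rho_shift k (ev R N)) y)%R.
Proof.
rewrite (bigID (fun R : arr => iinter (ev R))) /= [X in (_ + X)%R](@sum_involution _ _ tflip) ?addr0 //.
- by move=> R /andP[h1 h2]; have [-> -> _ _] := tflip_facts h1 h2.
- by move=> R /andP[h1 h2]; have [_ _ -> _] := tflip_facts h1 h2.
- by move=> R /andP[h1 h2]; have [_ _ _ ->] := tflip_facts h1 h2.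
Qed.

End TailSwap.

Lemma dual_immaculate_card B k a e : is_comp a -> (forall i, nth 0 a i <= B) ->
    size a = k -> dual_immaculate a e =
  Posz #|[set R : 'M['I_B.+1]_((size e).+1, k) |
     imm_chain (size e) k (nth 0 e) (ev R) &&
     ([seq ev R (size e) i | i <- iota 0 k] == a)]|.
Proof.
move=> ca aB sk; subst k; rewrite (dual_immaculateE e ca aB); congr Posz.
apply: eq_card => R; rewrite !inE; congr (_ && _).
apply/allnP/eqP => [h|h i ik]; last first.
  have := congr1 (fun s => nth 0 s i) h.
  by rewrite (nth_map 0) ?size_iota // nth_iota // => ->.
apply: (@eq_from_nth _ 0); rewrite size_map size_iota // => i ik.
by rewrite (nth_map 0) ?size_iota // nth_iota // (eqP (h i ik)).
Qed.

Lemma dual_immaculate_0 a e : is_comp a -> sumn e != sumn a ->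
  dual_immaculate a e = 0%R.
Proof.
move=> ca ne; rewrite (@dual_immaculate_card (maxpart a) (size a)) //; last exact: nth_maxpart.
congr Posz; apply: eq_card0 => R; rewrite !inE; apply/negP => /andP[iR /eqP fR].
have sa : sumn a = \sum_(j < size a) ev R (size e) j.
  by rewrite -[in LHS]fR sumn_map_iota.
by case/eqP: ne; rewrite sa (imm_sum iR) // sumn_nth.
Qed.

(** The signed sum ranges over immaculate chains with arbitrary positive final rows. Those that
    survive the tail swap interlace, so they are semistandard tableaux with weakly decreasing final
    rows, and there the sign selects the shape [la]. *)
Theorem schur_dual la e : is_part la -> sumn e = sumn la ->
  schur la e = (\sum_(a <- comps (sumn la) | size a == size la)
    match_sign (size la) (rho_shift (size la) (nth 0 a))
      (rho_shift (size la) (nth 0 la)) * dual_immaculate a e)%R.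
Proof.
move=> pla se; set k := size la; set n := sumn la; set N := size e.
pose fin (R : 'M['I_n.+1]_(N.+1, k)) := [seq ev R N i | i <- iota 0 k].
pose w a := match_sign k (rho_shift k (nth 0 a)) (rho_shift k (nth 0 la)).
pose I (R : 'M['I_n.+1]_(N.+1, k)) := imm_chain N k (nth 0 e) (ev R).
have parts_le a i : sumn a = n -> nth 0 a i <= n.
  move=> <-; case: (ltnP i (size a)) => h; last by rewrite nth_default.
  by rewrite sumn_nth (bigD1 (Ordinal h)) //= leq_addr.
have nth_fin R i : i < k -> nth 0 (fin R) i = ev R N i.
  by move=> ik; rewrite (nth_map 0) ?size_iota // nth_iota.
have eB : \sum_(s < N) nth 0 e s <= n by rewrite -sumn_nth se.
transitivity (\sum_(R | imm_set (nth 0 e) R) w (fin R))%R; last first.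
  (* The tableaux of all shapes [a] are gathered into one set of chains, with [fin] recording the
     shape. *)
  rewrite -[RHS]big_filter [RHS](eq_big_seq (fun a => \sum_(R | I R) w a * Posz (fin R == a))%R).
    rewrite [RHS]exchange_big /= [LHS]big_mkcond [RHS]big_mkcond; apply: eq_bigr => R _.
    rewrite /imm_set -/(I R); case: (boolP (I R)) => //= iR.
    have sf : size (fin R) = k by rewrite size_map size_iota.
    have smf : sumn (fin R) = n.
      by rewrite sumn_map_iota (imm_sum iR) // -sumn_nth.
    have cf : is_comp (fin R) = alln k (fun i => 0 < ev R N i).
      apply/idP/allnP => [cf i ik|h]; first by rewrite -nth_fin // is_comp_nth ?sf.
      apply/negP => /(nthP 0)[i]; rewrite sf => ik; rewrite nth_fin // => e0.
      by have := h i ik; rewrite e0.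
    rewrite -cf; have inf : (fin R \in [seq a <- comps n | size a == k]) = is_comp (fin R).
      by rewrite mem_filter mem_comps sf smf !eqxx /= andbT.
    case: ifP => cR; last first.
      rewrite big_seq big1 // => a ain; case: eqP => [ea|_]; rewrite ?mulr0 //.
      by rewrite -ea inf cR in ain.
    rewrite (bigD1_seq (fin R)) ?inf ?filter_uniq ?uniq_comps //= eqxx mulr1 big1 ?addr0 //.
    by move=> a; rewrite eq_sym => /negPf ->; rewrite mulr0.
  move=> a; rewrite mem_filter mem_comps => /and3P[/eqP sa ca /eqP sma].
  rewrite (@dual_immaculate_card n k a e) // => [|i]; last exact: parts_le.
  rewrite -big_distrr /=; congr (_ * _)%R.
  rewrite -sum1dep_card (big_morph Posz PoszD (erefl _)) big_mkcondr /=.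
  by apply: eq_bigr => R _; case: ifP.
rewrite (eq_bigr (fun R => match_sign k (rho_shift k (ev R N)) (rho_shift k (nth 0 la)))); last first.
  move=> R _; apply: eq_match_sign => // i ik; by rewrite /rho_shift nth_fin.
rewrite (imm_sign_sum k eB) /schur (@skew_schur_gt la [::] pla isT _ n) ?skew_size_nil //.
- rewrite /gt_card -sum1dep_card (big_morph Posz PoszD (erefl _)) -/N -/k.
  pose F (R : 'M['I_n.+1]_(N.+1, k)) := imm_set (nth 0 e) R && iinter N k (ev R).
  rewrite [RHS](eq_bigr (fun R => Posz (alln k (fun i => ev R N i == nth 0 la i)))); last first.
    move=> R /andP[/andP[/imm_chainP[h0 mon fc cE] _] /allnP ii].
    have decS i : i.+1 < k -> ev R N i.+1 <= ev R N i.
      move: (ev R) h0 mon ii => p h0 mon ii ik.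
      have [N0|N0] := posnP N; first by rewrite N0 !h0 // ltnW.
      have N1 : N.-1 < N by lia.
      have i1 : i < k.-1 by lia.
      have := elimT (allnP _ _) (ii _ N1) i i1; rewrite /iviol -leqNgt prednK //.
      by have := mon N.-1 i N1 (ltnW ik); rewrite prednK //; lia.
    rewrite match_sign_sorted.
    - rewrite (_ : alln k _ = alln k (fun i => ev R N i == nth 0 la i)); first by case: (alln k _).
      by apply: eq_all => i; rewrite /rho_shift eqn_add2r.
    - move=> i j ij jk; rewrite /rho_shift.
      suff : ev R N j <= ev R N i by lia.
      rewrite -(subnKC (ltnW ij)) in jk *; elim: (j - i) jk => [|d IH] jk; first by rewrite addn0.
      by rewrite addnS in jk *; apply: leq_trans (decS _ jk) (IH _); lia.
    - move=> i j ij jk; rewrite /rho_shift.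
      by have := is_part_decr pla (ltnW ij); lia.
  rewrite [RHS](_ : _ = \sum_(R | F R && alln k (fun i => ev R N i == nth 0%N la i)) 1)%R.
    apply: eq_bigl => R; apply/andP/andP.
      case=> /gtP[[h0 hN mon] int] /allnP cE.
      split; last by apply/allnP => i ik; rewrite hN.
      apply/andP; split; first apply/andP; first split.
      - apply/imm_chainP; split=> [i ik|//|t i tN ik h|t tN]; last exact/eqP/cE.
          by rewrite h0 // nth_nil.
        exact: leq_trans h (int _ _ tN ik).
      - by apply/allnP => i ik; rewrite hN // is_comp_nth // is_part_comp.
      - apply/allnP => t tN; apply/allnP => i ik; rewrite /iviol -leqNgt; apply: int => //; lia.
    case=> /andP[/andP[/imm_chainP[h0 mon fc cE] _] /allnP ii] /allnP hN.
    split; last by apply/allnP => t tN; apply/eqP/cE.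
    apply/gtP; split; first split=> [i ik|i ik|//]; [by rewrite h0 ?nth_nil|exact/eqP/hN|].
    move=> t i tN ik; have i1 : i < k.-1 by lia.
    by have := elimT (allnP _ _) (ii t tN) i i1; rewrite /iviol -leqNgt.
  by rewrite [RHS]big_mkcondr; apply: eq_bigr => R _; case: (alln k _).
- by move=> i; rewrite nth_nil.
- by move=> i; apply: parts_le.
Qed.

(* Adding rho = (n-1, ..., 0), sorting and removing rho again: D_a occurs in no
   Schur function other than that of straighten a. *)
Definition shifted a : seq nat :=
  [seq rho_shift (size a) (nth 0 a) i | i <- iota 0 (size a)].

Definition straighten a : seq nat :=
  [seq nth 0 (sort geq (shifted a)) i - ((size a).-1 - i) | i <- iota 0 (size a)].

(** The sign of the permutation that sorts the shifted parts; it is 0 when two of them coincide, and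
    then [D_a] occurs in no Schur function. *)
Definition dual_sign a : int :=
  if is_comp a then match_sign (size a) (rho_shift (size a) (nth 0 a))
    (nth 0 (sort geq (shifted a))) else 0%R.

Lemma geq_trans : transitive geq.
Proof. by move=> x y z /= h1 h2; exact: leq_trans h2 h1. Qed.

Lemma geq_total : total geq.
Proof. by move=> x y; exact: leq_total. Qed.

Lemma geq_anti : antisymmetric geq.
Proof. by move=> x y /=; rewrite andbC -eqn_leq => /eqP. Qed.

Lemma size_shifted a : size (shifted a) = size a.
Proof. by rewrite size_map size_iota. Qed.

Lemma nth_shifted a i : i < size a ->
  nth 0 (shifted a) i = rho_shift (size a) (nth 0 a) i.
Proof. by move=> h; rewrite (nth_map 0) ?size_iota // nth_iota. Qed.

Lemma rho_part_decr la i j : is_part la -> i < j -> j < size la ->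
  rho_shift (size la) (nth 0 la) j < rho_shift (size la) (nth 0 la) i.
Proof. by move=> pl ij jk; have := is_part_decr pl (ltnW ij); rewrite /rho_shift; lia. Qed.

Lemma sorted_shifted la : is_part la -> sorted geq (shifted la).
Proof.
move=> pl; apply/(sortedP 0) => i; rewrite size_shifted => ik.
by rewrite /= !nth_shifted ?(ltnW ik) // ltnW // rho_part_decr.
Qed.

Lemma straighten_shifted a la : is_comp la -> size a = size la ->
  perm_eq (shifted a) (shifted la) -> sorted geq (shifted la) -> straighten a = la.
Proof.
move=> cl sz pe sl; rewrite /straighten.
have -> : sort geq (shifted a) = shifted la.
  apply: (sorted_eq geq_trans geq_anti) => //; first exact: sort_sorted geq_total _.
  by rewrite perm_sort.
apply: (@eq_from_nth _ 0); rewrite size_map size_iota // => i ik.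
rewrite (nth_map 0) ?size_iota // nth_iota // add0n nth_shifted -?sz //.
by rewrite /rho_shift addnK.
Qed.

Lemma straighten_part la : is_part la -> straighten la = la /\ dual_sign la = 1%R.
Proof.
move=> pl; have cl := is_part_comp pl; split.
  by apply: straighten_shifted => //; exact: sorted_shifted.
rewrite /dual_sign cl (sorted_sort geq_trans) ?sorted_shifted //.
rewrite (@eq_match_sign _ _ _ _ (rho_shift (size la) (nth 0 la)) (fun _ _ => erefl)).
  rewrite match_sign_sorted; try by move=> i j; exact: rho_part_decr.
  by rewrite (_ : alln _ _); [|apply/allnP].
by move=> i; exact: nth_shifted.
Qed.

Lemma sorted_sign0 a i j : dual_sign a != 0%R -> i < j -> j < size a ->
  nth 0 (sort geq (shifted a)) j < nth 0 (sort geq (shifted a)) i.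
Proof.
rewrite /dual_sign; case: ifP => ca ne; last by rewrite eqxx in ne.
have us : uniq (sort geq (shifted a)).
  rewrite sort_uniq; apply/(uniqP 0) => x y; rewrite !inE size_shifted => xk yk.
  rewrite !nth_shifted // => e; apply/eqP; apply: contraNT ne => xy.
  by rewrite (match_sign_dup _ xk yk xy e).
move=> ij jk; rewrite ltn_neqAle; apply/andP; split.
  rewrite nth_uniq ?size_sort ?size_shifted //; last exact: ltn_trans ij jk.
  by apply/eqP; lia.
apply: (sorted_leq_nth geq_trans (fun x => leqnn x) 0 (sort_sorted geq_total (shifted a)));
  rewrite ?inE ?size_sort ?size_shifted //; lia.
Qed.

(** A strictly decreasing sequence of natural numbers lies above the staircase, so the truncated
    subtraction in [straighten] loses nothing. *)
Lemma sorted_ge_stair a i : dual_sign a != 0%R -> i < size a ->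
  (size a).-1 - i <= nth 0 (sort geq (shifted a)) i.
Proof.
move=> ne; have [d] := ubnP (size a - i); elim: d i => // d IH i hd ik.
case: (ltnP i.+1 (size a)) => ik1; last by lia.
have := IH i.+1; have := sorted_sign0 ne (ltnSn i) ik1; lia.
Qed.

Lemma straighten_sum a : is_comp a -> dual_sign a != 0%R ->
  sumn (straighten a) = sumn a.
Proof.
move=> ca ne; rewrite sumn_map_iota.
rewrite sumnB => [|i _]; last exact: sorted_ge_stair.
have -> : \sum_(i < size a) nth 0 (sort geq (shifted a)) i = sumn (shifted a).
  have := sumn_nth (sort geq (shifted a)); rewrite size_sort size_shifted => <-.
  by apply: perm_sumn; rewrite perm_sort.
by rewrite sumn_map_iota /rho_shift big_split /= addnK -sumn_nth.
Qed.

(** A nonzero determinant forces every shifted part of [la] to occur among those of [a]. The two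
    lists have equal length, so they are permutations of each other and sorting recovers [la]. *)
Lemma match_sign_straighten a la : is_part la -> is_comp a -> size a = size la ->
  match_sign (size la) (rho_shift (size la) (nth 0 a))
    (rho_shift (size la) (nth 0 la)) = ((straighten a == la)%:R * dual_sign a)%R.
Proof.
move=> pl ca sz; have cl := is_part_comp pl.
set x := rho_shift _ _; set y := rho_shift _ _; set k := size la.
case: (eqVneq (match_sign k x y) 0%R) => [e0|ne].
  rewrite e0; case: eqP => [st|_]; last by rewrite mul0r.
  rewrite mul1r; apply/esym/eqP; apply/negPn/negP => nz; move/eqP: e0; apply/negP.
  move: (nz); rewrite {1}/dual_sign ca sz -/k -/x.
  rewrite (@eq_match_sign k x x _ y) // => i ik.
  have hst : nth 0 la i = nth 0 (sort geq (shifted a)) i - ((size a).-1 - i).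
    by rewrite -[in LHS]st /straighten (nth_map 0) ?size_iota ?sz // nth_iota.
  by rewrite /y /rho_shift hst sz subnK // -sz sorted_ge_stair // sz.
have sub : {subset shifted la <= shifted a}.
  move=> z /mapP[j]; rewrite mem_iota /= => jk ->; apply/negPn/negP => h.
  case/eqP: ne; apply: (@match_sign_col0 _ _ _ j) => // i ik.
  apply: contra h => /eqP h; rewrite -/k -/y -h; apply/mapP; exists i.
    by rewrite mem_iota sz.
  by rewrite /x /rho_shift sz.
have ul : uniq (shifted la).
  rewrite map_inj_in_uniq ?iota_uniq // => i j; rewrite !mem_iota => /= ik jk e.
  have [lt|lt|//] := ltngtP i j.
    by have := rho_part_decr pl lt jk; rewrite e ltnn.
  by have := rho_part_decr pl lt ik; rewrite e ltnn.
have pe : perm_eq (shifted a) (shifted la).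
  have [|us es] := uniq_min_size ul sub; first by rewrite !size_shifted sz.
  by rewrite perm_sym; apply: uniq_perm => //; rewrite -(eq_uniq us es).
have sl := sorted_shifted pl.
have st := straighten_shifted cl sz pe sl; rewrite st eqxx mul1r /dual_sign ca sz -/k -/x.
apply: eq_match_sign => // i ik.
have -> : sort geq (shifted a) = shifted la.
  apply: (sorted_eq geq_trans geq_anti) => //; first exact: sort_sorted geq_total _.
  by rewrite perm_sort.
by rewrite nth_shifted.
Qed.

Lemma psum_nth a t : psum a t = \sum_(s < t) nth 0 a s.
Proof.
elim: t => [|t IH]; first by rewrite big_ord0 /psum take0.
by rewrite psumS IH big_ord_recr.
Qed.

Lemma leq_sum_support k t (f : nat -> nat) : (forall j, t <= j -> f j = 0) ->
  \sum_(j < k) f j <= \sum_(j < t) f j.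
Proof.
move=> h; rewrite -!(big_mkord xpredT f); case: (leqP k t) => kt.
  by rewrite [X in _ <= X](@big_cat_nat _ _ _ k) //= leq_addr.
have z : \sum_(t <= j < k) f j = 0.
  by rewrite big_nat_cond big1 // => j /andP[/andP[tj _] _]; exact: h.
by rewrite (@big_cat_nat _ _ _ t) ?(ltnW kt) //= z addn0.
Qed.

Lemma comp_eq_psum a b : is_comp a -> is_comp b -> sumn a = sumn b ->
  (forall t, t <= sumn a -> psum a t = psum b t) -> a = b.
Proof.
move=> ca cb sab h; apply: comp_eq_nth => // i.
have sa := size_comp_le ca; have sb := size_comp_le cb.
case: (ltnP i (sumn a)) => lt; last by rewrite !nth_default //; lia.
have := h i (ltnW lt); have := h i.+1 lt; rewrite !psumS; lia.
Qed.

(** The first column increases strictly, so the entries at most [t] lie in the first [t] rows, which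
    have [psum b t] boxes. *)
Lemma dual_immaculate_dom a b : is_comp a -> is_comp b ->
  dual_immaculate b a != 0%R ->
  sumn a = sumn b /\ forall t, psum a t <= psum b t.
Proof.
move=> ca cb ne; have sab : sumn a = sumn b.
  by apply/eqP; apply: contraNT ne => h; rewrite dual_immaculate_0.
split=> //; move: ne.
rewrite (@dual_immaculate_card (maxpart b) (size b)) //; last exact: nth_maxpart.
rewrite eqz_nat -lt0n => /card_gt0P[R]; rewrite inE => /andP[iR /eqP fR] t.
have [h0 mon fc cE] := imm_chainP _ _ _ _ iR.
have low s j : s <= size a -> s <= j -> ev R s j = 0.
  elim: s j => [|s IH] j sa sj.
    by case: (ltnP j (size b)) => jk; [exact: h0|rewrite ev_out_r].
  case: j sj => // j sj; case: (ltnP j.+1 (size b)) => jk; last by rewrite ev_out_r.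
  apply/eqP; rewrite -leqn0 leqNgt; apply/negP => /(fc s j sa jk).
  by rewrite IH // ltnW.
have main s : s <= size a -> psum a s <= psum b s.
  move=> sa; rewrite psum_nth -(imm_sum iR sa) psum_nth.
  apply: leq_trans (leq_sum_support _ (fun j => low s j sa)) _.
  apply: leq_sum => j _; case: (ltnP j (size b)) => jk; last by rewrite ev_out_r.
  have -> : nth 0 b j = ev R (size a) j.
    by rewrite -[in LHS]fR (nth_map 0) ?size_iota // nth_iota.
  exact: (imm_mono iR).
case: (leqP t (size a)) => ta; first exact: main.
apply: leq_trans (leq_psum b (ltnW ta)); apply: leq_trans (main _ (leqnn _)).
by rewrite psum_size psum_le.
Qed.

Lemma dual_immaculate_diag a : is_comp a -> dual_immaculate a a != 0%R.
Proof.
move=> ca; rewrite (@dual_immaculate_card (maxpart a) (size a)) //; last exact: nth_maxpart.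
rewrite eqz_nat -lt0n; apply/card_gt0P.
pose R := highestP (maxpart a) (size a) (size a) (nth 0 a).
have eR t i : t <= size a -> i < size a -> ev R t i = highest (nth 0 a) t i.
  by move=> tN ik; rewrite ev_highestP //; exact: nth_maxpart.
exists R; rewrite inE; apply/andP; split.
  apply/imm_chainP; split=> [i ik|t i tN ik|t i tN ik|t tN].
  - by rewrite eR.
  - rewrite !eR ?(ltnW tN) // /highest; case: (ltnP i t) => // h.
    by rewrite (leq_trans h).
  - rewrite !eR ?(ltnW tN) ?(ltnW ik) // /highest ltnS; case: ifP => // _ _.
    by rewrite is_comp_nth // ltnW.
  - rewrite cont_highest //; [exact: nth_default|exact: nth_maxpart].
apply/eqP/(@eq_from_nth _ 0); rewrite size_map size_iota // => i ik.
by rewrite (nth_map 0) ?size_iota // nth_iota // add0n eR // /highest ik.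
Qed.

(** The rank makes dominance numerical: smaller partial sums leave larger gaps to the total, and if
    no gap changes the compositions coincide. *)
Lemma triangular_D : triangular bD.
Proof.
exists (fun b => \sum_(t < (sumn b).+1) (sumn b - psum b t)).
split=> [a ca|a b ca cb ne ba]; first exact: dual_immaculate_diag.
have [sab dom] := dual_immaculate_dom ca cb ne; rewrite sab ltnNge.
apply: contra ba => h; apply/eqP/comp_eq_psum => // t tn.
apply/eqP; rewrite eqn_leq dom andbT leqNgt; apply/negP => lt.
move: h; rewrite leqNgt => /negP; apply.
have tS : t < (sumn b).+1 by [].
rewrite (bigD1 (Ordinal tS)) //= [X in _ < X](bigD1 (Ordinal tS)) //= -addSn.
apply: leq_add; first by have := psum_le b t; lia.
by apply: leq_sum => s _; have := dom s; lia.
Qed.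

Theorem refines_D : refines bD straighten dual_sign.
Proof.
split=> //; first exact: triangular_D.
- exact: straighten_sum.
- exact: straighten_part.
move=> la e pl; case: (eqVneq (sumn e) (sumn la)) => se; last first.
  rewrite /schur skew_schur_0 ?skew_size_nil // => [|i]; last by rewrite nth_nil.
  rewrite big_seq big1 // => a; rewrite mem_comps => /andP[ca /eqP sa].
  by rewrite /= dual_immaculate_0 ?mulr0 // sa.
rewrite schur_dual // big_mkcond big_seq [RHS]big_seq; apply: eq_bigr => a.
rewrite mem_comps => /andP[ca _]; case: (size a =P size la) => sz.
  by rewrite match_sign_straighten.
case: eqP => [st|_]; last by rewrite !mul0r.
by case: sz; rewrite -st size_map size_iota.
Qed.

(** * Quasisymmetric Schur functions *)

Lemma sum_ltn k c : \sum_(i < k) (i < c : nat) = minn c k.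
Proof.
elim: k => [|k IH]; first by rewrite big_ord0 minn0.
by rewrite big_ord_recr /= IH; case: ltnP => h /=; lia.
Qed.

Lemma sum_geq k c : \sum_(i < k) (k <= i + c : nat) = minn c k.
Proof.
rewrite (reindex_inj rev_ord_inj) /= -sum_ltn; apply: eq_bigr => i _.
by have := ltn_ord i; case: leqP; case: ltnP => /=; lia.
Qed.

Definition cnt k (g : nat -> nat) x := \sum_(i < k) (x <= g i : nat).

(* The condition relating two consecutive columns of a composition tableau. *)
Definition step k (f g : nat -> nat) :=
  (forall i, i < k -> g i <= f i) /\
  (forall i i', i < i' -> i' < k -> g i' != 0 -> g i <= g i' -> f i < g i').

Lemma cntS k g x : cnt k g x = cnt k g x.+1 + \sum_(i < k) (g i == x : nat).
Proof.
rewrite /cnt -big_split /=; apply: eq_bigr => i _.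
by rewrite leq_eqVlt eq_sym; case: eqP => [->|_] /=; rewrite ?ltnn ?addn0.
Qed.

Lemma cnt_le_k k g x : cnt k g x <= k.
Proof.
rewrite -[X in _ <= X]card_ord -sum1_card; apply: leq_sum => i _.
exact: leq_b1.
Qed.

Lemma cnt_exists k g x : cnt k g x.+1 < cnt k g x -> exists2 i, i < k & g i = x.
Proof.
rewrite (cntS k g x) -{1}[cnt k g x.+1]addn0 ltn_add2l lt0n sum_nat_eq0.
by case/forallPn => i; rewrite eqb0 negbK => /eqP gi; exists i.
Qed.

Lemma cnt_drop k g x i : i < k -> g i = x -> cnt k g x.+1 < cnt k g x.
Proof.
move=> ik gi; rewrite (cntS k g x) (bigD1 (Ordinal ik)) //= gi eqxx; lia.
Qed.

Lemma step_cnt k f g x : step k f g -> cnt k g x <= cnt k f x.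
Proof.
case=> h _; apply: leq_sum => i _; have := h i (ltn_ord i).
by case: (leqP x (g i)) => //= h1 h2; rewrite (leq_trans h1).
Qed.

(** A nonzero value occurs at most once in a column: for equal entries in rows [i < i'] the triple
    condition gives [f i < g i'], against [g i <= f i]. *)
Lemma step_cnt1 k f g x : step k f g -> 0 < x -> cnt k g x <= (cnt k g x.+1).+1.
Proof.
case=> h1 h2 x0; rewrite (cntS k g x) -[(cnt k g x.+1).+1]addn1 leq_add2l.
case: (pickP (fun i : 'I_k => g i == x)) => [i gi|h]; last first.
  by rewrite big1 // => i _; rewrite h.
rewrite (bigD1 i) //= gi big1 // => i' ne; apply/eqP; rewrite eqb0.
apply/negP => gi'; have := ne; rewrite -val_eqE neq_ltn /= => /orP[] lt.
  have := h2 _ _ lt (ltn_ord i); have := h1 _ (ltn_ord i'); rewrite (eqP gi) (eqP gi').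
  by move=> a b; have := b _ (leqnn _); lia.
have := h2 _ _ lt (ltn_ord i'); have := h1 _ (ltn_ord i); rewrite (eqP gi) (eqP gi').
by move=> a b; have := b _ (leqnn _); lia.
Qed.

(** Downward induction on the values. If [x] stands in different rows in [g] and [g'], the column
    having it in the lower row violates the triple condition at the upper row, where the other
    column shows that [x] still fits. *)
Lemma step_uniq k f g g' : step k f g -> step k f g' ->
  (forall x, 0 < x -> cnt k g x = cnt k g' x) -> forall i, i < k -> g i = g' i.
Proof.
move=> [gf tg] [gf' tg'] ec.
pose M := \sum_(i < k) (g i + g' i).
have bM i : i < k -> g i <= M /\ g' i <= M.
  by move=> ik; rewrite /M (bigD1 (Ordinal ik)) //=; lia.
suff h x : 0 < x -> forall i, i < k -> (x <= g i -> g' i = g i) /\ (x <= g' i -> g i = g' i).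
  move=> i ik; have [h1 h2] := h 1 isT i ik.
  case: (posnP (g i)) => [g0|/h1 //]; case: (posnP (g' i)) => [g0'|/h2 //].
  by rewrite g0 g0'.
have [d] := ubnP (M.+1 - x); elim: d x => // d IH x hd x0.
case: (leqP x M) => xM; last by move=> i /bM[]; lia.
have {}IH := IH x.+1; have {}IH : forall i, i < k ->
   (x < g i -> g' i = g i) /\ (x < g' i -> g i = g' i) by apply: IH; lia.
have ex1 i : i < k -> g i = x -> g' i = x.
  move=> ik gx; have lt := cnt_drop ik gx; rewrite (ec x) // (ec x.+1) // in lt.
  have [i' ik' gx'] := cnt_exists lt.
  have [-> //|ii] := eqVneq i i'.
  have le1 : g' i <= x by rewrite leqNgt; apply/negP => h; have [_ /(_ h)] := IH i ik; lia.
  have le2 : g i' <= x by rewrite leqNgt; apply/negP => h; have [/(_ h)] := IH i' ik'; lia.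
  have := ii; rewrite neq_ltn => /orP[] lt'.
    by have := tg' _ _ lt' ik'; have := gf i ik; rewrite gx gx'; lia.
  by have := tg _ _ lt' ik; have := gf' i' ik'; rewrite gx gx'; lia.
have ex2 i : i < k -> g' i = x -> g i = x.
  move=> ik gx; have lt := cnt_drop ik gx; rewrite -(ec x) // -(ec x.+1) // in lt.
  have [i' ik' gx'] := cnt_exists lt.
  have [-> //|ii] := eqVneq i i'.
  have le1 : g i <= x by rewrite leqNgt; apply/negP => h; have [/(_ h)] := IH i ik; lia.
  have le2 : g' i' <= x by rewrite leqNgt; apply/negP => h; have [_ /(_ h)] := IH i' ik'; lia.
  have := ii; rewrite neq_ltn => /orP[] lt'.
    by have := tg _ _ lt' ik'; have := gf' i ik; rewrite gx gx'; lia.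
  by have := tg' _ _ lt' ik; have := gf i' ik'; rewrite gx gx'; lia.
move=> i ik; split; rewrite leq_eqVlt => /orP[/eqP e|lt].
- by rewrite ex1.
- by have [/(_ lt)] := IH i ik.
- by rewrite ex2.
- by have [_ /(_ lt)] := IH i ik.
Qed.

(* Greedy construction: the entries are placed in decreasing order, each in
   the first row where it fits. *)
Lemma step_exists N k f C :
    (forall x, 0 < x -> C x.+1 <= C x <= (C x.+1).+1) ->
    (forall x, N < x -> C x = 0) -> (forall x, 0 < x -> C x <= cnt k f x) ->
  exists2 g, step k f g & forall x, 0 < x -> cnt k g x = C x.
Proof.
move=> C1 C0 Cf.
suff h d : d <= N -> exists g, [/\ step k f g,
    forall i, i < k -> g i != 0 -> N.+1 - d <= g i
    & forall x, N.+1 - d <= x -> cnt k g x = C x].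
  have [g [sg _ cg]] := h N (leqnn _); exists g => // x x0; apply: cg; lia.
elim: d => [|d IH] dN.
  exists (fun=> 0); split=> // x; rewrite subn0 => xN; rewrite C0 //.
  by rewrite /cnt big1 // => i _; rewrite leqn0; case: x xN.
have [g [[gf tg] gl cg]] := IH (ltnW dN); set y := N.+1 - d.+1.
have yS : N.+1 - d = y.+1 by rewrite /y; lia.
have y0 : 0 < y by rewrite /y; lia.
rewrite yS in gl cg.
have cy : cnt k g y = cnt k g y.+1.
  rewrite cntS big1 ?addn0 // => i _; apply/eqP; rewrite eqb0; apply/eqP => gy.
  by have := gl i (ltn_ord i); rewrite gy; lia.
have := C1 y y0; case: (eqVneq (C y) (C y.+1)) => [e _|ne hC].
  exists g; split=> // [i ik g0|x]; first exact: ltnW (gl i ik g0).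
  by rewrite leq_eqVlt => /orP[/eqP <-|/cg //]; rewrite cy cg.
have eC : C y = (C y.+1).+1 by lia.
have exi : exists i, [&& i < k, g i == 0 & y <= f i].
  case: (pickP (fun i : 'I_k => (g i == 0) && (y <= f i))) => [i hi|h].
    by exists i; rewrite ltn_ord.
  have : cnt k f y <= cnt k g y.+1.
    apply: leq_sum => i _; case: (leqP y (f i)) => //= fy.
    have /negbT := h i; rewrite fy andbT => g0.
    by rewrite (gl i _ g0).
  by have := Cf y y0; rewrite cg //; lia.
case: (ex_minnP exi) => i /and3P[ik /eqP gi fi] mini.
pose g' j := if j == i then y else g j; exists g'.
have g'i : g' i = y by rewrite /g' eqxx.
have g'n j : j != i -> g' j = g j by rewrite /g' => /negPf ->.
split=> [|j jk|x].
- split=> [j jk|a b ab bk].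
    by rewrite /g'; case: eqP => [->|_] //; exact: gf.
  case: (eqVneq b i) => [bi|bi].
    rewrite bi in ab *; have ai : a != i by apply/eqP; lia.
    rewrite g'i g'n // => _ ay; rewrite ltnNge; apply/negP => fa.
    have ak : a < k by lia.
    case: (eqVneq (g a) 0) => [ga|ga]; last by have := gl a ak ga; lia.
    by have := mini a; rewrite ak ga fa => /(_ isT); lia.
  rewrite [g' b]g'n //; case: (eqVneq a i) => [ai|ai]; last by rewrite g'n //; exact: tg.
  by rewrite ai in ab *; move=> b0 _; apply: tg; rewrite // gi.
- case: (eqVneq j i) => [->|ne']; first by rewrite g'i.
  by rewrite g'n // => g0; apply: ltnW; exact: gl.
- have cg' z : cnt k g' z = cnt k g z + (0 < z <= y : nat).
    rewrite /cnt (bigD1 (Ordinal ik)) //= [in RHS](bigD1 (Ordinal ik)) //= g'i gi.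
    rewrite (eq_bigr (fun j : 'I_k => (z <= g j : nat))); first by lia.
    by move=> j; rewrite -val_eqE /= => ne'; rewrite g'n.
  rewrite leq_eqVlt => /orP[/eqP <-|yx].
    by rewrite cg' cy cg // eC y0 leqnn addn1.
  by rewrite cg' cg // [x <= y]leqNgt yx andbF addn0.
Qed.

Lemma sum_leq k i : \sum_(j < k) (i <= j : nat) = k - i.
Proof.
elim: k => [|k IH]; first by rewrite big_ord0.
by rewrite big_ord_recr /= IH; case: leqP => h /=; lia.
Qed.

Definition increasing k (f : nat -> nat) := forall a b, a < b -> b < k -> f a < f b.

Lemma cnt_increasing k f x i : increasing k f -> i < k ->
  (x <= f i) = (k <= i + cnt k f x).
Proof.
move=> inc ik; case: (leqP x (f i)) => h.
  have : \sum_(j < k) (i <= j : nat) <= cnt k f x.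
    apply: leq_sum => j _; case: (leqP i j) => //= ij.
    suff -> : x <= f j by []. apply: leq_trans h _; move: ij; rewrite leq_eqVlt => /orP[/eqP -> //|ij].
    exact: ltnW (inc _ _ ij _).
  by rewrite sum_leq => h'; apply/esym/idP; lia.
have : cnt k f x <= \sum_(j < k) (i < j : nat).
  apply: leq_sum => j _; case: (ltnP i j) => [_|ji]; first exact: leq_b1.
  suff lt : f j < x by rewrite [x <= f j]leqNgt lt.
  apply: leq_ltn_trans h; move: ji; rewrite leq_eqVlt => /orP[/eqP -> //|ji].
  exact: ltnW (inc _ _ ji ik).
by rewrite sum_leq => h'; apply/esym/negbTE; lia.
Qed.

Lemma increasing_uniq k f f' : increasing k f -> increasing k f' ->
  (forall i, i < k -> 0 < f i) -> (forall i, i < k -> 0 < f' i) ->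
  (forall x, 0 < x -> cnt k f x = cnt k f' x) -> forall i, i < k -> f i = f' i.
Proof.
move=> inc inc' p p' ec i ik; apply/eqP; rewrite eqn_leq.
rewrite (cnt_increasing _ inc' ik) -ec ?p // -(cnt_increasing _ inc ik) leqnn /=.
by rewrite (cnt_increasing _ inc ik) ec ?p' // -(cnt_increasing _ inc' ik) leqnn.
Qed.

(** The first column lists its set of values in increasing order; its entry in row [i] is found as
    the number of [x] that at least [k - i] values reach. *)
Lemma increasing_exists N k C :
    (forall x, 0 < x -> C x.+1 <= C x <= (C x.+1).+1) ->
    (forall x, N < x -> C x = 0) -> C 1 = k ->
  exists f, [/\ increasing k f, forall i, i < k -> 0 < f i <= N
     & forall x, 0 < x -> cnt k f x = C x].
Proof.
move=> C1 C0 Ck.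
have Cmon x y : 0 < x -> x <= y -> C y <= C x.
  move=> x0 xy; rewrite -(subnKC xy); elim: (y - x) => [|d IH]; rewrite ?addn0 //.
  by rewrite addnS; apply: leq_trans IH; have := C1 (x + d); lia.
pose f i := count (fun x => k <= i + C x.+1) (iota 0 N).
have fE i x : i < k -> 0 < x -> (x <= f i) = (k <= i + C x).
  move=> ik x0; case: (leqP x N) => xN; last first.
    rewrite C0 // addn0 [RHS]leqNgt ik /= leqNgt; apply/negbF.
    by rewrite (leq_ltn_trans (count_size _ _)) ?size_iota.
  have x1 : x.-1 < N by lia.
  have := @count_prefix N (fun x => k <= i + C x.+1) x.-1.
  rewrite prednK // -/(f i) => -> // s s' ss s'N /leq_trans; apply.
  by rewrite leq_add2l; apply: Cmon.
have fpos i : i < k -> 0 < f i by move=> ik; rewrite fE // Ck leq_addl.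
have incS i : i.+1 < k -> f i < f i.+1.
  move=> ik; rewrite fE //; have fp := fpos i (ltnW ik).
  have := leqnn (f i); rewrite fE ?(ltnW ik) //; have := C1 _ fp; lia.
have inc : increasing k f.
  move=> a b ab; rewrite -(subnKC ab); elim: (b - a.+1) => [|d IH].
    by rewrite addn0; exact: incS.
  by rewrite addnS => h; apply: ltn_trans (IH (ltnW h)) (incS _ h).
exists f; split=> // [i ik|x x0].
  by rewrite fpos // (leq_trans (count_size _ _)) ?size_iota.
have -> : cnt k f x = \sum_(i < k) (k <= i + C x : nat).
  by apply: eq_bigr => i _; rewrite fE.
by rewrite sum_geq; have := Cmon 1 x isT x0; rewrite Ck; lia.
Qed.

Lemma cnt_iota k g x : cnt k g x = count (fun i => x <= g i) (iota 0 k).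
Proof.
rewrite /cnt -sum1_count [RHS]big_mkcond -[in RHS](subn0 k) -/(index_iota 0 k) big_mkord.
by apply: eq_bigr => i _; case: leqP.
Qed.

Lemma cnt_seq a x : cnt (size a) (nth 0 a) x = count (leq x) a.
Proof.
by rewrite cnt_iota -[in RHS](mkseq_nth 0 a) count_map; apply: eq_count.
Qed.

Lemma eq_cnt k g g' x : (forall i, i < k -> g i = g' i) -> cnt k g x = cnt k g' x.
Proof. by move=> h; apply: eq_bigr => i _; rewrite h. Qed.

Lemma cnt_dec k g x i : (forall a b, a <= b -> b < k -> g b <= g a) -> i < k ->
  (i < cnt k g x) = (x <= g i).
Proof.
move=> dec ik; rewrite cnt_iota; symmetry; apply: (@count_prefix k (fun i => x <= g i)) => //.
by move=> a b ab bk /leq_trans; apply; exact: dec.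
Qed.

Lemma cnt_conj k c p i : (forall a b, a <= b -> b < k -> p b <= p a) -> i < k ->
  p i <= c -> cnt c (fun j => cnt k p j.+1) i.+1 = p i.
Proof.
move=> dec ik pc; rewrite /cnt (eq_bigr (fun j : 'I_c => (j < p i : nat))).
  by rewrite sum_ltn; apply/minn_idPl.
by move=> j _; congr nat_of_bool; exact: cnt_dec.
Qed.

Lemma perm_of_cnt a b : size a = size b ->
  (forall x, 0 < x -> cnt (size a) (nth 0 a) x = cnt (size b) (nth 0 b) x) ->
  perm_eq a b.
Proof.
move=> sab h; have cm (s : seq nat) x : count_mem x s + count (leq x.+1) s = count (leq x) s.
  rewrite -count_predUI (@eq_count _ (predI _ _) pred0) ?count_pred0 ?addn0.
    apply: eq_count.
    by move=> y /=; rewrite [x <= y]leq_eqVlt eq_sym.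
  by move=> y /=; case: eqP => //= ->; rewrite ltnn.
apply/allP => x _; apply/eqP.
have := cm a x; have := cm b x; rewrite -!cnt_seq -(h x.+1) //.
suff -> : cnt (size b) (nth 0 b) x = cnt (size a) (nth 0 a) x by lia.
by case: x => [|x]; [rewrite !cnt_seq !count_predT|rewrite h].
Qed.

Lemma step_ext k f f' g g' : (forall i, i < k -> f i = f' i) ->
  (forall i, i < k -> g i = g' i) -> step k f g -> step k f' g'.
Proof.
move=> ef eg [h1 h2]; split=> [i ik|i i' ii ik]; first by rewrite -ef // -eg ?h1.
have ik' : i < k by lia.
by rewrite -!eg // -ef //; exact: h2.
Qed.

(** Composition tableaux inside a [k] by [c] box without a prescribed shape, which is recovered by
    [row_lengths]. All rearrangements of a partition can thus be counted at once. *)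
Definition ssc k c (t : nat -> nat -> nat) : bool :=
  [&& alln k (fun i => 0 < t i 0),
      alln k (fun i => alln k (fun i' => (i < i') ==> (t i 0 < t i' 0)))
    & alln c.-1 (fun j => alln k (fun i => t i j.+1 <= t i j) &&
        alln k (fun i => alln k (fun i' =>
          [&& i < i', t i' j.+1 != 0 & t i j.+1 <= t i' j.+1] ==>
          (t i j < t i' j.+1))))].

Lemma sscP k c t : reflect
  [/\ forall i, i < k -> 0 < t i 0, increasing k (t^~ 0)
    & forall j, j.+1 < c -> step k (t^~ j) (t^~ j.+1)] (ssc k c t).
Proof.
apply: (iffP and3P) => [[/allnP h0 /allnP h1 /allnP h2]|[h0 h1 h2]].
  split=> // [i i' ii ik|j jc].
    have ik' : i < k by lia.
    exact: implyP (elimT (allnP _ _) (h1 i ik') i' ik) ii.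
  have jc' : j < c.-1 by lia.
  have /andP[/allnP s1 /allnP s2] := h2 j jc'.
  split=> // i i' ii ik n0 le; have ik' : i < k by lia.
  by apply: implyP (elimT (allnP _ _) (s2 i ik') i' ik) _; rewrite ii n0.
split; apply/allnP => i ik; first exact: h0.
  by apply/allnP => i' ik'; apply/implyP => ii; exact: h1.
have [|s1 s2] := h2 i; first lia.
apply/andP; split; apply/allnP => a ak; first exact: s1.
apply/allnP => b bk; apply/implyP => /and3P[ab n0 le]; exact: s2.
Qed.

Lemma ssc_row k c t i j j' : ssc k c t -> i < k -> j <= j' -> j' < c -> t i j' <= t i j.
Proof.
case/sscP => _ _ st ik jj; rewrite -(subnKC jj); elim: (j' - j) => [|d IH].
  by rewrite addn0.
rewrite addnS => h; apply: leq_trans (IH (ltnW h)).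
by have [s1 _] := st _ h; exact: s1.
Qed.

Definition row_lengths k c (t : nat -> nat -> nat) := [seq cnt c (t i) 1 | i <- iota 0 k].

Lemma nth_row_lengths k c t i : i < k -> nth 0 (row_lengths k c t) i = cnt c (t i) 1.
Proof. by move=> ik; rewrite (nth_map 0) ?size_iota // nth_iota. Qed.

Lemma quasi_schur_card k c a e : is_comp a -> size a = k -> maxpart a = c ->
  quasi_schur a e = Posz #|[set T : 'M['I_(size e).+1]_(k, c) |
     ssc k c (ev T) && has_content T && (row_lengths k c (ev T) == a)]|.
Proof.
move=> ca sk mc; subst k c; congr Posz; apply: eq_card => T; rewrite !inE.
rewrite andbAC; congr (_ && _); set k := size a; set c := maxpart a.
have c0 i : i < k -> 0 < c.
  by move=> ik; apply: leq_trans (is_comp_nth ca ik) (nth_maxpart _ _).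
apply/idP/idP.
  case/and4P => /forallP fl /forallP rw /forallP fc /forallP tr.
  have f0 i j : i < k -> j < c -> (ev T i j != 0) = (j < nth 0 a i).
    move=> ik jc; have /forallP/(_ (Ordinal jc))/eqP := fl (Ordinal ik).
    by rewrite -evE.
  have r0 i j j' : i < k -> j < j' -> j' < c -> ev T i j' <= ev T i j.
    move=> ik jj jc; have jc' : j < c by lia.
    case: (ltnP j' (nth 0 a i)) => h.
      have /forallP/(_ (Ordinal jc'))/forallP/(_ (Ordinal jc)) := rw (Ordinal ik).
      by rewrite /comp_diagram /= jj h -!evE.
    by have := f0 i j' ik jc; rewrite ltnNge h /= => /negbFE/eqP ->.
  apply/andP; split.
    apply/sscP; split=> [i ik|i i' ii ik|j jc].
    - by rewrite lt0n f0 ?(c0 i) // is_comp_nth.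
    - have ik' : i < k by lia.
      have /forallP/(_ (Ordinal ik))/forallP/(_ (Ordinal (c0 _ ik))) := fc (Ordinal ik').
      by rewrite /= ii -!evE.
    - split=> [i ik|i i' ii ik n0 le]; first exact: r0.
      have ik' : i < k by lia.
      have /forallP/(_ (Ordinal ik))/forallP/(_ (Ordinal (ltnW jc))) := tr (Ordinal ik').
      move/forallP/(_ (Ordinal jc)); rewrite -!evE /= ii eqxx n0 le /=; exact.
  apply/eqP/(@eq_from_nth _ 0); rewrite size_map size_iota // => i ik.
  rewrite nth_row_lengths //.
  have -> : cnt c (ev T i) 1 = \sum_(j < c) (j < nth 0 a i : nat).
    by apply: eq_bigr => j _; rewrite lt0n f0.
  by rewrite sum_ltn; apply/minn_idPl; exact: nth_maxpart.
case/andP => sT /eqP rl.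
have f0 i j : i < k -> j < c -> (ev T i j != 0) = (j < nth 0 a i).
  move=> ik jc; rewrite -[in RHS]rl nth_row_lengths // cnt_dec ?lt0n // => x y.
  exact: ssc_row sT ik.
have [p0 inc st] := sscP _ _ _ sT.
apply/and4P; split.
- by apply/forallP => i; apply/forallP => j; rewrite -evE f0.
- apply/forallP => i; apply/forallP => j; apply/forallP => j'; apply/implyP.
  by case/andP => jj _; rewrite -!evE; apply: (ssc_row sT) => //; exact: ltnW.
- apply/forallP => i; apply/forallP => i'; apply/forallP => j; apply/implyP.
  by case/andP => /eqP j0 ii; rewrite -!evE j0; exact: inc.
- apply/forallP => i; apply/forallP => i'; apply/forallP => j; apply/forallP => j'.
  apply/implyP; rewrite -!evE => /and4P[ii /eqP ej n0 le]; rewrite ej in n0 le *.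
  have [|_ s2] := st j; last exact: s2.
  by rewrite -ej.
Qed.

Section Quasi.

Variables (N k c : nat).

(* Complementing the entries turns a composition tableau, read column by
   column as a set, into a chain of partitions. *)
Definition heights (t : nat -> nat -> nat) s j := cnt k (t^~ j) (N.+1 - s).

Definition pattern t s i := cnt c (heights t s) i.+1.

Lemma heights_dec t s a b : ssc k c t -> a <= b -> b < c -> heights t s b <= heights t s a.
Proof.
case/sscP => _ _ st ab; rewrite -(subnKC ab); elim: (b - a) => [|d IH].
  by rewrite addn0.
rewrite addnS => h; apply: leq_trans (IH (ltnW h)).
exact: step_cnt (st _ h).
Qed.

Lemma pattern_galois t s i j : ssc k c t -> j < c ->
  (j < pattern t s i) = (i < heights t s j).
Proof. by move=> st jc; apply: cnt_dec => // a b; exact: heights_dec. Qed.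

Lemma sum_pattern t s : \sum_(i < k) pattern t s i = \sum_(j < c) heights t s j.
Proof.
rewrite exchange_big; apply: eq_bigr => j _; rewrite /= sum_ltn.
exact/minn_idPl/cnt_le_k.
Qed.

Lemma heights_S t s j : s < N ->
  heights t s.+1 j = heights t s j + \sum_(i < k) (t i j == N - s : nat).
Proof.
by move=> sN; rewrite /heights subSS (subSn (ltnW sN)) (cntS k _ (N - s)).
Qed.

Lemma pattern_mono t s i : s < N -> pattern t s i <= pattern t s.+1 i.
Proof.
move=> sN; apply: leq_sum => j _; rewrite heights_S //.
by case: (leqP i.+1 (heights t s j)) => //= h; rewrite (leq_trans h) ?leq_addr.
Qed.

Lemma occ_columns (T : 'M['I_N.+1]_(k, c)) v :
  occ T v = \sum_(j < c) \sum_(i < k) (ev T i j == v : nat).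
Proof.
rewrite occE exchange_big; apply: eq_bigr => i _.
by rewrite -sum1dep_card big_mkcond.
Qed.

(** Step [s] of the pattern collects the entries [N - s], so the content is read backwards. *)
Lemma cont_pattern (T : 'M['I_N.+1]_(k, c)) s : s < N ->
  cont k (pattern (ev T)) s = occ T (N - s).
Proof.
move=> sN; have : \sum_(i < k) pattern (ev T) s.+1 i =
    cont k (pattern (ev T)) s + \sum_(i < k) pattern (ev T) s i.
  by rewrite -big_split; apply: eq_bigr => i _ /=; rewrite subnK // pattern_mono.
rewrite !sum_pattern occ_columns.
rewrite (eq_bigr (fun j : 'I_c => heights (ev T) s j + \sum_(i < k) (ev T i j == N - s : nat))).
  by rewrite big_split /=; lia.
by move=> j _; rewrite heights_S.
Qed.

Variable la : nat -> nat.
Hypothesis lac : forall i, la i <= c.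
Hypothesis ladec : forall a b, a <= b -> b < k -> la b <= la a.
Hypothesis lapos : forall i, i < k -> 0 < la i.

Definition column_shape t := forall j, j < c -> cnt k (t^~ j) 1 = cnt k la j.+1.

(** A nonzero value occurs at most once in each column, so the height of a column grows by at most 1
    per step, which is the horizontal strip condition. *)
Lemma pattern_gtb (T : 'M['I_N.+1]_(k, c)) : ssc k c (ev T) -> column_shape (ev T) ->
  gtb (fun=> 0) la N k (pattern (ev T)).
Proof.
move=> sT cT; have [p0 inc st] := sscP _ _ _ sT.
apply/gtP; split; first split=> [i ik|i ik|t i tN ik].
- rewrite /pattern /cnt big1 // => j _.
  by rewrite /heights /cnt big1 // => i' _; rewrite subn0 ltnNge ev_le.
- rewrite /pattern -[RHS](cnt_conj ladec ik (lac i)).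
  by apply: eq_cnt => j jc; rewrite /heights subSnn cT.
- exact: pattern_mono.
move=> t i tN ik; apply: leq_sum => j _.
suff le : heights (ev T) t.+1 j <= (heights (ev T) t j).+1.
  case: (leqP i.+2 (heights (ev T) t.+1 j)) => //= h.
  by have -> : i < heights (ev T) t j by lia.
rewrite /heights subSS (subSn (ltnW tN)).
have x0 : 0 < N - t by lia.
case: j => [[|j] jc] /=; last exact: step_cnt1 (st _ jc) x0.
rewrite (cntS k _ (N - t)) -[(cnt _ _ _).+1]addn1 leq_add2l.
case: (pickP (fun i : 'I_k => ev T i 0 == N - t)) => [a ea|h]; last first.
  by rewrite big1 // => b _; rewrite h.
rewrite (bigD1 a) //= ea big1 // => b ne; apply/eqP; rewrite eqb0.
apply/negP => eb; have := ne; rewrite -val_eqE neq_ltn /= => /orP[] lt.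
  by have := inc _ _ lt (ltn_ord a); rewrite (eqP ea) (eqP eb) ltnn.
by have := inc _ _ lt (ltn_ord b); rewrite (eqP ea) (eqP eb) ltnn.
Qed.

(** The pattern gives the set of values of each column. The first column is this set in increasing
    order, and each later column is determined by its set and by the column before it. *)
Lemma pattern_inj (T T' : 'M['I_N.+1]_(k, c)) : ssc k c (ev T) -> ssc k c (ev T') ->
  (forall s i, s <= N -> i < k -> pattern (ev T) s i = pattern (ev T') s i) -> T = T'.
Proof.
move=> sT sT' eP.
have eC j x : j < c -> 0 < x -> cnt k ((ev T)^~ j) x = cnt k ((ev T')^~ j) x.
  move=> jc x0; case: (leqP x N) => xN; last first.
    rewrite /cnt !big1 // => i _; apply/eqP; rewrite eqb0 -ltnNge;
      exact: leq_ltn_trans (ev_le _ _ _) xN.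
  have sN : N.+1 - x <= N by lia.
  have xE : N.+1 - (N.+1 - x) = x by lia.
  have := cnt_le_k k ((ev T)^~ j) x; have := cnt_le_k k ((ev T')^~ j) x.
  move=> le le'; apply: (leq_eqP le' le) => i ik.
  have := pattern_galois (N.+1 - x) i sT jc; have := pattern_galois (N.+1 - x) i sT' jc.
  by rewrite /heights xE eP // ![_ <= i]leqNgt => -> ->.
have [p0 inc st] := sscP _ _ _ sT; have [p0' inc' st'] := sscP _ _ _ sT'.
suff h j : j < c -> forall i, i < k -> ev T i j = ev T' i j.
  by apply: ev_inj => i j ik jc; exact: h.
elim: j => [|j IH] jc i ik.
  by apply: (increasing_uniq inc inc') => // x x0; exact: eC.
have s2 : step k ((ev T)^~ j) ((ev T')^~ j.+1).
  by apply: step_ext (st' _ jc) => // i' ik'; rewrite IH // ltnW.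
by apply: (step_uniq (st _ jc) s2) => // x x0; exact: eC.
Qed.

(** [C j x] is the number of entries at least [x] prescribed for column [j]. Interlacing bounds its
    jumps by 1, column [j.+1] never asks for more than column [j] provides, and the columns are
    built from left to right. *)
Lemma pattern_onto p : gtb (fun=> 0) la N k p ->
  exists T : 'M['I_N.+1]_(k, c), [/\ ssc k c (ev T), column_shape (ev T)
    & forall s i, s <= N -> i < k -> pattern (ev T) s i = p s i].
Proof.
move/gtP => [ch itl]; have [h0 hN mon] := ch.
have pN s i : s <= N -> i < k -> p s i <= la i.
  by move=> sN ik; rewrite -hN //; exact: chain_mono ch _ _ ik.
have pdec s a b : s <= N -> a <= b -> b < k -> p s b <= p s a.
  move=> sN ab; rewrite -(subnKC ab); elim: (b - a) => [|d IH]; first by rewrite addn0.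
  rewrite addnS => h; apply: leq_trans (IH (ltnW h)).
  case: s sN {IH} => [|s] sN; first by rewrite !h0 // ltnW.
  exact: leq_trans (itl _ _ sN h) (mon _ _ sN (ltnW h)).
pose C j x := cnt k (p (N.+1 - x)) j.+1.
have C0 j x : N < x -> C j x = 0.
  move=> xN; rewrite /C; have -> : N.+1 - x = 0 by lia.
  by rewrite /cnt big1 // => i _; rewrite h0.
have C1 j x : 0 < x -> C j x.+1 <= C j x <= (C j x.+1).+1.
  move=> x0; case: (leqP x N) => xN; last by rewrite !C0 // ltnW.
  rewrite /C subSS; have sN : N - x < N by lia.
  have -> : N.+1 - x = (N - x).+1 by lia.
  apply/andP; split.
    apply: leq_sum => i _; have := mon _ _ sN (ltn_ord i).
    by case: (leqP j.+1 (p (N - x) i)) => //= h1 h2; rewrite (leq_trans h1).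
  rewrite /cnt; move: itl; case: (k) => [|k'] itl; first by rewrite !big_ord0.
  rewrite big_ord_recl big_ord_recr /= -[X in _ <= X]add1n leq_add ?leq_b1 //.
  apply: leq_trans (leq_addr _ _); apply: leq_sum => i _.
  have := itl _ i sN; rewrite ltnS ltn_ord => /(_ isT) le.
  rewrite /bump /= add1n.
  by case: (leqP j.+1 (p (N - x).+1 i.+1)) => //= h; rewrite (leq_trans h).
have Ck : C 0 1 = k.
  rewrite /C subSS subn0 /cnt (eq_bigr (fun=> 1)) ?sum1_card ?card_ord // => i _.
  by rewrite hN // lapos.
have [f [finc fpos fC]] := increasing_exists (C1 0) (@C0 0) Ck.
have [g [g0 gs gC]] : exists g : nat -> nat -> nat, [/\ g 0 = f,
    forall j, j < c -> step k (g j) (g j.+1)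
    & forall j, j <= c -> forall x, 0 < x -> cnt k (g j) x = C j x].
  elim: (c) => [|J [g [g0 gs gC]]].
    by exists (fun=> f); split=> // j; rewrite leqn0 => /eqP ->.
  have Cf x : 0 < x -> C J.+1 x <= cnt k (g J) x.
    move=> x0; rewrite gC //; apply: leq_sum => i _.
    by case: (leqP J.+2 (p (N.+1 - x) i)) => //= h; rewrite (ltnW h).
  have [h sh hC] := step_exists (C1 J.+1) (@C0 J.+1) Cf.
  exists (fun j => if j == J.+1 then h else g j); split=> // j.
    rewrite ltnS leq_eqVlt => /orP[/eqP ->|jJ].
      by rewrite eqxx (_ : (J == J.+1) = false) //; apply/eqP; lia.
    rewrite eqSS (ltn_eqF jJ) (_ : (j == J.+1) = false); first exact: gs.
    by apply/eqP; lia.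
  by rewrite leq_eqVlt; case: eqP => [-> //|_ /= jJ]; exact: gC.
have gN j i : j <= c -> i < k -> g j i <= N.
  move=> jc ik; rewrite leqNgt; apply/negP => lt.
  have gt0 : 0 < g j i by lia.
  have := gC j jc (g j i) gt0; rewrite C0 //.
  by have := cnt_drop ik (erefl (g j i)); lia.
pose T : 'M['I_N.+1]_(k, c) := mk N k c (fun i j => g j i).
have eT i j : i < k -> j < c -> ev T i j = g j i.
  by move=> ik jc; rewrite ev_mk // gN // ltnW.
have eC j x : j < c -> 0 < x -> cnt k ((ev T)^~ j) x = C j x.
  move=> jc x0; rewrite -gC ?(ltnW jc) //; apply: eq_cnt => i ik; exact: eT.
have c0 i : i < k -> 0 < c by move=> ik; apply: leq_trans (lapos ik) (lac i).
exists T; split.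
- apply/sscP; split=> [i ik|a b ab bk|j jc].
  + by rewrite eT ?(c0 i) // g0; case/andP: (fpos i ik).
  + have ak : a < k by lia.
    by rewrite !eT ?(c0 a) // g0; exact: finc.
  + by apply: step_ext (gs j (ltnW jc)) => i ik; rewrite eT // ltnW.
- move=> j jc; rewrite eC // /C subSS subn0; apply: eq_cnt => i ik; exact: hN.
- move=> s i sN ik; rewrite -[RHS](@cnt_conj k c (p s)) //.
  + apply: eq_cnt => j jc; rewrite /heights eC //; last lia.
    by rewrite /C; congr (cnt k (p _)); lia.
  + by move=> a b; exact: pdec.
  + exact: leq_trans (pN _ _ sN ik) (lac i).
Qed.

End Quasi.

Lemma quasi_schur_0 a e : is_comp a -> sumn e != sumn a -> quasi_schur a e = 0%R.
Proof.
move=> ca ne; rewrite (@quasi_schur_card (size a) (maxpart a)) //.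
congr Posz; apply: eq_card0 => T; rewrite !inE; apply/negP => /andP[/andP[_ /forallP cT] /eqP rT].
case/eqP: ne; rewrite -[in RHS]rT /row_lengths sumn_map_iota.
pose F i v := #|[set j : 'I_(maxpart a) | ev T i j == v]|.
rewrite sumn_nth (eq_bigr (fun v : 'I_(size e) => \sum_(i < size a) F i v.+1)); last first.
  by move=> v _; rewrite -(eqP (cT v)) occE.
rewrite exchange_big; apply: eq_bigr => i _ /=.
rewrite /cnt (eq_bigr (fun v : 'I_(size e) => \sum_(j < maxpart a) (ev T i j == v.+1 : nat))).
  rewrite exchange_big; apply: eq_bigr => j _ /=.
  case: (posnP (ev T i j)) => [->|h]; first by rewrite big1.
  have vN : (ev T i j).-1 < size e by have := ev_le T i j; lia.
  rewrite (bigD1 (Ordinal vN)) //= prednK // eqxx big1 // => v.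
  rewrite -val_eqE /= => nv; apply/eqP; rewrite eqb0; apply: contra nv => /eqP ->.
  by [].
by move=> v _; rewrite /F -sum1dep_card big_mkcond.
Qed.

(** Tableaux of all shapes rearranging [la] are matched together with the patterns of shape [la].
    The matching reverses the content, and the symmetry of [schur la] allows [e] to be replaced by
    [rev e]. *)
Theorem schur_quasi la e : is_part la -> sumn e = sumn la -> schur la e =
  (\sum_(a <- comps (sumn la)) (sort geq a == la)%:R * quasi_schur a e)%R.
Proof.
move=> pla se; set k := size la; set c := maxpart la; set N := size e.
pose L := nth 0 la; have cla := is_part_comp pla.
have Lc i : L i <= c by exact: nth_maxpart.
have Ldec x y : x <= y -> y < k -> L y <= L x by move=> xy _; exact: is_part_decr.
have Lpos i : i < k -> 0 < L i by exact: is_comp_nth.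
have ml i : nth 0 [::] i <= nth 0 la i by rewrite nth_nil.
have sort_part a : (sort geq a == la) = perm_eq a la.
  apply/eqP/idP => [<-|pe]; first by rewrite perm_sym perm_sort.
  have sla : sorted geq la by case/andP: pla.
  apply: (sorted_eq geq_trans geq_anti) => //; first exact: sort_sorted geq_total _.
  by rewrite perm_sort.
pose I (T : 'M['I_N.+1]_(k, c)) := ssc k c (ev T) && has_content T.
pose fin (T : 'M['I_N.+1]_(k, c)) := row_lengths k c (ev T).
transitivity (Posz #|[set T | I T && perm_eq (fin T) la]|); last first.
  rewrite -sum1dep_card (big_morph Posz PoszD (erefl 0%R)).
  rewrite (eq_big_seq (fun a => \sum_(T | I T && perm_eq (fin T) la) Posz (fin T == a))%R).
    rewrite exchange_big; apply: eq_bigr => T /andP[_ pT].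
    rewrite sum_indicator ?uniq_comps // mem_comps (perm_sumn pT) eqxx andbT.
    by rewrite /is_comp (perm_mem pT) (cla : 0 \notin la).
  move=> a; rewrite mem_comps sort_part => /andP[ca _].
  case: (boolP (perm_eq a la)) => pa; last first.
    rewrite mul0r big1 // => T /andP[_ pT]; case: eqP => // fa.
    by rewrite -fa pT in pa.
  rewrite mul1r (@quasi_schur_card k c) ?(perm_size pa) //; last first.
    by rewrite /maxpart (perm_big _ pa).
  rewrite -(big_morph Posz PoszD (erefl 0%R)) -big_mkcondr /= sum1dep_card; congr Posz.
  apply: eq_card => T; rewrite !inE -/(I T) -/(fin T).
  by case: (fin T =P a) => [->|_]; rewrite ?pa ?andbT ?andbF.
rewrite /schur (@skew_schur_gt _ _ pla _ ml c) //; last by rewrite skew_size_nil.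
rewrite (@gt_card_perm _ _ _ _ _ e (rev e)) // -/N; last by rewrite perm_sym perm_rev.
have szr : size (rev e) = N by rewrite size_rev.
congr Posz; symmetry.
have colP (T : 'M['I_N.+1]_(k, c)) : ssc k c (ev T) ->
    (perm_eq (fin T) la <-> column_shape k c L (ev T)).
  move=> sT; have szf : size (fin T) = k by rewrite size_map size_iota.
  have fE j : j < c -> cnt k (nth 0 (fin T)) j.+1 = cnt k ((ev T)^~ j) 1.
    move=> jc; apply: eq_bigr => i _; rewrite nth_row_lengths // cnt_dec //.
    by move=> x y; exact: (ssc_row sT (ltn_ord i)).
  split=> [pe j jc|cs].
    rewrite -fE // -{1}szf !cnt_seq; exact: (elimT seq.permP pe).
  apply: perm_of_cnt => // x x0; rewrite szf; case: (leqP x c) => xc.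
    have xc' : x.-1 < c by lia.
    by rewrite -(prednK x0) fE ?cs.
  rewrite /cnt !big1 // => i _; apply/eqP; rewrite eqb0 -ltnNge.
    exact: leq_ltn_trans (Lc i) xc.
  by rewrite nth_row_lengths //; apply: leq_ltn_trans (cnt_le_k _ _ _) xc.
pose Pm (T : 'M['I_N.+1]_(k, c)) : 'M['I_c.+1]_(N.+1, k) := mk c N.+1 k (pattern N k c (ev T)).
have ePm T s i : s <= N -> i < k -> ev (Pm T) s i = pattern N k c (ev T) s i.
  by move=> sN ik; rewrite ev_mk //; exact: cnt_le_k.
have gE (p q : nat -> nat -> nat) : (forall s i, s <= N -> i < k -> p s i = q s i) ->
    gtb (nth 0 [::]) L N k p = gtb (fun=> 0) L N k q.
  move=> pq; rewrite /gtb; congr [&& _, _ & _]; apply: eq_in_all => i;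
    rewrite mem_iota /= => ik; rewrite ?nth_nil ?pq //.
  apply: eq_in_all => j; rewrite mem_iota => jk.
  by case: (ltnP j.+1 k) => jk'; rewrite /= !pq // ltnW.
have coE (p q : nat -> nat -> nat) s : (forall s i, s <= N -> i < k -> p s i = q s i) -> s < N ->
    cont k p s = cont k q s.
  by move=> pq sN; apply: eq_bigr => i _; rewrite !pq ?(ltnW sN).
have contE (T : 'M['I_N.+1]_(k, c)) : @has_content e k c T = alln N (fun t => cont k (pattern N k c (ev T)) t == nth 0 (rev e) t).
  apply/forallP/allnP => [h s sN|h v].
    rewrite cont_pattern // nth_rev // -/N; have vN : N - s.+1 < N by lia.
    by rewrite -(eqP (h (Ordinal vN))) /=; apply/eqP; congr (occ T); lia.
  have sN : N - v.+1 < N by have := ltn_ord v; lia.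
  have := h _ sN; rewrite cont_pattern // nth_rev // -/N.
  have -> : N - (N - v.+1) = v.+1 by have := ltn_ord v; lia.
  by have -> : N - (N - v.+1).+1 = v by have := ltn_ord v; lia.
apply: (@bij_card _ _ _ _ Pm).
- move=> T T'; rewrite !inE => /andP[/andP[sT _] _] /andP[/andP[sT' _] _] eP.
  by apply: (pattern_inj sT sT') => s i sN ik; rewrite -!ePm // eP.
- move=> T; rewrite !inE => /andP[/andP[sT cT] /(colP _ sT) csT].
  rewrite (gE _ _ (ePm T)) pattern_gtb //=.
  apply/allnP => s sN; rewrite (coE _ _ _ (ePm T)) //.
  by move: cT; rewrite contE => /allnP/(_ s sN).
- move=> P; rewrite inE => /andP[gP /allnP cP].
  rewrite (gE _ (ev P)) // in gP.
  have [T [sT csT eT]] := pattern_onto Lc Lpos gP.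
  exists T; last by apply: ev_inj => s i sN ik; rewrite ePm // eT.
  rewrite inE /I sT contE; apply/andP; split; last exact/(colP _ sT).
  by apply/allnP => s sN; rewrite (coE _ _ _ eT) // cP.
Qed.

(** * Kostka numbers and the independence of the quasisymmetric Schur functions *)

Lemma sort_comp a : is_comp a -> is_part (sort geq a) /\ sumn (sort geq a) = sumn a.
Proof.
move=> ca; split; last by apply: perm_sumn; rewrite perm_sort.
rewrite /is_part (sort_sorted geq_total) /=.
by rewrite /is_comp mem_sort.
Qed.

Lemma sort_part la : is_part la -> sort geq la = la.
Proof. by case/andP => h _; apply: sorted_sort => //; exact: geq_trans. Qed.

Lemma schur_sort_content la e : is_part la -> sumn e = sumn la ->
  schur la e = schur la (sort geq e).
Proof.
move=> pla se; have ml i : nth 0 [::] i <= nth 0 la i by rewrite nth_nil.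
rewrite /schur !(@skew_schur_gt _ _ pla _ ml (maxpart la)) ?skew_size_nil //;
  try exact: nth_maxpart.
  by rewrite size_sort; congr Posz; apply: gt_card_perm => //; rewrite perm_sym perm_sort.
by rewrite -se; apply: perm_sumn; rewrite perm_sort.
Qed.

Section Kostka.

Variables (la mu : seq nat).
Hypotheses (pla : is_part la) (smu : sumn mu = sumn la).

Let N := size mu.

Let ml i : nth 0 [::] i <= nth 0 la i. Proof. by rewrite nth_nil. Qed.

Section Pattern.

Variables (p : nat -> nat -> nat).
Hypothesis gp : gtb (nth 0 [::]) (nth 0 la) N (size la) p.
Hypothesis cp : forall t, t < N -> cont (size la) p t = nth 0 mu t.

Lemma gt_low t i : t <= N -> t <= i -> i < size la -> p t i = 0.
Proof.
have [ch itl] := gtP _ _ _ _ _ gp; have [h0 _ _] := ch.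
elim: t i => [|t IH] i tN ti ik; first by rewrite h0 // nth_nil.
case: i ti ik => // i ti ik; apply/eqP; rewrite -leqn0 -(IH i) //; try lia.
by apply: itl.
Qed.

Lemma gt_sum t : t <= N -> \sum_(i < size la) p t i = psum mu t.
Proof.
have [ch _] := gtP _ _ _ _ _ gp; have [h0 _ mon] := ch.
elim: t => [|t IH] tN; first by rewrite big1 /psum ?take0 // => i _; rewrite h0 ?nth_nil.
rewrite psumS -IH ?(ltnW tN) // -cp // -big_split /=; apply: eq_bigr => i _.
by rewrite subnKC ?mon.
Qed.

Lemma gt_le t i : t <= N -> i < size la -> p t i <= highest (nth 0 la) t i.
Proof.
move=> tN ik; rewrite /highest; case: (ltnP i t) => ti; last by rewrite gt_low.
have [ch _] := gtP _ _ _ _ _ gp; have [_ hN _] := ch.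
by rewrite -hN //; exact: chain_mono ch _ _ ik.
Qed.

Lemma sum_highest t : \sum_(i < size la) highest (nth 0 la) t i <= psum la t.
Proof.
rewrite psum_nth (leq_trans (@leq_sum_support _ t _ _)) //.
  by move=> j tj; rewrite /highest ltnNge tj.
by apply: leq_sum => i _; rewrite /highest; case: ifP.
Qed.

Lemma gt_dom t : psum mu t <= psum la t.
Proof.
have main s : s <= N -> psum mu s <= psum la s.
  move=> sN; rewrite -gt_sum // (leq_trans _ (sum_highest s)) //.
  by apply: leq_sum => i _; exact: gt_le.
case: (leqP t N) => tN; first exact: main.
apply: leq_trans (leq_psum _ (ltnW tN)); apply: leq_trans (main _ (leqnn _)).
by rewrite psum_size psum_le.
Qed.

Lemma gt_highest : mu = la -> forall t i, t <= N -> i < size la ->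
  p t i = highest (nth 0 la) t i.
Proof.
move=> ml' t i tN ik; have le j : j < size la -> p t j <= highest (nth 0 la) t j.
  exact: gt_le.
apply/eqP; rewrite eqn_leq le //= leqNgt; apply/negP => lt.
have := sum_highest t; rewrite -ml' -gt_sum // leqNgt => /negP; apply.
rewrite ml' (bigD1 (Ordinal ik)) //= [X in _ < X](bigD1 (Ordinal ik)) //= -addSn.
by apply: leq_add => //; apply: leq_sum => j _; exact: le.
Qed.

End Pattern.

Lemma kostka_dom : schur la mu != 0%R -> forall t, psum mu t <= psum la t.
Proof.
rewrite /schur (@skew_schur_gt _ _ pla _ ml (maxpart la)) ?skew_size_nil //;
  last exact: nth_maxpart.
rewrite eqz_nat -lt0n => /card_gt0P[P]; rewrite inE => /andP[gP /allnP cP] t.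
by apply: (gt_dom gP) => s sN; exact/eqP/cP.
Qed.

Lemma kostka_diag : mu = la -> (schur la mu <= 1)%R.
Proof.
move=> e; rewrite /schur (@skew_schur_gt _ _ pla _ ml (maxpart la)) ?skew_size_nil //;
  last exact: nth_maxpart.
rewrite lez_nat; apply/card_le1_eqP => P Q; rewrite !inE.
move=> /andP[gP /allnP cP] /andP[gQ /allnP cQ]; apply: ev_inj => t i tN ik.
rewrite (gt_highest gP) //; last by move=> s sN; exact/eqP/cP.
by rewrite (gt_highest gQ) // => s sN; exact/eqP/cQ.
Qed.

End Kostka.

Lemma quasi_schur_diag a : is_comp a -> (0 < quasi_schur a a)%R.
Proof.
move=> ca; rewrite (@quasi_schur_card (size a) (maxpart a)) //.
rewrite ltz_nat; apply/card_gt0P.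
set k := size a; set c := maxpart a.
pose f i j := if j < nth 0 a i then i.+1 else 0.
pose T : 'M['I_k.+1]_(k, c) := mk k k c f.
have eT i j : i < k -> j < c -> ev T i j = f i j.
  by move=> ik jc; rewrite ev_mk // /f; case: ifP => _.
have c0 i : i < k -> 0 < c.
  by move=> ik; apply: leq_trans (is_comp_nth ca ik) (nth_maxpart _ _).
have ac i : nth 0 a i <= c by exact: nth_maxpart.
exists T; rewrite inE; apply/andP; split; first apply/andP; first split.
- apply/sscP; split=> [i ik|i i' ii ik|j jc].
  + by rewrite eT ?(c0 i) // /f is_comp_nth.
  + have ik' : i < k by lia.
    by rewrite !eT ?(c0 i) // /f !is_comp_nth.
  + split=> [i ik|i i' ii ik].
      rewrite !eT ?(ltnW jc) // /f; case: (ltnP j.+1 (nth 0 a i)) => // h.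
      by rewrite (ltnW h).
    have ik' : i < k by lia.
    rewrite !eT ?(ltnW jc) // /f; case: (ltnP j.+1 (nth 0 a i')) => // h _ _.
    by case: ifP.
- apply/forallP => v; rewrite occE (bigD1 v) //= big1 ?addn0.
    rewrite -[X in _ == X]subn0 -(@card_ord_range c 0) //; apply/eqP/eq_card => j.
    by rewrite !inE eT // /f; case: ifP => //=; rewrite eqxx.
  move=> i ne; apply: eq_card0 => j; rewrite !inE eT // /f.
  by case: ifP => // _; rewrite eqSS; apply: contraNF ne => /eqP/val_inj ->.
- apply/eqP/(@eq_from_nth _ 0); rewrite size_map size_iota // => i ik.
  rewrite nth_row_lengths //.
  have -> : cnt c (ev T i) 1 = \sum_(j < c) (j < nth 0 a i : nat).
    by apply: eq_bigr => j _; rewrite eT // /f; case: (ltnP j (nth 0 a i)).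
  by rewrite sum_ltn; apply/minn_idPl.
Qed.

Lemma quasi_schur_ge0 a e : (0 <= quasi_schur a e)%R.
Proof. by []. Qed.

(** By symmetry the Schur function takes the same value at [a] and at its sorted form, and
    [quasi_schur b] is one of its nonnegative summands. *)
Lemma schur_ge_quasi b a : is_comp a -> is_comp b -> sumn a = sumn b ->
  (quasi_schur b a <= schur (sort geq b) (sort geq a))%R.
Proof.
move=> ca cb sab; have [pb sb] := sort_comp cb.
rewrite -schur_sort_content ?sb // schur_quasi ?sb //.
rewrite (big_rem b) /=; last by rewrite mem_comps cb eqxx.
rewrite eqxx mul1r lerDl; apply: sumr_ge0 => x _.
by apply: mulr_ge0; rewrite ?quasi_schur_ge0 // ler0n.
Qed.

(* If a <> b have the same sorted content, then S_a and S_b both occur in the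
   corresponding Schur function, whose coefficient there is 1. *)
Lemma quasi_schur_sort b a : is_comp a -> is_comp b -> b != a ->
  quasi_schur b a != 0%R -> sort geq b != sort geq a.
Proof.
move=> ca cb ne nz; apply/negP => /eqP es.
have [pa sa] := sort_comp ca; have [pb sb] := sort_comp cb.
have sab : sumn a = sumn b by rewrite -sa -es.
have : (schur (sort geq b) a <= 1)%R.
  by rewrite schur_sort_content ?sb // kostka_diag ?sa ?sb // es.
rewrite schur_quasi ?sb // (big_rem b) /=; last by rewrite mem_comps cb eqxx.
rewrite eqxx mul1r (big_rem a) /=; last first.
  by rewrite (rem_filter _ (uniq_comps _)) mem_filter /= eq_sym ne mem_comps ca sab eqxx.
rewrite es eqxx mul1r leNgt => /negP; apply.
have h1 := quasi_schur_diag ca; have h2 := quasi_schur_ge0 b a.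
have h3 : (0 < quasi_schur b a)%R by rewrite lt0r nz h2.
set S := (X in (_ + (_ + X))%R); have : (0 <= S)%R.
  by apply: sumr_ge0 => x _; apply: mulr_ge0; rewrite ?quasi_schur_ge0 // ler0n.
move: h1 h3; clear; move: (quasi_schur a a) (quasi_schur b a) S => x y z; lia.
Qed.

(** The rank measures the dominance of the sorted index: [schur_ge_quasi] reduces the comparison to
    Kostka numbers, and ties are excluded by [quasi_schur_sort]. *)
Lemma triangular_S : triangular bS.
Proof.
exists (fun b => \sum_(t < (sumn b).+1) (sumn b - psum (sort geq b) t)).
split=> [a ca|a b ca cb nz ba]; first by rewrite lt0r_neq0 ?quasi_schur_diag.
have sab : sumn a = sumn b.
  by apply/eqP; apply: contraNT nz => h; rewrite /= quasi_schur_0.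
have [pa sa] := sort_comp ca; have [pb sb] := sort_comp cb.
have dom t : psum (sort geq a) t <= psum (sort geq b) t.
  apply: kostka_dom => //; first by rewrite sa sb.
  have := schur_ge_quasi ca cb sab; have := quasi_schur_ge0 b a.
  move: nz => /=; move: (quasi_schur b a) (schur _ _) => x y; lia.
rewrite sab ltnNge; apply: contra (quasi_schur_sort ca cb ba nz) => h.
apply/eqP/comp_eq_psum; rewrite ?(is_part_comp pa) ?(is_part_comp pb) ?sa ?sb // => t tn.
apply/eqP; rewrite eqn_leq dom andbT leqNgt; apply/negP => lt.
move: h; rewrite leqNgt => /negP; apply.
have tS : t < (sumn b).+1 by [].
have lt' := lt; have pl : psum (sort geq b) t <= sumn b by rewrite -sb psum_le.
rewrite (bigD1 (Ordinal tS)) //= [X in _ < X](bigD1 (Ordinal tS)) //= -addSn.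
apply: leq_add; first by lia.
by apply: leq_sum => s _; have := dom s; lia.
Qed.

Theorem refines_S : refines bS (sort geq) (fun=> 1%R).
Proof.
split=> //; first exact: triangular_S.
- by move=> a ca _; have [] := sort_comp ca.
- by move=> la pla; rewrite sort_part.
move=> la e pl; case: (eqVneq (sumn e) (sumn la)) => se; last first.
  rewrite /schur skew_schur_0 ?skew_size_nil // => [|i]; last by rewrite nth_nil.
  rewrite big_seq big1 // => a; rewrite mem_comps => /andP[ca /eqP sa].
  by rewrite /= quasi_schur_0 ?mulr0 // sa.
by rewrite schur_quasi //; apply: eq_bigr => a _; rewrite mulr1.
Qed.

(** * Overlaps and rectangles *)

Definition excess t (s : seq nat) := \sum_(a <- s) (a - t).

Lemma excess_nth t s : excess t s = \sum_(i < size s) (nth 0 s i - t).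
Proof. by rewrite /excess (big_nth 0) big_mkord. Qed.

Lemma excess_ge t s k : \sum_(i < k) (nth 0 s i - t) <= excess t s.
Proof.
rewrite excess_nth; apply: (@leq_sum_support k (size s) (fun i => nth 0 s i - t)) => i h.
by rewrite nth_default.
Qed.

Lemma excess_le t s k : (forall i, k <= i -> nth 0 s i <= t) ->
  excess t s <= \sum_(i < k) (nth 0 s i - t).
Proof.
move=> h; rewrite excess_nth.
apply: (@leq_sum_support (size s) k (fun i => nth 0 s i - t)) => i /h le.
by apply/eqP; rewrite subn_eq0.
Qed.

Lemma sorted_geq_nth s i j : sorted geq s -> i <= j -> nth 0 s j <= nth 0 s i.
Proof.
move=> ss ij; case: (ltnP j (size s)) => js; last by rewrite nth_default.
apply: (sorted_leq_nth geq_trans leqnn 0 ss) => //; rewrite inE //; lia.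
Qed.

(** Legendre duality: [excess t x] is the maximum over [k] of [psum x k - k * t], and [psum y k] is
    the minimum over [t] of [k * t + excess t y]. *)
Lemma dominated_excess x y : sorted geq x -> sorted geq y ->
  dominated x y <-> forall t, excess t x <= excess t y.
Proof.
move=> sx sy; split=> [dom t|h k _].
  (* The maximum is attained at the number of parts exceeding [t]. *)
  pose k := cnt (size x) (nth 0 x) t.+1.
  have kx : k <= size x by exact: cnt_le_k.
  have kP i : i < size x -> (i < k) = (t < nth 0 x i).
    by move=> ix; apply: cnt_dec => // a b ab _; exact: sorted_geq_nth.
  have ex : excess t x <= \sum_(i < k) (nth 0 x i - t).
    apply: excess_le => i ki; case: (ltnP i (size x)) => ix; last by rewrite nth_default.
    by rewrite leqNgt -kP // -leqNgt.
  apply: leq_trans ex (leq_trans _ (excess_ge t y k)).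
  case: (posnP k) => [->|k0]; first by rewrite big_ord0.
  have := dom k; rewrite k0 kx -/(psum x k) -/(psum y k) !psum_nth => /(_ isT) le.
  rewrite -(leq_add2r (\sum_(i < k) t)) -!big_split /=.
  rewrite (eq_bigr (fun i : 'I_k => nth 0 x i)); last first.
    move=> i _; rewrite subnK // ltnW // -kP //; apply: leq_trans (ltn_ord i) kx.
  by apply: leq_trans le _; apply: leq_sum => i _; lia.
(* The minimum is attained at the part following the first [k], whose index is [k] as counting
   starts at 0. *)
rewrite -/(psum x k) -/(psum y k) !psum_nth; set t := nth 0 y k.
have ey : excess t y <= \sum_(i < k) (nth 0 y i - t).
  by apply: excess_le => i ki; exact: sorted_geq_nth.
have le := leq_trans (excess_ge t x k) (leq_trans (h t) ey).
rewrite -(leq_add2r (\sum_(i < k) t)) -!big_split /= in le.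
have xy : \sum_(i < k) nth 0 x i <= \sum_(i < k) (nth 0 x i - t + t).
  by apply: leq_sum => i _; lia.
apply: leq_trans xy (leq_trans le _); apply: leq_sum => i _.
by rewrite subnK // /t; apply: sorted_geq_nth => //; exact: ltnW.
Qed.

Lemma excess_overlaps t r c D k : excess t (overlaps r c D k) =
  excess t [seq overlap c D k i | i <- iota 0 (r.+1 - k)].
Proof.
rewrite /excess /overlaps (perm_big _ (permEl (perm_sort _ _))) /= big_filter.
rewrite [RHS](bigID (fun v => v != 0)) /= [X in _ + X]big1 ?addn0 //.
by move=> v /negbNE/eqP ->; rewrite sub0n.
Qed.

Lemma sorted_overlaps r c D k : sorted geq (overlaps r c D k).
Proof. exact: sort_sorted geq_total _. Qed.

Section Intervals.

Variables (r c : nat) (D : diagram) (m la : nat -> nat).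
Hypothesis DE : forall i j, D i j = (m i <= j < la i).
Hypothesis mdec : forall i i', i <= i' -> m i' <= m i.
Hypothesis ladec : forall i i', i <= i' -> la i' <= la i.
Hypothesis lac : forall i, la i <= c.
Hypothesis la0 : forall i, r <= i -> la i = 0.

Lemma overlapE k i : overlap c D k.+1 i = la (i + k) - m i.
Proof.
rewrite /overlap -(card_ord_range _ (lac (i + k))); apply: eq_card => j; rewrite !inE.
apply/forallP/andP => [h|[h1 h2] p].
  have := h ord0; have := h ord_max; rewrite /= !DE addn0.
  by move=> /andP[_ ->] /andP[-> _].
rewrite DE (leq_trans _ h1) ?mdec ?leq_addr //= (leq_trans h2) // ladec //.
by rewrite leq_add2l -ltnS.
Qed.

(** A rectangle is fixed by its top left corner, and in row [i] the corner may stand in all but the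
    last [l] columns common to rows [i] to [i + k]. *)
Lemma rects_excess k l :
  #|[set x : 'I_r * 'I_c |
      [forall p : 'I_k.+1, forall q : 'I_l.+1, D (x.1 + p) (x.2 + q)]]| =
  excess l [seq overlap c D k.+1 i | i <- iota 0 (r.+1 - k.+1)].
Proof.
rewrite /excess big_map subSS -(subn0 (r - k)) -/(index_iota 0 (r - k)) big_mkord.
rewrite (eq_bigr (fun i : 'I_(r - k) => la (i + k) - m i - l)); last first.
  by move=> i _; rewrite overlapE.
have -> : \sum_(i < r - k) (la (i + k) - m i - l) = \sum_(i < r) (la (i + k) - m i - l).
  apply/eqP; rewrite eqn_leq.
  rewrite (@leq_sum_support _ _ (fun i => la (i + k) - m i - l)); last first.
    by move=> j rj; rewrite la0 //; lia.
  rewrite (@leq_sum_support _ _ (fun i => la (i + k) - m i - l)) //.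
  by move=> j rj; rewrite la0 //; lia.
rewrite -sum1dep_card.
rewrite -(pair_big_dep xpredT (fun (i : 'I_r) (j : 'I_c) => [forall p : 'I_k.+1, forall q : 'I_l.+1,
   D (i + p) (j + q)]) (fun _ _ => 1)) /=.
apply: eq_bigr => i _; rewrite sum1dep_card subnAC -(@card_ord_range c); last first.
  by apply: leq_trans (leq_subr _ _) (lac _).
apply: eq_card => j; rewrite !inE.
apply/forallP/andP => [h|[h1 h2] p].
  have /forallP/(_ ord0) := h ord0; have /forallP/(_ ord_max) := h ord_max.
  by rewrite /= !DE !addn0 => /andP[_ h1] /andP[h2 _]; split=> //; lia.
apply/forallP => q; rewrite DE.
have := mdec (leq_addr p i); have : la (i + k) <= la (i + p).
  by apply: ladec; have := ltn_ord p; lia.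
by have := ltn_ord q; lia.
Qed.

End Intervals.

Definition transposed (D : diagram) : diagram := fun j i => D i j.

Lemma rects_transposed r c D k l :
  #|[set x : 'I_r * 'I_c | [forall p : 'I_k, forall q : 'I_l, D (x.1 + p) (x.2 + q)]]| =
  #|[set x : 'I_c * 'I_r |
      [forall p : 'I_l, forall q : 'I_k, transposed D (x.1 + p) (x.2 + q)]]|.
Proof.
apply: (@bij_card _ _ _ _ (fun x => (x.2, x.1))).
- by move=> [a b] [a' b'] _ _ [-> ->].
- move=> [a b]; rewrite !inE => /forallP h; apply/forallP => p; apply/forallP => q.
  by have /forallP/(_ p) := h q.
- move=> [a b]; rewrite inE => /forallP h; exists (b, a) => //; rewrite inE.
  by apply/forallP => p; apply/forallP => q; have /forallP/(_ p) := h q.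
Qed.

Section Shape.

Variable A : skew_shape.

Let M := nth 0 (inner A).
Let L := nth 0 (outer A).

Lemma inner_outer i : M i <= L i.
Proof.
case: (ltnP i (size (inner A))) => h; last by rewrite /M nth_default.
exact: (forallP (inner_sub A) (Ordinal h)).
Qed.

Lemma inner_decr i i' : i <= i' -> M i' <= M i.
Proof. exact/is_part_decr/inner_part. Qed.

Lemma outer_decr i i' : i <= i' -> L i' <= L i.
Proof. exact/is_part_decr/outer_part. Qed.

Lemma outer_out i : nrows A <= i -> L i = 0.
Proof. exact: nth_default. Qed.

Lemma rects_rows k l : rects k.+1 l.+1 A = excess l (rows k.+1 A).
Proof.
rewrite excess_overlaps; apply: (@rects_excess _ _ (inside A) M L) => //.
- exact: inner_decr.
- exact: outer_decr.
- by move=> i; exact: nth_maxpart.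
- exact: outer_out.
Qed.

(** The transposed diagram again has intervals as rows, bounded by the conjugates [m] and [la], so
    the same count applies with rows and columns exchanged. *)
Lemma rects_cols k l : rects k.+1 l.+1 A = excess k (cols l.+1 A).
Proof.
rewrite excess_overlaps /rects rects_transposed.
pose r := nrows A; pose m j := cnt r M j.+1; pose la j := cnt r L j.+1.
have mono f i i' : i <= i' -> cnt r f i'.+1 <= cnt r f i.+1.
  move=> le; apply: leq_sum => a _; case: (leqP i'.+1 (f a)) => //= h.
  by rewrite (leq_ltn_trans le).
apply: (@rects_excess _ _ (transposed (inside A)) m la).
- move=> j i; rewrite /transposed /inside /skew_diagram -/M -/L.
  case: (ltnP i r) => ir.
    rewrite [m j <= i]leqNgt [M i <= j]leqNgt /m /la !cnt_dec // => a b ab _.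
      exact: outer_decr.
    exact: inner_decr.
  rewrite outer_out // ltn0 andbF; apply/esym/negbTE; rewrite negb_and.
  have h : la j <= i := leq_trans (cnt_le_k _ _ _) ir.
  by rewrite [i < _]ltnNge h orbT.
- by move=> i i'; exact: mono.
- by move=> i i'; exact: mono.
- by move=> i; exact: cnt_le_k.
- move=> j cj; rewrite /la /cnt big1 // => i _; apply/eqP; rewrite eqb0 -leqNgt.
  exact: leq_trans (nth_maxpart _ _) cj.
Qed.

Lemma rectsE k l : rects k.+1 l.+1 A = \sum_(i < nrows A) (L (i + k) - (M i + l)).
Proof.
rewrite /rects (@rects_excess _ _ (inside A) M L) //; first 1 last.
- exact: inner_decr.
- exact: outer_decr.
- by move=> i; exact: nth_maxpart.
- exact: outer_out.
rewrite /excess big_map subSS -(subn0 (nrows A - k)) -/(index_iota 0 (nrows A - k)).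
rewrite big_mkord.
rewrite (eq_bigr (fun i : 'I_(nrows A - k) => L (i + k) - (M i + l))); last first.
  move=> i _; rewrite (@overlapE _ (inside A) M L) ?subnDA //.
  - exact: inner_decr.
  - exact: outer_decr.
  - by move=> j; exact: nth_maxpart.
apply/eqP; rewrite eqn_leq.
rewrite (@leq_sum_support _ _ (fun i => L (i + k) - (M i + l))); last first.
  by move=> j rj; rewrite outer_out //; lia.
rewrite (@leq_sum_support _ _ (fun i => L (i + k) - (M i + l))) //.
by move=> j rj; rewrite outer_out //; lia.
Qed.

End Shape.

Lemma rows_rects A B : rows_cond A B <-> rects_cond A B.
Proof.
split=> [h [//|k] [//|l] _ _|h [//|k] _].
  have /dominated_excess := h k.+1 isT; rewrite !rects_rows => -> //; exact: sorted_overlaps.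
apply/dominated_excess; try exact: sorted_overlaps.
by move=> t; rewrite -!rects_rows; exact: h.
Qed.

Lemma cols_rects A B : cols_cond A B <-> rects_cond A B.
Proof.
split=> [h [//|k] [//|l] _ _|h [//|l] _].
  have /dominated_excess := h l.+1 isT; rewrite !rects_cols => -> //; exact: sorted_overlaps.
apply/dominated_excess; try exact: sorted_overlaps.
by move=> t; rewrite -!rects_cols; exact: h.
Qed.

(** * Strips, and the passage from descents to rectangles *)

Definition same_descents (w w' : seq nat) := size w = size w' /\
  forall i, i.+1 < size w -> (nth 0 w i < nth 0 w i.+1) = (nth 0 w' i < nth 0 w' i.+1).

Lemma same_descents_take n w w' : same_descents w w' ->
  same_descents (take n w) (take n w').
Proof.
case=> sz h; split; first by rewrite !size_take sz.
move=> i; rewrite size_take => hi; have i1 : i.+1 < n by move: hi; case: ifP; lia.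
have i2 : i.+1 < size w by move: hi; case: ifP; lia.
by have i0 := ltnW i1; rewrite !nth_take //; exact: h.
Qed.

Lemma same_descents_drop n w w' : same_descents w w' ->
  same_descents (drop n w) (drop n w').
Proof.
case=> sz h; split; first by rewrite !size_drop sz.
by move=> i; rewrite size_drop => hi; rewrite !nth_drop addnS h //; lia.
Qed.

Lemma same_descents_dec w w' : same_descents w w' -> sorted geq w -> sorted geq w'.
Proof.
case=> sz h /(sortedP 0) sw; apply/(sortedP 0) => i; rewrite -sz => hi.
by have := sw i hi; rewrite /geq /= => le; rewrite leqNgt -h // -leqNgt.
Qed.

Lemma same_descents_inc w w' : same_descents w w' -> sorted ltn w -> sorted ltn w'.
Proof.
case=> sz h /(sortedP 0) sw; apply/(sortedP 0) => i; rewrite -sz => hi.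
by have := sw i hi; rewrite /= -h.
Qed.

Lemma same_descents_wdesc w w' : size w = size w' -> wdesc w = wdesc w' ->
  same_descents w w'.
Proof.
move=> sz e; split=> // i hi.
have mem u : size u = size w -> (i.+1 \in wdesc u) = (nth 0 u i < nth 0 u i.+1).
  by move=> su; rewrite mem_filter mem_iota su /= andbC; have -> : i.+1 < 1 + (size w).-1 by lia.
by rewrite -!mem // e.
Qed.

Definition admissible m w :=
  forall k i, shape m (take k w) i.+1 <= shape m (take k w) i.

Lemma admissible_drop m n w : admissible m w ->
  admissible (shape m (take n w)) (drop n w).
Proof.
move=> h k i; rewrite -!shape_cat take_drop.
have := h (k + n) i; rewrite -{1 2}(cat_take_drop n (take (k + n) w)).
by rewrite take_takel ?leq_addl.
Qed.

Lemma admissible_take m n w : admissible m w -> admissible m (take n w).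
Proof.
move=> h k i; case: (leqP k n) => kn; first by rewrite take_takel.
by rewrite take_oversize // size_take; case: ifP; lia.
Qed.

(** Each block of [w] is weakly decreasing like that of [us], so it adds a horizontal strip, after
    which row [i.+1] is no longer than row [i] was before. *)
Lemma dec_blocks_bound us m w : all (sorted geq) us -> same_descents (flatten us) w ->
  admissible m w -> forall i, size us <= i -> shape m w i <= m (i - size us).
Proof.
elim: us m w => [|u us IH] m w /=.
  move=> _ [/esym/size0nil -> _] _ i _; by rewrite subn0 /shape addn0.
case/andP => su sus sd aw [|i] //; rewrite ltnS => usi.
have h1 := same_descents_take (size u) sd; have h2 := same_descents_drop (size u) sd.
rewrite take_size_cat // in h1; rewrite drop_size_cat // in h2.
rewrite -(cat_take_drop (size u) w) shape_cat subSS.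
apply: leq_trans (IH _ _ sus h2 (admissible_drop (size u) aw) i.+1 (leqW usi)) _.
rewrite (subSn usi); apply: hstrip_of_dec; first exact: same_descents_dec h1 su.
exact: admissible_take.
Qed.

(** A strictly increasing block repeats no letter, so it adds at most one box to a row. *)
Lemma inc_blocks_bound vs m w i : all (sorted ltn) vs -> same_descents (flatten vs) w ->
  shape m w i <= m i + size vs.
Proof.
elim: vs m w => [|v vs IH] m w /=.
  move=> _ [/esym/size0nil -> _]; by rewrite /shape.
case/andP => sv svs sd.
have h1 := same_descents_take (size v) sd; have h2 := same_descents_drop (size v) sd.
rewrite take_size_cat // in h1; rewrite drop_size_cat // in h2.
rewrite -(cat_take_drop (size v) w) shape_cat.
apply: leq_trans (IH _ _ svs h2) _; rewrite addnS -addSn leq_add2r -addn1 leq_add2l.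
have /(sorted_uniq ltn_trans ltnn) un := same_descents_inc h1 sv.
by rewrite count_uniq_mem // leq_b1.
Qed.

Section Exist.

Variables (r : nat) (M L : nat -> nat).
Hypothesis mdec : forall i i', i <= i' -> M i' <= M i.
Hypothesis ldec : forall i i', i <= i' -> L i' <= L i.
Hypothesis ML : forall i, M i <= L i.
Hypothesis Lout : forall i, r <= i -> L i = 0.

(** Row lengths after [k] horizontal strips, each as large as possible inside [L]: row [i] can at
    best reach the initial length of row [i - k], and the first [k] rows are full. [vfill] does the
    same for [p] vertical strips. *)
Definition hfill k i := if i < k then L i else minn (L i) (M (i - k)).

Definition vfill (s : nat -> nat) p i := minn (L i) (s i + p).

Lemma hfill_bounds k i : M i <= hfill k i <= L i.
Proof.
rewrite /hfill; case: ifP => _; first by rewrite ML leqnn.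
by rewrite leq_min ML geq_minl mdec ?leq_subr.
Qed.

Lemma hfill_mono k i : hfill k i <= hfill k.+1 i.
Proof.
rewrite {2}/hfill; case: ltnP => ki; first by case/andP: (hfill_bounds k i).
have /andP[_ h] := hfill_bounds k i; rewrite leq_min h /= /hfill (ltnNge i k) (ltnW ki) /=.
by apply: leq_trans (geq_minr _ _) (mdec _); lia.
Qed.

Lemma hfill_dec k i : hfill k i.+1 <= hfill k i.
Proof.
rewrite /hfill; case: (ltnP i k) => ik; last first.
  rewrite ltnNge (leqW ik) /= leq_min (leq_trans (geq_minl _ _)) ?ldec //=.
  by apply: leq_trans (geq_minr _ _) (mdec _); lia.
by case: ifP => _; rewrite ?(leq_trans (geq_minl _ _)) ?ldec.
Qed.

Lemma hfill_strip k i : hfill k.+1 i.+1 <= hfill k i.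
Proof.
rewrite /hfill ltnS subSS; case: ifP => _; first exact: ldec.
by rewrite leq_min geq_minr andbT (leq_trans (geq_minl _ _)) ?ldec.
Qed.

Lemma dec_blocks_exist k : exists us, [/\ all (sorted geq) us, size us = k,
  admissible M (flatten us) & forall i, shape M (flatten us) i = hfill k i].
Proof.
elim: k => [|k [us [sus szu adu shu]]].
  exists [::]; split=> // [k i|i]; first by rewrite /= /shape !addn0 mdec.
  by rewrite /= /shape addn0 /hfill subn0; apply/esym/minn_idPr/ML.
have [u su cu] := dec_word_exists r (fun i => hfill k.+1 i - hfill k i).
have shu' i : shape (hfill k) u i = hfill k.+1 i.
  rewrite /shape cu; case: ltnP => ir; first by rewrite subnKC ?hfill_mono.
  have := hfill_bounds k i; have := hfill_bounds k.+1 i; rewrite Lout //; lia.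
have shE i : shape M (flatten us ++ u) i = hfill k.+1 i.
  by rewrite shape_cat -shu'; apply: eq_shape.
exists (rcons us u); rewrite flatten_rcons; split.
- by rewrite all_rcons su.
- by rewrite size_rcons szu.
- apply: prefix_cat => //; apply: prefix_hstrip => i.
  rewrite shu (eq_shape _ shu) shu'; exact: hfill_strip.
- exact: shE.
Qed.

Lemma inc_word_exists (q : nat -> bool) : exists2 v, sorted ltn v &
  forall i, count_mem i v = (i < r) && q i.
Proof.
exists (filter q (iota 0 r)).
  by apply: sorted_filter; [exact: ltn_trans|exact: iota_ltn_sorted].
move=> i; rewrite count_uniq_mem ?filter_uniq ?iota_uniq //.
by rewrite mem_filter mem_iota add0n andbC.
Qed.

(* The boxes of a vertical strip are added from the top row downwards. *)
Lemma prefix_vstrip m v : sorted ltn v -> (forall i, m i.+1 <= m i) ->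
  (forall i, shape m v i.+1 <= shape m v i) -> admissible m v.
Proof.
move=> sv md sd k i; have uv := sorted_uniq ltn_trans ltnn sv.
have cle (u : seq nat) j : uniq u -> count_mem j u = (j \in u) by move=> ?; exact: count_uniq_mem.
have := sd i; have := md i; rewrite /shape !cle ?take_uniq //.
case: (boolP (i.+1 \in take k v)) => h1; last by lia.
rewrite (mem_take h1); case: (boolP (i \in v)) => h2; last first.
  by rewrite (contraNF (@mem_take _ _ _ _) h2).
suff -> : i \in take k v by lia.
have i1 : i.+1 \in v := mem_take h1.
have lt : index i v < index i.+1 v.
  rewrite ltnNge; apply/negP; rewrite leq_eqVlt => /orP[/eqP e|lt].
    by have := nth_index 0 h2; rewrite -e nth_index //; lia.
  have := sorted_ltn_nth ltn_trans 0 sv; move/(_ (index i.+1 v) (index i v)).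
  rewrite !inE !index_mem i1 h2 => /(_ isT isT lt); rewrite !nth_index //; lia.
rewrite in_take //; rewrite in_take // in h1; exact: ltn_trans h1.
Qed.

Lemma vfill_dec s t i : (forall i, s i.+1 <= s i) -> vfill s t i.+1 <= vfill s t i.
Proof.
move=> sdec; rewrite /vfill leq_min (leq_trans (geq_minl _ _)) ?ldec //=.
by rewrite (leq_trans (geq_minr _ _)) // leq_add2r.
Qed.

Lemma inc_blocks_exist s p : (forall i, s i.+1 <= s i) -> (forall i, s i <= L i) ->
  exists vs, [/\ all (sorted ltn) vs, size vs = p,
  admissible s (flatten vs) & forall i, shape s (flatten vs) i = vfill s p i].
Proof.
move=> sdec sL; elim: p => [|p [vs [svs szv adv shv]]].
  exists [::]; split=> // [k i|i]; first by rewrite /= /shape !addn0.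
  by rewrite /= /shape /vfill !addn0; apply/esym/minn_idPr/sL.
have [v sv cv] := inc_word_exists (fun i => vfill s p i < vfill s p.+1 i).
have vE i : vfill s p.+1 i = vfill s p i + (vfill s p i < vfill s p.+1 i).
  by case: (ltnP (vfill s p i) (vfill s p.+1 i)); rewrite /vfill; lia.
have shv' i : shape (vfill s p) v i = vfill s p.+1 i.
  rewrite /shape cv [RHS]vE; case: (ltnP i r) => //= ir.
  by rewrite /vfill Lout // !min0n.
have vdec t i := vfill_dec t i sdec.
have shE i : shape s (flatten vs ++ v) i = vfill s p.+1 i.
  by rewrite shape_cat -shv'; apply: eq_shape.
exists (rcons vs v); rewrite flatten_rcons; split.
- by rewrite all_rcons sv.
- by rewrite size_rcons szv.
- apply: prefix_cat => //; apply: prefix_vstrip => // i; rewrite ?(eq_shape _ shv) ?shv' ?shv //.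
- exact: shE.
Qed.

End Exist.

Definition dcomp w := comp_of (size w) (wdesc w).

Lemma dcompP w : [/\ is_comp (dcomp w), sumn (dcomp w) = size w
  & cuts (dcomp w) = wdesc w].
Proof.
case: w => [//|x w]; apply: comp_of_spec; apply: path_rcons_ltn => // [|k].
  by apply: sorted_filter; [exact: ltn_trans|exact: iota_ltn_sorted].
by rewrite mem_filter mem_iota => /andP[_] /=; lia.
Qed.

Lemma dcomp_same_descents w w' : dcomp w = dcomp w' -> same_descents w w'.
Proof.
have [_ s c] := dcompP w; have [_ s' c'] := dcompP w' => e.
by apply: same_descents_wdesc; rewrite ?(esym s) ?(esym c) e.
Qed.

Definition shape_words A := words (outer A) (inner A) (nboxes A).

Lemma shape_wordsP A w :
  reflect (valid (nth 0 (inner A)) (nth 0 (outer A)) w) (w \in shape_words A).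
Proof. by apply: mem_words_valid; [exact: inner_part|exact: inner_outer]. Qed.

Lemma size_shape_words A w : w \in shape_words A -> size w = nboxes A.
Proof.
by move=> /shape_wordsP h; apply: valid_size h; [exact: outer_part|exact: inner_part].
Qed.

Lemma sfunE A e : sfun A e = (\sum_(w <- shape_words A) fundamental (dcomp w) e)%R.
Proof.
rewrite /sfun skew_schur_words; [|exact: outer_part|exact: inner_part|exact: inner_outer].
by apply: eq_big_seq => w /size_shape_words h; rewrite /dcomp h.
Qed.

Lemma sum_count_le r k w : \sum_(i < r) count_mem (i + k) w <= size w.
Proof.
elim: w => [|x w IH] /=; first by rewrite big1.
rewrite big_split /= -add1n leq_add //.
case: (pickP (fun i : 'I_r => x == i + k)) => [i xi|h]; last first.
  by rewrite big1 // => i _; rewrite h.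
rewrite (bigD1 i) //= xi big1 // => j ne; apply/eqP; rewrite eqb0.
by apply: contra ne => /eqP xj; apply/eqP/val_inj => /=; move/eqP: xi; lia.
Qed.

Lemma sum_shift_le r k (G : nat -> nat) :
  \sum_(i < r) (if k <= i then G (i - k) else 0) <= \sum_(i < r) G i.
Proof.
have -> : \sum_(i < r) (if k <= i then G (i - k) else 0) = \sum_(i < r - k) G i.
  elim: r => [|r IH]; first by rewrite sub0n !big_ord0.
  rewrite big_ord_recr /= IH; case: (leqP k r) => kr.
    by rewrite subSn // big_ord_recr.
  have -> : r - k = 0 by lia.
  have -> : r.+1 - k = 0 by lia.
  by rewrite !big_ord0.
rewrite -!(big_mkord xpredT G) [X in _ <= X](@big_cat_nat _ _ _ (r - k)) ?leq_subr //=.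
exact: leq_addr.
Qed.

(* In B, fill k horizontal strips and then l vertical strips greedily; a
   tableau of shape A with the same descents fills strips of the same sizes,
   and the boxes that remain are counted by the rectangles. *)
Lemma descents_rects A B k l :
    (forall w, w \in shape_words B ->
       exists2 w', w' \in shape_words A & same_descents w w') ->
  rects k.+1 l.+1 A <= rects k.+1 l.+1 B.
Proof.
move=> sub; rewrite !rectsE.
set M := nth 0 (inner B); set L := nth 0 (outer B).
set M' := nth 0 (inner A); set L' := nth 0 (outer A).
have mdec : forall i i', i <= i' -> M i' <= M i by exact: inner_decr.
have ldec : forall i i', i <= i' -> L i' <= L i by exact: outer_decr.
have ML : forall i, M i <= L i by exact: inner_outer.
have Lout : forall i, nrows B <= i -> L i = 0 by exact: outer_out.
have [us [sus szu adu shu]] := dec_blocks_exist mdec ldec ML Lout k.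
have hdec i := hfill_dec mdec ldec k i.
have hle i : hfill M L k i <= L i by have /andP[] := hfill_bounds mdec ML k i.
have [vs [svs szv adv shv]] := inc_blocks_exist ldec Lout l hdec hle.
have vdec i := vfill_dec ldec l i hdec.
have vle i : vfill L (hfill M L k) l i <= L i by exact: geq_minl.
(* What remains is completed by [ncols B] vertical strips, which is enough because no row is
   longer. *)
have [zs [_ _ adz shz]] := inc_blocks_exist ldec Lout (ncols B) vdec vle.
pose w := flatten us ++ flatten vs ++ flatten zs.
have shuv i : shape M (flatten us ++ flatten vs) i = vfill L (hfill M L k) l i.
  by rewrite shape_cat (eq_shape _ shu) shv.
have shw i : shape M w i = L i.
  rewrite /w catA shape_cat (eq_shape _ shuv) shz /vfill; apply/minn_idPl.
  by apply: leq_trans (leq_addl _ _); exact: nth_maxpart.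
have vw : valid M L w.
  split=> //; apply: prefix_cat => // j i; rewrite !(eq_shape _ shu).
  by apply: prefix_cat => // {}j {}i; rewrite !(eq_shape _ shv).
have /sub[w' /shape_wordsP vw' sd] : w \in shape_words B by exact/shape_wordsP.
set x := size (flatten us); set y := size (flatten vs).
have sd1 := same_descents_take x sd; rewrite /w take_size_cat // in sd1.
have sd2 := same_descents_drop x sd; rewrite /w drop_size_cat // in sd2.
have sd3 := same_descents_take y sd2; rewrite take_size_cat // in sd3.
have sd4 := same_descents_drop y sd2; rewrite drop_size_cat // in sd4.
set w1 := take x w' in sd1; set w2 := take y (drop x w') in sd3.
set w3 := drop y (drop x w') in sd4.
have wE : w' = w1 ++ w2 ++ w3 by rewrite !cat_take_drop.
have [ad' sh'] := vw'.
(* In [A] the strips bring row [i + k] to length at most [M' i + l]; the rest of the row must come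
   from [w3]. *)
have low i : L' (i + k) <= M' i + l + count_mem (i + k) w3.
  have := dec_blocks_bound sus sd1 (admissible_take x ad') .
  rewrite szu => /(_ (i + k) (leq_addl _ _)); rewrite addnK.
  have := inc_blocks_bound (shape M' w1) (i + k) svs sd3; rewrite szv.
  by rewrite /L' -(sh' (i + k)) wE !shape_cat /shape /M'; lia.
have le1 : \sum_(i < nrows A) (L' (i + k) - (M' i + l)) <= size w3.
  apply: leq_trans (sum_count_le (nrows A) k w3); apply: leq_sum => i _.
  by rewrite leq_subLR; exact: low.
apply: leq_trans le1 _; have [<- _] := sd4.
have cz i : count_mem i (flatten zs) = L i - vfill L (hfill M L k) l i.
  by rewrite -shw /w catA shape_cat (eq_shape _ shuv) /shape addKn.
rewrite -(@sum_count_mem (nrows B)); last first.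
  apply/allP => i iz; apply: (valid_lt_r (outer_part B) (inner_part B) vw).
  by rewrite !mem_cat iz !orbT.
(* In [B] the greedy strips leave nothing in the first [k] rows, and in a later row [i] only what
   lies beyond [M (i - k) + l]. *)
apply: leq_trans (sum_shift_le (nrows B) k (fun i => L (i + k) - (M i + l))).
apply: leq_sum => i _; rewrite cz /vfill /hfill ltnNge.
case: (leqP k i) => ki /=; last by lia.
by rewrite subnK //; have := ML i; lia.
Qed.

(** * Positivity and supports passed from one basis to another *)

Lemma expansion_list (X : Defs.family) f s : all (indices X) s ->
    (forall e, f e = (\sum_(a <- s) member X a e)%R) ->
  expansion X f (fun a => Posz (count_mem a s)).
Proof.
move=> /allP aX fE; apply: (@expansion_intro _ _ _ s) => [a|a|e].
- by rewrite eqz_nat -lt0n -has_count has_pred1.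
- by rewrite eqz_nat -lt0n -has_count has_pred1; exact: aX.
- rewrite fE -big_undup_iterop_count; apply: eq_bigr => a _.
  by rewrite -natz mulr_natl.
Qed.

Lemma expansion_sfun_F A :
  expansion bF (sfun A) (fun a => Posz (count_mem a [seq dcomp w | w <- shape_words A])).
Proof.
apply: expansion_list => [|e]; last by rewrite big_map sfunE.
by apply/allP => a /mapP[w _ ->]; have [] := dcompP w.
Qed.

Lemma supp_F A a : supp bF A a <-> a \in [seq dcomp w | w <- shape_words A].
Proof.
split=> [[c ec ca]|ha]; last first.
  exists (fun a => Posz (count_mem a [seq dcomp w | w <- shape_words A])).
    exact: expansion_sfun_F.
  by apply/eqP; rewrite eqz_nat -lt0n -has_count has_pred1.
rewrite -has_pred1 has_count -ltz_nat lt0r lez_nat leq0n andbT.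
by rewrite (expansion_uniq triangular_F (expansion_sfun_F A) ec); apply/eqP.
Qed.

Lemma supp_F_rects A B : supp_contains bF A B -> rects_cond A B.
Proof.
move=> h [//|k] [//|l] _ _; apply: descents_rects => w wB.
have /h/supp_F/mapP[w' wA e] : supp bF B (dcomp w) by apply/supp_F/map_f.
by exists w' => //; exact: dcomp_same_descents.
Qed.

Section Transfer.

Variables X Y : Defs.family.
Hypothesis uY : forall f c d, expansion Y f c -> expansion Y f d -> c =1 d.
Hypothesis XY : forall b, indices X b -> positive Y (member X b).

(** All coefficients involved are nonnegative, so nothing cancels and the support in [Y] is the
    union of the supports of those members of [X] that occur. *)
Lemma expansion_through f c : expansion X f c -> (forall b, (0 <= c b)%R) ->
  exists D, [/\ expansion Y f D, forall a, (0 <= D a)%R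
    & forall a, D a != 0%R <-> exists b, c b != 0%R /\
        exists2 d, expansion Y (member X b) d & d a != 0%R].
Proof.
case=> s [_ /allP aX cs fE] c0.
suff [D [h1 h2 h3]] : exists D, [/\ expansion Y f D, forall a, (0 <= D a)%R
    & forall a, D a != 0%R <-> exists b, [/\ b \in s, c b != 0%R &
        exists2 d, expansion Y (member X b) d & d a != 0%R]].
  exists D; split=> // a; split=> [/h3[b [_ cb hd]]|[b [cb hd]]]; first by exists b.
  apply/h3; exists b; split=> //; apply: contraNT cb => /cs ->.
  by rewrite eqxx.
elim: s f aX fE {cs} => [|b s IH] f aX fE.
  exists (fun=> 0%R); split=> // [|a]; last by split=> [|[b []//]]; rewrite eqxx.
  by exists [::]; split=> // e; rewrite fE !big_nil.
have [D [eD D0 DE]] := IH _ (fun a h => aX a (mem_behead (h : a \in behead (b :: s)))) (fun e => erefl _).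
have [d ed d0] := XY (aX b (mem_head _ _)).
exists (fun a => D a + c b * d a)%R; split=> [|a|a].
- by apply: expansion_ext (expansion_lin (c b) eD ed) => // e; rewrite fE big_cons addrC.
- by rewrite addr_ge0 ?mulr_ge0.
have cd0 : (0 <= c b * d a)%R by rewrite mulr_ge0.
split=> [|[x [xs cx [d' ed' da']]]].
  case: (eqVneq (D a) 0%R) => [->|/DE[x [xs cx hx]] _]; last first.
    by exists x; rewrite inE xs orbT.
  rewrite add0r mulf_eq0 negb_or => /andP[cb da]; exists b; rewrite mem_head; split=> //.
  by exists d.
rewrite paddr_eq0 // negb_and; move: xs; rewrite inE => /orP[/eqP xb|xs].
  rewrite xb in ed' cx; rewrite mulf_neq0 ?orbT //.
  by rewrite (uY ed ed').
by apply/orP; left; apply/DE; exists x; split=> //; exists d'.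
Qed.

Lemma positive_through f : positive X f -> positive Y f.
Proof. by case=> c ec c0; have [D [eD D0 _]] := expansion_through ec c0; exists D. Qed.

Hypothesis uX : forall f c d, expansion X f c -> expansion X f d -> c =1 d.

Lemma supp_through A a : positive X (sfun A) -> supp Y A a <->
  exists2 b, supp X A b & exists2 d, expansion Y (member X b) d & d a != 0%R.
Proof.
case=> c ec c0; have [D [eD D0 DE]] := expansion_through ec c0.
split=> [[d ed /eqP da]|[b [c' ec' /eqP cb] hd]].
  have /DE[b [cb hb]] : D a != 0%R by rewrite (uY eD ed).
  by exists b => //; exists c => //; apply/eqP.
exists D => //; apply/eqP/DE; exists b; split=> //.
by rewrite (uX ec ec').
Qed.

Lemma supp_contains_through A B : positive X (sfun A) -> positive X (sfun B) ->
  supp_contains X A B -> supp_contains Y A B.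
Proof.
move=> pA pB h a /(supp_through a pB)[b /h hb hd].
by apply/(supp_through a pA); exists b.
Qed.

End Transfer.

Lemma positive_F_sfun A : positive bF (sfun A).
Proof.
by exists (fun a => Posz (count_mem a [seq dcomp w | w <- shape_words A]));
  first exact: expansion_sfun_F.
Qed.

Lemma positive_F_schur la : is_part la -> positive bF (schur la).
Proof.
move=> pla; have h : [forall i : 'I_(size (Nil nat)), nth 0 [::] i <= nth 0 la i].
  by apply/forallP => -[].
exact: (positive_F_sfun (SkewShape pla (isT : is_part [::]) h)).
Qed.

Lemma positive_M_fundamental a : is_comp a -> positive bM (fundamental a).
Proof.
move=> ca; pose s := [seq b <- comps (sumn a) | all (mem (cuts b)) (cuts a)].
exists (fun b => Posz (count_mem b s)) => //; apply: expansion_list => [|e].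
  by apply/allP => b; rewrite mem_filter mem_comps => /and3P[].
by rewrite big_filter.
Qed.

Lemma positive_s_sfun A : positive bs (sfun A).
Proof.
have [c cE] := schur_expansion (outer_part A) (inner_part A) (@inner_outer A).
set n := skew_size _ _ in cE.
exists (fun a => Posz (if a \in parts n then c a else 0)) => //.
apply: (@expansion_intro _ _ _ (parts n)) => [a|a|e].
- by case: ifP.
- by case: ifP => //; rewrite mem_parts => /andP[].
rewrite /sfun cE undup_id ?filter_uniq ?uniq_comps //.
by apply: eq_big_seq => a /= ->.
Qed.

(** * The implications and the separating examples *)

Lemma uniq_s f c d : expansion bs f c -> expansion bs f d -> c =1 d.
Proof. exact: (triangular_schur_of refines_D). Qed.

Lemma uniq_F f c d : expansion bF f c -> expansion bF f d -> c =1 d.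
Proof. exact: (expansion_uniq triangular_F). Qed.

Lemma uniq_M f c d : expansion bM f c -> expansion bM f d -> c =1 d.
Proof. exact: (expansion_uniq triangular_M). Qed.

Lemma positive_M_sfun A : positive bM (sfun A).
Proof. exact: (@positive_through bF bM uniq_M positive_M_fundamental _ (positive_F_sfun A)). Qed.

Section Implications.

Variables A B : skew_shape.

Lemma diff_schur_expansion : exists c, expansion bs (diff A B) c.
Proof.
have [c ec _] := positive_s_sfun A; have [d ed _] := positive_s_sfun B.
by exists (fun a => c a - d a)%R; apply: expansion_sub.
Qed.

Lemma Dpos_implies_Spos : positive bD (diff A B) -> positive bs (diff A B).
Proof. by have [c ec] := diff_schur_expansion; apply: (refined_positive refines_D ec). Qed.

Lemma Spos_iff_quasi : positive bs (diff A B) <-> positive bS (diff A B).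
Proof.
have [c ec] := diff_schur_expansion; split; last exact: (refined_positive refines_S ec).
by apply: (positive_refined refines_S).
Qed.

Lemma strict_arrow_holds c d : strict_arrow c d -> holds c A B -> holds d A B.
Proof.
case=> /=.
- exact: Dpos_implies_Spos.
- exact: (@positive_through bs bF uniq_F positive_F_schur).
- exact: (@positive_through bF bM uniq_M positive_M_fundamental).
- exact: (@supp_contains_through bs bF uniq_F positive_F_schur uniq_s A B
    (positive_s_sfun A) (positive_s_sfun B)).
- exact: (@supp_contains_through bF bM uniq_M positive_M_fundamental uniq_F A B
    (positive_F_sfun A) (positive_F_sfun B)).
- exact: (diff_supp_contains uniq_s positive_s_sfun).
- exact: (diff_supp_contains uniq_F positive_F_sfun).
- exact: (diff_supp_contains uniq_M positive_M_sfun).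
Qed.

Lemma consequence_holds c d : consequence c d -> holds c A B -> holds d A B.
Proof.
elim=> {c d} [c d [sa|-> ->]|//|c d e _ h1 _ h2 /h1/h2 //].
  exact: strict_arrow_holds.
by move=> /= /supp_F_rects/rows_rects.
Qed.

End Implications.

(** * The order on the conditions and the separating pairs *)

Definition reach c d : bool := match c, d with
  | Dpos, _ => true
  | Spos, Dpos => false
  | Spos, _ => true
  | Fpos, (Dpos | Spos | Ssupp) => false
  | Fpos, _ => true
  | Mpos, (Mpos | Msupp) => true
  | Ssupp, (Ssupp | Fsupp | Msupp | Overlap) => true
  | Fsupp, (Fsupp | Msupp | Overlap) => true
  | Msupp, Msupp => true
  | Overlap, Overlap => true
  | _, _ => false
  end.

Lemma consequence_refl c : consequence c c.
Proof. exact: rt_refl. Qed.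

Lemma consequence_step c d e : arrow c d -> consequence d e -> consequence c e.
Proof. by move=> h; apply: rt_trans; apply: rt_step. Qed.

(** [reach] tabulates the paths of arrows, so that a case analysis over pairs of conditions is
    settled by computation; the path for each entry is found by search. *)
Lemma reach_consequence c d : reach c d -> consequence c d.
Proof.
case: c; case: d => // _;
  eauto 12 using consequence_step, consequence_refl, arrow_strict, arrow_overlap,
    Dpos_Spos, Spos_Fpos, Fpos_Mpos, Ssupp_Fsupp, Fsupp_Msupp, Spos_Ssupp,
    Fpos_Fsupp, Mpos_Msupp.
Qed.

Definition separated (t f : cond) := exists A B,
  [/\ nboxes A = nboxes B, holds t A B & ~ holds f A B].

(** A pair of shapes that separates [t] from [f] refutes every implication from a condition implied
    by [t] to one that implies [f], so only extreme cases need shapes. *)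
Lemma separated_weaken t f c d : separated t f -> reach t c -> reach d f -> separated c d.
Proof.
case=> A [B [sz ht hf]] tc df; exists A, B; split=> // [|hd].
  exact: consequence_holds (reach_consequence tc) ht.
exact: hf (consequence_holds (reach_consequence df) hd).
Qed.

(** The number of boxes is taken as a sum over a list rather than as the cardinality of a finite
    set, so that [vm_compute] can run. *)
Definition dcomps (l m : seq nat) :=
  [seq dcomp w | w <- words l m (sumn [seq nth 0 l i - nth 0 m i | i <- iota 0 (size l)])].

Lemma inner_sub_all l m : all (fun i => nth 0 m i <= nth 0 l i) (iota 0 (size m)) ->
  [forall i : 'I_(size m), nth 0 m i <= nth 0 l i].
Proof. by move/allnP => h; apply/forallP => i; exact: h. Qed.

Definition skew l m pl pm (ml : all (fun i => nth 0 m i <= nth 0 l i) (iota 0 (size m))) :=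
  @SkewShape l m pl pm (inner_sub_all ml).

Lemma nboxesE A : nboxes A =
  sumn [seq nth 0 (outer A) i - nth 0 (inner A) i | i <- iota 0 (size (outer A))].
Proof. by rewrite /nboxes skew_sizeE sumn_map_iota. Qed.

Lemma dcompsE A : [seq dcomp w | w <- shape_words A] = dcomps (outer A) (inner A).
Proof. by rewrite /shape_words nboxesE. Qed.

Lemma sfun_dcomps A e :
  sfun A e = (\sum_(a <- dcomps (outer A) (inner A)) fundamental a e)%R.
Proof. by rewrite sfunE -dcompsE big_map. Qed.

Lemma is_comp_dcomps l m : all is_comp (dcomps l m).
Proof. by apply/allP => a /mapP[w _ ->]; have [] := dcompP w. Qed.

Lemma sfun_count A e : sfun A e = Posz (count (fun a => (sumn e == sumn a) &&
  all (mem (cuts (flat e))) (cuts a)) (dcomps (outer A) (inner A))).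
Proof.
rewrite sfun_dcomps; elim: (dcomps _ _) (is_comp_dcomps (outer A) (inner A)) => [|a s IH] /=.
  by rewrite big_nil.
by case/andP => ca /IH e1; rewrite big_cons e1 fundamentalE.
Qed.

Lemma schur_dcomps la e : is_part la ->
  schur la e = (\sum_(a <- dcomps la [::]) fundamental a e)%R.
Proof. by move=> pla; exact: (sfun_dcomps (@skew la [::] pla isT isT)). Qed.

(** A Schur expansion is certified by comparing two lists of descent compositions up to
    permutation. *)
Lemma schur_list A s : all is_part s ->
    perm_eq (dcomps (outer A) (inner A)) (flatten [seq dcomps la [::] | la <- s]) ->
  expansion bs (sfun A) (fun a => Posz (count_mem a s)).
Proof.
move=> ps pe; apply: expansion_list => // e.
rewrite sfun_dcomps (perm_big _ pe) big_flatten big_map; apply: eq_big_seq => la ls.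
by rewrite /= schur_dcomps //; exact: (allP ps).
Qed.

Lemma supp_schur_list A s a : expansion bs (sfun A) (fun a => Posz (count_mem a s)) ->
  supp bs A a <-> a \in s.
Proof.
move=> es; rewrite -has_pred1 has_count; split=> [[c ec /eqP]|h].
  by rewrite -(uniq_s es ec) eqz_nat lt0n.
by exists (fun a => Posz (count_mem a s)) => //; apply/eqP; rewrite eqz_nat -lt0n.
Qed.

(** The difference of the two Schur functions is [M_2], but the row contains a rectangle with one
    row and two columns and the column does not. *)
Lemma separated_Mpos_Overlap : separated Mpos Overlap.
Proof.
pose A := @skew [:: 2] [::] isT isT isT; pose B := @skew [:: 1; 1] [::] isT isT isT.
exists A, B; split; first by rewrite !nboxesE.
  exists (fun a => Posz (count_mem a [:: [:: 2]])) => //; apply: expansion_list => // e.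
  rewrite big_seq1 /= monomialE // /diff /sub_series !sfun_count /=.
  rewrite -(sumn_flat e); have := is_comp_flat e.
  case: (flat e) => [//|x [|y [|z s]]]; rewrite !is_comp_cons /=.
  - by rewrite addn0 andbT /=; case: x => [|[|[|x]]].
  - move=> /and3P[x0 y0 _]; rewrite (addn0 y) -[2 - 0 + 0]/2 -[1 - 0 + (2 - 1 + 0)]/2.
    case: (x + y =P 2) => [xy|_]; first by have -> : x = 1 by lia.
    by rewrite eqseq_cons andbF.
  - case/and4P => x0 y0 z0 _; rewrite -[2 - 0 + 0]/2 -[1 - 0 + (2 - 1 + 0)]/2 eqseq_cons andbF.
    by case: eqP => // h; exfalso; lia.
move=> /rows_rects/(_ 1 2 isT isT); rewrite !rectsE /nrows /=.
by rewrite !big_ord_recl big_ord0.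
Qed.

(** The function of [A] is s_31 + s_211. Its term [F_22], from s_31, and its term [F_121], from
    s_211, make up the s_22 of [B], which is not one of its Schur constituents. *)
Lemma separated_Fpos_Ssupp : separated Fpos Ssupp.
Proof.
pose A := @skew [:: 3; 1; 1] [:: 1] isT isT isT.
pose B := @skew [:: 2; 2] [::] isT isT isT.
exists A, B; split; first by rewrite !nboxesE.
  pose s := [:: [:: 3; 1]; [:: 1; 3]; [:: 2; 1; 1]; [:: 1; 1; 2]].
  exists (fun a => Posz (count_mem a s)) => //; apply: expansion_list => // e.
  rewrite /diff /sub_series !sfun_dcomps.
  have pe : perm_eq (dcomps (outer A) (inner A)) (dcomps (outer B) (inner B) ++ s).
    by vm_compute.
  by rewrite (perm_big _ pe) big_cat /= addrAC subrr add0r.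
have eA := @schur_list A [:: [:: 3; 1]; [:: 2; 1; 1]] isT ltac:(by vm_compute).
have eB := @schur_list B [:: [:: 2; 2]] isT ltac:(by vm_compute).
by move=> /(_ [:: 2; 2]) /=; rewrite (supp_schur_list _ eA) (supp_schur_list _ eB) => /(_ isT).
Qed.

(** The Schur supports are equal, but s_221 occurs once for [A] and twice for [B], so the difference
    is -s_221. *)
Lemma separated_Ssupp_Mpos : separated Ssupp Mpos.
Proof.
pose A := @skew [:: 3; 2; 1; 1] [:: 1; 1] isT isT isT.
pose B := @skew [:: 3; 2; 2; 1] [:: 2; 1] isT isT isT.
exists A, B; split; first by rewrite !nboxesE.
  have eA := @schur_list A [:: [:: 3; 2]; [:: 3; 1; 1]; [:: 2; 2; 1]; [:: 2; 1; 1; 1]]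
    isT ltac:(by vm_compute).
  have eB := @schur_list B [:: [:: 3; 2]; [:: 3; 1; 1]; [:: 2; 2; 1]; [:: 2; 2; 1];
    [:: 2; 1; 1; 1]] isT ltac:(by vm_compute).
  move=> a; rewrite (supp_schur_list _ eA) (supp_schur_list _ eB) !inE.
  by do !case: eqP => //= _.
case=> c [s [_ _ _ cE]] c0.
(* The value at five exponents 1 compares the numbers of standard tableaux, 20 for [A] against 25
   for [B]. *)
have : (0 <= diff A B [:: 1; 1; 1; 1; 1])%R.
  by rewrite cE; apply: sumr_ge0 => a _; rewrite mulr_ge0.
by rewrite /diff /sub_series !sfun_count; vm_compute.
Qed.

Lemma dual_sign13 : dual_sign [:: 1; 3] = (-1)%R.
Proof.
have [_ h] := @straighten_part [:: 2; 2] isT.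
(* The compositions 22 and 13 both have the shifted parts 3 and 2, in opposite orders, so one swap
   carries the known sign of 22 to that of 13 without evaluating a determinant. *)
change (match_sign 2 (rho_shift 2 (nth 0 [:: 2; 2])) (nth 0 [:: 3; 2]) = 1%R) in h.
change (match_sign 2 (rho_shift 2 (nth 0 [:: 1; 3])) (nth 0 [:: 3; 2]) = (-1)%R).
rewrite -h -(match_sign_swap _ _ (isT : 1 < 2)).
by apply: eq_match_sign => [[|[|i]]|].
Qed.

(** The difference is s_22, which equals [D_22 - D_13]. *)
Lemma separated_Spos_Dpos : separated Spos Dpos.
Proof.
pose A := @skew [:: 4; 2] [:: 2] isT isT isT.
pose B := @skew [:: 4; 1] [:: 1] isT isT isT.
have eA := @schur_list A [:: [:: 4]; [:: 3; 1]; [:: 2; 2]] isT ltac:(by vm_compute).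
have eB := @schur_list B [:: [:: 4]; [:: 3; 1]] isT ltac:(by vm_compute).
have eD := expansion_sub eA eB.
exists A, B; split; first by rewrite !nboxesE.
  eexists; first exact: eD.
  by move=> a /=; rewrite subr_ge0 lez_nat !leq_add2l.
case=> d ed /(_ [:: 1; 3]).
rewrite -(expansion_uniq (refines_tri refines_D) (expansion_refined refines_D eD) ed).
by rewrite /refined dual_sign13; vm_compute.
Qed.

Lemma cond_cases c d : [\/ consequence c d, undecided c d | separated c d].
Proof.
case: c; case: d; first
 [ by apply: Or31; apply: reach_consequence
 | by apply: Or32; split; [|left]
 | by apply: Or32; split; [|right]
 | by apply: Or33; apply: (separated_weaken separated_Mpos_Overlap)
 | by apply: Or33; apply: (separated_weaken separated_Fpos_Ssupp)
 | by apply: Or33; apply: (separated_weaken separated_Ssupp_Mpos)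
 | by apply: Or33; apply: (separated_weaken separated_Spos_Dpos) ].
Qed.

Theorem mainTheorem7 :
  (* (1) *)
  (forall A B : skew_shape,
     (positive bD (diff A B) -> positive bs (diff A B)) /\
     (positive bs (diff A B) <-> positive bS (diff A B)) /\
     (positive bs (diff A B) -> positive bF (diff A B)) /\
     (positive bF (diff A B) -> positive bM (diff A B)) /\
     (supp_contains bD A B <-> supp_contains bs A B) /\
     (psupp_contains bD A B <-> supp_contains bs A B) /\
     (supp_contains bs A B <-> supp_contains bS A B) /\
     (supp_contains bs A B -> supp_contains bF A B) /\
     (supp_contains bF A B -> supp_contains bM A B) /\
     (positive bs (diff A B) -> supp_contains bs A B) /\
     (positive bF (diff A B) -> supp_contains bF A B) /\
     (positive bM (diff A B) -> supp_contains bM A B) /\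
     (supp_contains bF A B -> rows_cond A B) /\
     (rows_cond A B <-> cols_cond A B) /\
     (rows_cond A B <-> rects_cond A B)) /\
  (* (2) *)
  (forall c d : cond, strict_arrow c d ->
     exists A B : skew_shape, holds d A B /\ ~ holds c A B) /\
  (* (3) *)
  (forall c d : cond, ~ undecided c d ->
     (forall A B : skew_shape, nboxes A = nboxes B ->
        holds c A B -> holds d A B) ->
     consequence c d) /\
  ~ (forall A B : skew_shape, nboxes A = nboxes B ->
       supp_contains bs A B -> positive bM (diff A B)) /\
  ~ (forall A B : skew_shape, nboxes A = nboxes B ->
       positive bF (diff A B) -> supp_contains bs A B) /\
  ~ (forall A B : skew_shape, nboxes A = nboxes B ->
       positive bM (diff A B) -> rows_cond A B) /\
  ~ (forall A B : skew_shape, nboxes A = nboxes B ->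
       rows_cond A B -> positive bM (diff A B)).
Proof.
split=> [A B|].
  do 2 (split; first by [exact: Dpos_implies_Spos|exact: Spos_iff_quasi]).
  split; first exact: (strict_arrow_holds Spos_Fpos).
  split; first exact: (strict_arrow_holds Fpos_Mpos).
  split; first exact: (supp_contains_refined refines_D positive_s_sfun).
  split; first exact: (psupp_contains_refined refines_D positive_s_sfun).
  split; first exact: (iff_sym (supp_contains_refined refines_S positive_s_sfun A B)).
  split; first exact: (strict_arrow_holds Ssupp_Fsupp).
  split; first exact: (strict_arrow_holds Fsupp_Msupp).
  split; first exact: (strict_arrow_holds Spos_Ssupp).
  split; first exact: (strict_arrow_holds Fpos_Fsupp).
  split; first exact: (strict_arrow_holds Mpos_Msupp).
  split; first by move/supp_F_rects/rows_rects.
  split; last exact: rows_rects.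
  by split=> [/rows_rects/cols_rects|/cols_rects/rows_rects].
split=> [c d cd|].
  suff [A [B [_ hd hc]]] : separated d c by exists A, B.
  case: cd; first
   [ by apply: (separated_weaken separated_Spos_Dpos)
   | by apply: (separated_weaken separated_Fpos_Ssupp)
   | by apply: (separated_weaken separated_Mpos_Overlap)
   | by apply: (separated_weaken separated_Ssupp_Mpos) ].
split=> [c d nu h|].
  by case: (cond_cases c d) => // -[A [B [sz hc []]]]; exact: h.
have no c d : separated c d ->
    ~ (forall A B, nboxes A = nboxes B -> holds c A B -> holds d A B).
  by case=> A [B [sz hc nd]] h; exact: nd (h A B sz hc).
split; first exact: (no Ssupp Mpos separated_Ssupp_Mpos).
split; first exact: (no Fpos Ssupp separated_Fpos_Ssupp).
split; first exact: (no Mpos Overlap separated_Mpos_Overlap).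
(* Containment of Schur supports implies the overlap condition, so the pair with difference -s_221
   serves again. *)
by apply: (no Overlap Mpos); apply: (separated_weaken separated_Ssupp_Mpos).
Qed.
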